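(* Let $(W,S)$ be a finite Coxeter group, $R$ a commutative ring, $(q_s)_{s\in S}$ a family of invertible elements of $R$ with $q_s=q_t$ whenever $s,t\in S$ are $W$-conjugate, and $\mathcal{H}$ the associated Hecke algebra over $R$. Then $X(\mathcal{H})\otimes_{\mathcal{H}}-$ induces an auto-equivalence of the homotopy category $\mathbf{K}^{\mathbf b}(\mathcal{H})$.
   Context: Hecke algebra: $\mathcal{H}=\bigoplus_{w\in W}Rh_w$ is the $R$-free associative algebra with $h_wh_{w'}=h_{ww'}$ whenever $l(ww')=l(w)+l(w')$ ($l$ the length with respect to $S$), and $(h_s)^2=(q_s-1)h_s+q_s$ for $s\in S$. For $I\subseteq S$, $W_I=\langle I\rangle$ and $\mathcal{H}_I=\bigoplus_{w\in W_I}Rh_w$, a subalgebra of $\mathcal{H}$. Complexes: $\mathbf{K}^{\mathbf b}(A)$ is the homotopy category of bounded cochain complexes of finitely generated left $A$-modules. A coefficient system on the set $2^S$ of subsets of $S$ is a family of modules $(M^I)_{I\subseteq S}$ with restriction maps $\varphi_{JI}:M^I\to M^J$ for $I\subseteq J$ satisfying $\varphi_{KJ}\varphi_{JI}=\varphi_{KI}$. Fixing a total order on $S$ and letting $n(I,s)$ be the number of elements of $I$ that are $<s$, its associated complex has $\bigoplus_{|I|=i}M^I$ in degree $i$ and differential $\sum_{s\in S\setminus I}(-1)^{n(I,s)}\varphi_{I\cup\{s\},I}$ on $M^I$. $X(\mathcal{H})$ is the complex of $\mathcal{H}$-bimodules associated with the coefficient system on $2^S$ given by $X(\mathcal{H})^I=\mathcal{H}\otimes_{\mathcal{H}_I}\mathcal{H}$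 and $\varphi_{JI}(h\otimes_{\mathcal{H}_I}h')=h\otimes_{\mathcal{H}_J}h'$ for $I\subseteq J$. Tensor products of complexes are total complexes. *)

(* Defs.v *)
From HB Require Import structures.
From mathcomp Require Import all_boot all_order all_algebra all_fingroup.
From mathcomp Require Import generic_quotient.
From mathcomp Require Import boolp.

Set Implicit Arguments.
Unset Strict Implicit.
Unset Printing Implicit Defensive.

Import GRing.Theory.
Local Open Scope ring_scope.

(* [rscale v b] is v . b; the left action of A is the library's scaling. *)
HB.mixin Record Lmodule_isBimodule (A B : pzRingType) V of GRing.Lmodule A V := {
  rscale : V -> B -> V;
  rscaleA : forall v b c, rscale (rscale v b) c = rscale v (b * c);
  rscale1 : forall v, rscale v 1 = v;
  rscaleDl : forall v w b, rscale (v + w) b = rscale v b + rscale w b;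
  rscaleDr : forall v b c, rscale v (b + c) = rscale v b + rscale v c;
  rscaleZ : forall (a : A) v b, rscale (a *: v) b = a *: rscale v b
}.

#[short(type="bimodType")]
HB.structure Definition Bimodule (A B : pzRingType) :=
  {V of GRing.Lmodule A V & Lmodule_isBimodule A B V}.

Section RegularBimodule.
Variable A : pzRingType.
HB.instance Definition _ :=
  @Lmodule_isBimodule.Build A A A^o (fun x b => x * b : A)
    (fun v b c => esym (@mulrA A v b c)) (@mulr1 A)
    (fun v w b => @mulrDl A v w b) (fun v b c => @mulrDr A v b c)
    (fun a v b => esym (@mulrA A a v b)).
End RegularBimodule.

Record bimodMap (A B : pzRingType) (M N : bimodType A B) := BimodMap {
  bimodMap_lin :> {linear M -> N};
  bimodMapr : forall (x : M) (b : B),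
    bimodMap_lin (rscale x b) = rscale (bimodMap_lin x) b
}.

Section Tensor.
Variables (A B : pzRingType) (P : B -> Prop) (M : bimodType A B) (N : lmodType B).

(* The tensor product of M and N over the subring P of B (all of B is
   [whole B] below) is the quotient of the formal finite sums of pairs (x, y) by
   the congruence generated by biadditivity and x b (x) y = x (x) b y for b in
   P.  The sums are finite sequences up to order; the formal opposite of (x, y)
   is (- x, y), so that killing the pairs (0, y) makes the quotient a group. *)
Inductive tens_rel : seq (M * N) -> seq (M * N) -> Prop :=
| tens_refl l : tens_rel l l
| tens_sym l1 l2 : tens_rel l1 l2 -> tens_rel l2 l1
| tens_trans l1 l2 l3 : tens_rel l1 l2 -> tens_rel l2 l3 -> tens_rel l1 l3
| tens_cat l1 l2 k1 k2 :
    tens_rel l1 k1 -> tens_rel l2 k2 -> tens_rel (l1 ++ l2) (k1 ++ k2)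
| tens_comm l1 l2 : tens_rel (l1 ++ l2) (l2 ++ l1)
| tens_zero y : tens_rel [:: (0, y)] [::]
| tens_addl x x' y : tens_rel [:: (x + x', y)] [:: (x, y); (x', y)]
| tens_addr x y y' : tens_rel [:: (x, y + y')] [:: (x, y); (x, y')]
| tens_bal x b y : P b -> tens_rel [:: (rscale x b, y)] [:: (x, b *: y)].

Definition tens_relb (l1 l2 : seq (M * N)) : bool := `[< tens_rel l1 l2 >].

Lemma tens_relb_equiv : equiv_class_of tens_relb.
Proof.
split=> [x|x y|y x z]; rewrite /tens_relb.
- by apply/asboolP; exact: tens_refl.
- by apply/asboolP/asboolP; exact: tens_sym.
- by move=> /asboolP h1 /asboolP h2; apply/asboolP; exact: tens_trans h1 h2.
Qed.

Canonical tens_relb_equiv_rel := EquivRelPack tens_relb_equiv.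
Canonical tens_relb_encModRel := defaultEncModRel tens_relb.

Definition tens := {eq_quot tens_relb}%qT.
HB.instance Definition _ := EqQuotient.on tens.
HB.instance Definition _ := Choice.on tens.

Definition tens_cls (l : seq (M * N)) : tens := (\pi_tens l)%qT.
Definition pure (x : M) (y : N) : tens := tens_cls [:: (x, y)].

Lemma tens_clsP l1 l2 : tens_rel l1 l2 <-> tens_cls l1 = tens_cls l2.
Proof.
split=> [h|/eqP]; first by apply/eqP; rewrite /tens_cls piE; apply/asboolP.
by rewrite /tens_cls piE => /asboolP.
Qed.

Lemma tens_repr t : tens_cls (repr t) = t.
Proof. by rewrite /tens_cls reprK. Qed.

Lemma repr_rel l : tens_rel (repr (tens_cls l)) l.
Proof. by apply/tens_clsP; rewrite tens_repr. Qed.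

Definition opp1 (p : M * N) : M * N := (- p.1, p.2).
Definition tens_add (t u : tens) : tens := tens_cls (repr t ++ repr u).
Definition tens_opp (t : tens) : tens := tens_cls (map opp1 (repr t)).

Lemma tens_addE l1 l2 : tens_add (tens_cls l1) (tens_cls l2) = tens_cls (l1 ++ l2).
Proof. by apply/tens_clsP/tens_cat; apply: repr_rel. Qed.

Lemma tens_rel0 l : tens_rel (map opp1 l ++ l) [::].
Proof.
elim: l => [|[x y] l IH]; first exact: tens_refl.
have h1 : tens_rel (map opp1 l ++ ([:: (x, y)] ++ l))
    (([:: (x, y)] ++ l) ++ map opp1 l) by exact: tens_comm.
have h2 : tens_rel (([:: (x, y)] ++ l) ++ map opp1 l)
    ([:: (x, y)] ++ (map opp1 l ++ l)).
  by rewrite -catA; apply: tens_cat; [exact: tens_refl | exact: tens_comm].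
have h3 := tens_cat (tens_refl [:: (- x, y)]) (tens_trans h1 h2).
have h4 : tens_rel ([:: (- x, y)] ++ [:: (x, y)]) [::].
  apply: tens_trans (tens_zero y); apply: tens_sym.
  by rewrite -{1}(addNr x); exact: tens_addl.
have := tens_cat h4 IH; rewrite -catA => h5.
exact: tens_trans h3 h5.
Qed.

Fact tens_addA : associative tens_add.
Proof.
move=> t u v; rewrite -(tens_repr t) -(tens_repr u) -(tens_repr v).
by rewrite !tens_addE catA.
Qed.
Fact tens_addC : commutative tens_add.
Proof. by move=> t u; apply/tens_clsP/tens_comm. Qed.
Fact tens_add0 : left_id (tens_cls [::]) tens_add.
Proof. by move=> t; rewrite -(tens_repr t) tens_addE. Qed.
Fact tens_addN : left_inverse (tens_cls [::]) tens_opp tens_add.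
Proof.
move=> t; rewrite -{2}(tens_repr t) /tens_opp tens_addE.
exact/tens_clsP/tens_rel0.
Qed.

HB.instance Definition _ :=
  GRing.isZmodule.Build tens tens_addA tens_addC tens_add0 tens_addN.

Lemma tens_cls0 : tens_cls [::] = 0. Proof. by []. Qed.
Lemma tens_clsD l1 l2 : tens_cls (l1 ++ l2) = tens_cls l1 + tens_cls l2.
Proof. by rewrite -tens_addE. Qed.

Lemma pureDl x x' y : pure (x + x') y = pure x y + pure x' y.
Proof. by rewrite /pure -tens_clsD; apply/tens_clsP/tens_addl. Qed.
Lemma pureDr x y y' : pure x (y + y') = pure x y + pure x y'.
Proof. by rewrite /pure -tens_clsD; apply/tens_clsP/tens_addr. Qed.
Lemma pure_bal x b y : P b -> pure (rscale x b) y = pure x (b *: y).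
Proof. by move=> Pb; apply/tens_clsP/tens_bal. Qed.
Lemma pure0l y : pure 0 y = 0.
Proof. by apply: (addrI (pure 0 y)); rewrite -pureDl !addr0. Qed.
Lemma pure0r x : pure x 0 = 0.
Proof. by apply: (addrI (pure x 0)); rewrite -pureDr !addr0. Qed.

Lemma tens_clsE l : tens_cls l = \sum_(p <- l) pure p.1 p.2.
Proof.
elim: l => [|[x y] l IH]; first by rewrite big_nil.
by rewrite big_cons -IH -cat1s tens_clsD.
Qed.

Definition balanced (Z : zmodType) (f : M -> N -> Z) : Prop :=
  [/\ forall x x' y, f (x + x') y = f x y + f x' y,
      forall x y y', f x (y + y') = f x y + f x y'
    & forall x b y, P b -> f (rscale x b) y = f x (b *: y)].

(* The additive map x (x) y |-> f x y; only meaningful for balanced f. *)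
Definition tens_lift (Z : zmodType) (f : M -> N -> Z) (t : tens) : Z :=
  \sum_(p <- repr t) f p.1 p.2.

Section Lift.
Variables (Z : zmodType) (f : M -> N -> Z).
Hypothesis bf : balanced f.

Lemma lift_rel l1 l2 : tens_rel l1 l2 ->
  \sum_(p <- l1) f p.1 p.2 = \sum_(p <- l2) f p.1 p.2.
Proof.
case: bf => fDl fDr fb; elim=> {l1 l2} //.
- by move=> l1 l2 l3 _ -> _ ->.
- by move=> l1 l2 k1 k2 _ e1 _ e2; rewrite !big_cat e1 e2.
- by move=> l1 l2; rewrite !big_cat /= addrC.
- move=> y; rewrite big_seq1 big_nil /=.
  by apply: (addrI (f 0 y)); rewrite -fDl !addr0.
- by move=> x x' y; rewrite !big_cons !big_nil /= !addr0 fDl.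
- by move=> x y y'; rewrite !big_cons !big_nil /= !addr0 fDr.
- by move=> x b y Pb; rewrite !big_seq1 /= fb.
Qed.

Lemma tens_liftE l : tens_lift f (tens_cls l) = \sum_(p <- l) f p.1 p.2.
Proof. exact/lift_rel/repr_rel. Qed.

Lemma tens_lift_pure x y : tens_lift f (pure x y) = f x y.
Proof. by rewrite tens_liftE big_seq1. Qed.

Lemma tens_liftD t u : tens_lift f (t + u) = tens_lift f t + tens_lift f u.
Proof.
rewrite -(tens_repr t) -(tens_repr u) -tens_clsD !tens_liftE.
by rewrite big_cat.
Qed.
End Lift.

Lemma tens_ind (Q : tens -> Prop) :
  Q 0 -> (forall x y, Q (pure x y)) -> (forall t u, Q t -> Q u -> Q (t + u)) ->
  forall t, Q t.
Proof.
move=> Q0 Qp QD t; rewrite -(tens_repr t) tens_clsE.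
by apply: big_ind => // i _; apply: Qp.
Qed.

Lemma tens_eq (Z : zmodType) (f g : tens -> Z) :
  {morph f : x y / x + y} -> {morph g : x y / x + y} ->
  (forall x y, f (pure x y) = g (pure x y)) -> f =1 g.
Proof.
move=> fD gD fg; elim/tens_ind => //; last by move=> t u e1 e2; rewrite fD gD e1 e2.
have add0 (k : tens -> Z) : {morph k : x y / x + y} -> k 0 = 0.
  by move=> kD; apply: (addrI (k 0)); rewrite -kD !addr0.
by rewrite !add0.
Qed.

Definition tens_scale (a : A) : tens -> tens :=
  tens_lift (fun x y => pure (a *: x) y).

Lemma tens_scale_bal a : balanced (fun x y => pure (a *: x) y).
Proof.
split=> [x x' y|x y y'|x b y Pb]; first by rewrite scalerDr pureDl.
- by rewrite pureDr.
- by rewrite -rscaleZ pure_bal.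
Qed.

Fact tens_scaleA a b t : tens_scale a (tens_scale b t) = tens_scale (a * b) t.
Proof.
have D c := tens_liftD (tens_scale_bal c).
apply: (tens_eq (f := fun t => tens_scale a (tens_scale b t))) t => [t u|t u|x y].
- by rewrite /tens_scale !D.
- exact: D.
- by rewrite /tens_scale !tens_lift_pure ?scalerA //; apply: tens_scale_bal.
Qed.
Fact tens_scale1 : left_id 1 tens_scale.
Proof.
move=> t; apply: (tens_eq (f := fun t => tens_scale 1 t) (g := id)) t => //.
- exact: (tens_liftD (tens_scale_bal 1)).
- by move=> x y; rewrite /tens_scale tens_lift_pure ?scale1r //; apply: tens_scale_bal.
Qed.
Fact tens_scaleDr : right_distributive tens_scale +%R.
Proof. by move=> a; apply: (tens_liftD (tens_scale_bal a)). Qed.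
Fact tens_scaleDl t : {morph tens_scale^~ t : a b / a + b}.
Proof.
move=> a b; have D c := tens_liftD (tens_scale_bal c).
apply: (tens_eq (g := fun t => tens_scale a t + tens_scale b t)) t => [|t u|x y].
- exact: D.
- by rewrite /tens_scale !D addrACA.
- by rewrite /tens_scale !tens_lift_pure ?scalerDl ?pureDl //; apply: tens_scale_bal.
Qed.

HB.instance Definition _ := GRing.Zmodule_isLmodule.Build A tens
  tens_scaleA tens_scale1 tens_scaleDr tens_scaleDl.

Lemma pureZ a x y : a *: pure x y = pure (a *: x) y.
Proof. exact: (tens_lift_pure (tens_scale_bal a)). Qed.

Lemma tens_lift_linear (V : lmodType A) (f : M -> N -> V) :
  balanced f -> (forall a x y, f (a *: x) y = a *: f x y) ->
  linear (tens_lift f).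
Proof.
move=> bf fZ a t u; rewrite (tens_liftD bf); congr (_ + _).
apply: (tens_eq (f := fun t => tens_lift f (a *: t))
  (g := fun t => a *: tens_lift f t)) t => [t v|t v|x y].
- by rewrite scalerDr (tens_liftD bf).
- by rewrite (tens_liftD bf) scalerDr.
- by rewrite pureZ !(tens_lift_pure bf) fZ.
Qed.

End Tensor.

Arguments pure {A B} P {M N} x y.
Arguments tens_lift {A B P M N Z} f t.

Section TensorBimodule.
Variables (A B C : pzRingType) (P : B -> Prop) (M : bimodType A B) (N : bimodType B C).
Local Notation T := (tens P M N).

Definition tens_rscale (t : T) (c : C) : T :=
  tens_lift (fun x y => pure P x (rscale y c)) t.

Lemma tens_rscale_bal c : balanced P (fun (x : M) (y : N) => pure P x (rscale y c)).
Proof.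
split=> [x x' y|x y y'|x b y Pb]; first by rewrite pureDl.
- by rewrite rscaleDl pureDr.
- by rewrite rscaleZ pure_bal.
Qed.

Let rD c := tens_liftD (tens_rscale_bal c).
Let rp c := tens_lift_pure (tens_rscale_bal c).

Fact tens_rscaleA t c d : tens_rscale (tens_rscale t c) d = tens_rscale t (c * d).
Proof.
apply: (tens_eq (f := fun t => tens_rscale (tens_rscale t c) d)
  (g := fun t => tens_rscale t (c * d))) t => [t u|t u|x y]; rewrite /tens_rscale.
- by rewrite !rD.
- by rewrite !rD.
- by rewrite !rp rscaleA.
Qed.
Fact tens_rscale1 t : tens_rscale t 1 = t.
Proof.
apply: (tens_eq (f := fun t => tens_rscale t 1) (g := id)) t => [t u|//|x y];
  rewrite /tens_rscale.
- by rewrite !rD.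
- by rewrite !rp rscale1.
Qed.
Fact tens_rscaleDl t u c : tens_rscale (t + u) c = tens_rscale t c + tens_rscale u c.
Proof. exact: rD. Qed.
Fact tens_rscaleDr t c d : tens_rscale t (c + d) = tens_rscale t c + tens_rscale t d.
Proof.
apply: (tens_eq (f := fun t => tens_rscale t (c + d))
  (g := fun t => tens_rscale t c + tens_rscale t d)) t => [t u|t u|x y];
  rewrite /tens_rscale.
- by rewrite !rD.
- by rewrite !rD addrACA.
- by rewrite !rp rscaleDr pureDr.
Qed.
Fact tens_rscaleZ a t c : tens_rscale (a *: t) c = a *: tens_rscale t c.
Proof.
apply: (tens_eq (f := fun t => tens_rscale (a *: t) c)
  (g := fun t => a *: tens_rscale t c)) t => [t u|t u|x y]; rewrite /tens_rscale.
- by rewrite scalerDr rD.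
- by rewrite rD scalerDr.
- by rewrite pureZ !rp pureZ.
Qed.

HB.instance Definition _ := Lmodule_isBimodule.Build A C T
  tens_rscaleA tens_rscale1 tens_rscaleDl tens_rscaleDr tens_rscaleZ.

Lemma pure_rscale x y c : rscale (pure P x y : T) c = pure P x (rscale y c).
Proof. exact: rp. Qed.

End TensorBimodule.

Section TensorMap.
Variables (A B : pzRingType) (P : B -> Prop) (M M' : bimodType A B) (N N' : lmodType B).
Variables (f : bimodMap M M') (g : {linear N -> N'}).

Lemma tens_map_bal : balanced P (fun x y => pure P (f x) (g y)).
Proof.
split=> [x x' y|x y y'|x b y Pb]; first by rewrite linearD pureDl.
- by rewrite linearD pureDr.
- by rewrite bimodMapr linearZ pure_bal.
Qed.

Definition tens_map : tens P M N -> tens P M' N' :=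
  tens_lift (fun x y => pure P (f x) (g y)).

Fact tens_map_linear : linear tens_map.
Proof.
by apply: tens_lift_linear tens_map_bal _ => a x y; rewrite linearZ pureZ.
Qed.
HB.instance Definition _ := GRing.isLinear.Build A _ _ _ tens_map tens_map_linear.

Lemma tens_mapE x y : tens_map (pure P x y) = pure P (f x) (g y).
Proof. exact: tens_lift_pure tens_map_bal x y. Qed.
End TensorMap.
Arguments tens_map {A B} P {M M' N N'} f g _.

Section TensorWiden.
Variables (A B C : pzRingType) (P Q : B -> Prop) (M : bimodType A B) (N : bimodType B C).
Hypothesis PQ : forall b, P b -> Q b.

(* M (x)_P N -> M (x)_Q N for subrings P <= Q of B *)
Definition tens_widen : tens P M N -> tens Q M N := tens_lift (fun x y => pure Q x y).

Lemma tens_widen_bal : balanced P (fun (x : M) (y : N) => pure Q x y).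
Proof.
split=> *; rewrite ?pureDl ?pureDr //.
by apply: pure_bal; apply: PQ.
Qed.
Fact tens_widen_linear : linear tens_widen.
Proof. by apply: tens_lift_linear tens_widen_bal _ => a x y; rewrite pureZ. Qed.

Definition tens_widen_lin : {linear tens P M N -> tens Q M N} :=
  HB.pack tens_widen (GRing.isLinear.Build A _ _ _ tens_widen tens_widen_linear).

Lemma tens_widen_lin_pure x y : tens_widen_lin (pure P x y) = pure Q x y.
Proof. exact: tens_lift_pure tens_widen_bal x y. Qed.

Lemma tens_widen_r t c : tens_widen_lin (rscale t c) = rscale (tens_widen_lin t) c.
Proof.
apply: (tens_eq (f := fun t => tens_widen_lin (rscale t c))
  (g := fun t => rscale (tens_widen_lin t) c)) t => [t u|t u|x y].
- by rewrite rscaleDl linearD.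
- by rewrite linearD rscaleDl.
- by rewrite pure_rscale !tens_widen_lin_pure pure_rscale.
Qed.

Definition tens_widen_bimod : bimodMap (tens P M N) (tens Q M N) :=
  BimodMap tens_widen_r.

Lemma tens_widen_bimod_pure x y : tens_widen_bimod (pure P x y) = pure Q x y.
Proof. exact: tens_widen_lin_pure. Qed.
End TensorWiden.

(* The direct sum of the M i over those i satisfying P: families with finite
   support contained in P. *)
Record dsum (A : pzRingType) (I : choiceType) (P : pred I) (M : I -> lmodType A) := DSum {
  dsum_fun :> forall i, M i;
  dsum_off : forall i, ~~ P i -> dsum_fun i = 0;
  dsum_fin : exists s : seq I, forall i, i \notin s -> dsum_fun i = 0
}.

Section DirectSum.
Variables (A : pzRingType) (I : choiceType) (P : pred I) (M : I -> lmodType A).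
Local Notation D := (dsum P M).

Lemma dsumP (x y : D) : (forall i, x i = y i) -> x = y.
Proof.
case: x y => [x px fx] [y py fy] /= xy.
have {}xy : x = y by apply: functional_extensionality_dep.
by subst y; congr DSum; apply: Prop_irrelevance.
Qed.

HB.instance Definition _ := gen_eqMixin D.
HB.instance Definition _ := gen_choiceMixin D.

Definition dsum0 : D.
Proof. by exists (fun i => 0) => //; exists [::]. Defined.
Definition dsum_opp (x : D) : D.
Proof.
exists (fun i => - x i) => [i Pi|]; first by rewrite dsum_off ?oppr0.
by have [s hs] := dsum_fin x; exists s => i /hs ->; rewrite oppr0.
Defined.
Definition dsum_add (x y : D) : D.
Proof.
exists (fun i => x i + y i) => [i Pi|]; first by rewrite !dsum_off ?addr0.
have [s hs] := dsum_fin x; have [t ht] := dsum_fin y; exists (s ++ t) => i.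
by rewrite mem_cat negb_or => /andP[/hs -> /ht ->]; rewrite addr0.
Defined.
Definition dsum_scale (a : A) (x : D) : D.
Proof.
exists (fun i => a *: x i) => [i Pi|]; first by rewrite dsum_off ?scaler0.
by have [s hs] := dsum_fin x; exists s => i /hs ->; rewrite scaler0.
Defined.

Fact dsum_addA : associative dsum_add.
Proof. by move=> x y z; apply: dsumP => i /=; rewrite addrA. Qed.
Fact dsum_addC : commutative dsum_add.
Proof. by move=> x y; apply: dsumP => i /=; rewrite addrC. Qed.
Fact dsum_add0 : left_id dsum0 dsum_add.
Proof. by move=> x; apply: dsumP => i /=; rewrite add0r. Qed.
Fact dsum_addN : left_inverse dsum0 dsum_opp dsum_add.
Proof. by move=> x; apply: dsumP => i /=; rewrite addNr. Qed.
HB.instance Definition _ :=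
  GRing.isZmodule.Build D dsum_addA dsum_addC dsum_add0 dsum_addN.

Fact dsum_scaleA a b x : dsum_scale a (dsum_scale b x) = dsum_scale (a * b) x.
Proof. by apply: dsumP => i /=; rewrite scalerA. Qed.
Fact dsum_scale1 : left_id 1 dsum_scale.
Proof. by move=> x; apply: dsumP => i /=; rewrite scale1r. Qed.
Fact dsum_scaleDr : right_distributive dsum_scale +%R.
Proof. by move=> a x y; apply: dsumP => i /=; rewrite scalerDr. Qed.
Fact dsum_scaleDl x : {morph dsum_scale^~ x : a b / a + b}.
Proof. by move=> a b; apply: dsumP => i /=; rewrite scalerDl. Qed.
HB.instance Definition _ := GRing.Zmodule_isLmodule.Build A D
  dsum_scaleA dsum_scale1 dsum_scaleDr dsum_scaleDl.

Lemma dsumD (x y : D) i : (x + y) i = x i + y i. Proof. by []. Qed.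
Lemma dsumN (x : D) i : (- x) i = - x i. Proof. by []. Qed.
Lemma dsumZ a (x : D) i : (a *: x) i = a *: x i. Proof. by []. Qed.
Lemma dsum0E i : (0 : D) i = 0. Proof. by []. Qed.

End DirectSum.

Section DirectSumBimodule.
Variables (A B : pzRingType) (I : choiceType) (P : pred I) (M : I -> bimodType A B).
Local Notation D := (dsum P (fun i => M i : lmodType A)).

Lemma rscale0 (V : bimodType A B) b : rscale (0 : V) b = 0.
Proof. by apply: (addrI (rscale 0 b)); rewrite -rscaleDl !addr0. Qed.

Definition dsum_rscale (x : D) (b : B) : D.
Proof.
exists (fun i => rscale (x i : M i) b) => [i Pi|]; first by rewrite dsum_off ?rscale0.
by have [s hs] := dsum_fin x; exists s => i /hs ->; rewrite rscale0.
Defined.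

Fact dsum_rscaleA x b c : dsum_rscale (dsum_rscale x b) c = dsum_rscale x (b * c).
Proof. by apply: dsumP => i /=; rewrite rscaleA. Qed.
Fact dsum_rscale1 x : dsum_rscale x 1 = x.
Proof. by apply: dsumP => i /=; rewrite rscale1. Qed.
Fact dsum_rscaleDl x y b : dsum_rscale (x + y) b = dsum_rscale x b + dsum_rscale y b.
Proof. by apply: dsumP => i /=; rewrite rscaleDl. Qed.
Fact dsum_rscaleDr x b c : dsum_rscale x (b + c) = dsum_rscale x b + dsum_rscale x c.
Proof. by apply: dsumP => i /=; rewrite rscaleDr. Qed.
Fact dsum_rscaleZ a x b : dsum_rscale (a *: x) b = a *: dsum_rscale x b.
Proof. by apply: dsumP => i /=; rewrite rscaleZ. Qed.
HB.instance Definition _ := Lmodule_isBimodule.Build A B D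
  dsum_rscaleA dsum_rscale1 dsum_rscaleDl dsum_rscaleDr dsum_rscaleZ.

Definition dsum_bimod : bimodType A B := D.
End DirectSumBimodule.

Section DirectSumMap.
Variables (A : pzRingType) (I J : choiceType) (P : pred I) (Q : pred J).
Variables (M : I -> lmodType A) (N : J -> lmodType A).
Variable F : dsum P M -> forall j, N j.
Hypothesis Foff : forall x j, ~~ Q j -> F x j = 0.
Hypothesis Ffin : forall x, exists s : seq J, forall j, j \notin s -> F x j = 0.
Hypothesis Flin : forall a x y j, F (a *: x + y) j = a *: F x j + F y j.

Definition dsum_map (x : dsum P M) : dsum Q N := DSum (Foff x) (Ffin x).
Fact dsum_map_linear : linear dsum_map.
Proof. by move=> a x y; apply: dsumP => j; apply: Flin. Qed.
Definition dsum_lin : {linear dsum P M -> dsum Q N} :=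
  HB.pack dsum_map (GRing.isLinear.Build A _ _ _ dsum_map dsum_map_linear).
End DirectSumMap.

(* Cochain complexes indexed by all integers.  The differential is given as a
   family of maps between any two degrees, vanishing unless the target degree
   is the successor of the source degree; this avoids transports along
   equalities between degrees. *)
Record complex (A : pzRingType) := Complex {
  cobj :> int -> lmodType A;
  cdiff : forall i j, {linear cobj i -> cobj j};
  cdiff_shape : forall i j x, j != i + 1 -> cdiff i j x = 0;
  cdiffK : forall i j k x, cdiff j k (cdiff i j x) = 0
}.

Record bimodComplex (A B : pzRingType) := BimodComplex {
  bobj :> int -> bimodType A B;
  bdiff : forall i j, bimodMap (bobj i) (bobj j);
  bdiff_shape : forall i j x, j != i + 1 -> bdiff i j x = 0;
  bdiffK : forall i j k x, bdiff j k (bdiff i j x) = 0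
}.

Record chainMap (A : pzRingType) (C D : complex A) := ChainMap {
  cmap :> forall i, {linear C i -> D i};
  cmapE : forall i j x, cmap j (cdiff C i j x) = cdiff D i j (cmap i x)
}.

Definition homotopic (A : pzRingType) (C D : complex A) (f g : chainMap C D) : Prop :=
  exists h : forall i j, {linear C i -> D j},
    forall i (x : C i),
      f i x - g i x =
        cdiff D (i - 1) i (h i (i - 1) x) + h (i + 1) i (cdiff C i (i + 1) x).

(* Categories whose morphism sets are setoids: [heq] is the equality of
   morphisms. *)
Record category := Category {
  ob :> Type;
  hom : ob -> ob -> Type;
  heq : forall a b, hom a b -> hom a b -> Prop;
  idm : forall a, hom a a;
  comp : forall a b c, hom b c -> hom a b -> hom a c;
  heq_refl : forall a b (f : hom a b), heq f f;
  heq_sym : forall a b (f g : hom a b), heq f g -> heq g f;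
  heq_trans : forall a b (f g h : hom a b), heq f g -> heq g h -> heq f h;
  heq_comp : forall a b c (f f' : hom b c) (g g' : hom a b),
    heq f f' -> heq g g' -> heq (comp f g) (comp f' g');
  comp1m : forall a b (f : hom a b), heq (comp (idm b) f) f;
  compm1 : forall a b (f : hom a b), heq (comp f (idm a)) f;
  compA : forall a b c d (f : hom c d) (g : hom b c) (h : hom a b),
    heq (comp f (comp g h)) (comp (comp f g) h)
}.
Arguments idm {_} a.

Record functor (C D : category) := Functor {
  fob :> C -> D;
  fhom : forall a b, hom a b -> hom (fob a) (fob b);
  fhom_heq : forall a b (f g : hom a b), heq f g -> heq (fhom f) (fhom g);
  fhom1 : forall a, heq (fhom (idm a)) (idm (fob a));
  fhomM : forall a b c (f : hom b c) (g : hom a b),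
    heq (fhom (comp f g)) (comp (fhom f) (fhom g))
}.

Definition id_functor (C : category) : functor C C :=
  {| fob := id; fhom := fun a b => id;
     fhom_heq := fun a b f g e => e;
     fhom1 := fun a => heq_refl _;
     fhomM := fun a b c f g => heq_refl _ |}.

Program Definition comp_functor (C D E : category) (G : functor D E) (F : functor C D) :
  functor C E :=
  {| fob := fun a => G (F a); fhom := fun a b f => fhom G (fhom F f) |}.
Next Obligation. by apply/fhom_heq/fhom_heq. Qed.
Next Obligation. exact: heq_trans (fhom_heq _ (fhom1 _ _)) (fhom1 _ _). Qed.
Next Obligation. exact: heq_trans (fhom_heq _ (fhomM _ _ _)) (fhomM _ _ _). Qed.

Definition naturally_isomorphic (C D : category) (F G : functor C D) : Prop :=
  exists (eta : forall a, hom (F a) (G a)) (eps : forall a, hom (G a) (F a)),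
    [/\ forall a b (f : hom a b),
          heq (comp (eta b) (fhom F f)) (comp (fhom G f) (eta a)),
        forall a, heq (comp (eps a) (eta a)) (idm (F a))
      & forall a, heq (comp (eta a) (eps a)) (idm (G a))].

Definition is_equivalence (C D : category) (F : functor C D) : Prop :=
  exists G : functor D C,
    naturally_isomorphic (comp_functor G F) (id_functor C) /\
    naturally_isomorphic (comp_functor F G) (id_functor D).

Program Definition full_subcategory (C : category) (P : C -> Prop) : category :=
  {| ob := {a : C | P a};
     hom := fun a b => hom (sval a) (sval b);
     heq := fun a b f g => heq f g;
     idm := fun a => idm (sval a);
     comp := fun a b c f g => comp f g |}.
Next Obligation. exact: heq_refl. Qed.
Next Obligation. exact: heq_sym. Qed.
Next Obligation. exact: heq_trans H H0. Qed.
Next Obligation. exact: heq_comp. Qed.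
Next Obligation. exact: comp1m. Qed.
Next Obligation. exact: compm1. Qed.
Next Obligation. exact: compA. Qed.

Program Definition restrict (C D : category) (P : C -> Prop) (Q : D -> Prop)
    (F : functor C D) (PQ : forall a, P a -> Q (F a)) :
    functor (full_subcategory P) (full_subcategory Q) :=
  {| fob := fun a => exist _ (F (sval a)) (PQ _ (svalP a));
     fhom := fun a b f => fhom F f |}.
Next Obligation. exact: fhom_heq. Qed.
Next Obligation. exact: fhom1. Qed.
Next Obligation. exact: fhomM. Qed.

Section HomotopyCategory.
Variable A : pzRingType.
Implicit Types C D E : complex A.

Definition chain_id C : chainMap C C :=
  ChainMap (cmap := fun i => idfun : {linear C i -> C i}) (fun i j x => erefl).

Program Definition chain_comp C D E (f : chainMap D E) (g : chainMap C D) : chainMap C E :=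
  {| cmap := fun i => (f i \o g i : {linear C i -> E i}) |}.
Next Obligation. by rewrite !cmapE. Qed.

Lemma homotopic_refl C D (f : chainMap C D) : homotopic f f.
Proof.
exists (fun i j => \0 : {linear C i -> D j}) => i x.
by rewrite subrr /= linear0 addr0.
Qed.

Lemma homotopic_sym C D (f g : chainMap C D) : homotopic f g -> homotopic g f.
Proof.
move=> [h hh]; exists (fun i j => \- h i j : {linear C i -> D j}) => i x.
by rewrite -opprB hh opprD /= linearN.
Qed.

Lemma homotopic_trans C D (f g k : chainMap C D) :
  homotopic f g -> homotopic g k -> homotopic f k.
Proof.
move=> [h hh] [h' hh']; exists (fun i j => h i j \+ h' i j : {linear C i -> D j}) => i x.
rewrite -(subrK (g i x) (f i x)) -addrA hh hh' /= linearD.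
by rewrite addrACA.
Qed.

Lemma homotopic_comp C D E (f f' : chainMap D E) (g g' : chainMap C D) :
  homotopic f f' -> homotopic g g' -> homotopic (chain_comp f g) (chain_comp f' g').
Proof.
move=> [h hh] [h' hh'].
exists (fun i j => (f j \o h' i j) \+ (h i j \o g' i) : {linear C i -> E j}) => i x /=.
rewrite -(subrK (f i (g' i x)) (f i (g i x))) -addrA hh -linearB hh' /=.
by rewrite !linearD -!cmapE addrACA.
Qed.

Lemma eq_homotopic C D (f g : chainMap C D) :
  (forall i x, f i x = g i x) -> homotopic f g.
Proof.
move=> fg; exists (fun i j => \0 : {linear C i -> D j}) => i x.
by rewrite fg subrr /= linear0 addr0.
Qed.

Program Definition homotopy_category : category :=
  {| ob := complex A; hom := @chainMap A; heq := @homotopic A;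
     idm := chain_id; comp := chain_comp;
     heq_refl := homotopic_refl; heq_sym := homotopic_sym;
     heq_trans := homotopic_trans; heq_comp := homotopic_comp |}.
Next Obligation. exact: eq_homotopic. Qed.
Next Obligation. exact: eq_homotopic. Qed.
Next Obligation. exact: eq_homotopic. Qed.

Definition finitely_generated (M : lmodType A) : Prop :=
  exists (n : nat) (g : 'I_n -> M),
    forall x : M, exists c : 'I_n -> A, x = \sum_(i < n) c i *: g i.

Definition bounded_fg (C : complex A) : Prop :=
  (exists m : int, forall i : int, (m < `|i|)%R -> forall x : C i, x = 0) /\
  (forall i : int, finitely_generated (C i)).

(* The homotopy category of bounded complexes of finitely generated modules. *)
Definition Kb : category :=
  @full_subcategory homotopy_category bounded_fg.
End HomotopyCategory.

Lemma sign_pred (A : pzRingType) (i : int) :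
  (-1) ^+ `|i - 1|%N = - (-1) ^+ `|i|%N :> A.
Proof.
case: i => [[|n]|n].
- by rewrite sub0r expr1 expr0.
- by rewrite -addn1 PoszD addrK exprD expr1 mulrN1 opprK.
- have -> : `|Negz n - 1|%N = n.+2 by rewrite NegzE -opprD abszN -PoszD addn1.
  by rewrite exprS mulN1r.
Qed.

Lemma sign_scale (A : pzRingType) (V : lmodType A) n a (v : V) :
  (-1) ^+ n *: (a *: v) = a *: ((-1) ^+ n *: v).
Proof. by rewrite !scalerA; congr (_ *: _); apply: commr_sym; apply: commr_sign. Qed.

Definition bimod_id (A B : pzRingType) (M : bimodType A B) : bimodMap M M :=
  BimodMap (bimodMap_lin := idfun : {linear M -> M}) (fun _ _ => erefl).

Definition whole (B : pzRingType) : B -> Prop := fun _ => True.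
Arguments whole : clear implicits.

Section TotalComplex.
Variables (A B : pzRingType) (X : bimodComplex A B).
Local Notation "M '(x)' N" := (tens (whole B) M N) (at level 40).

Section TensComplex.
Variable C : complex B.

Definition tot_obj (k : int) : lmodType A :=
  dsum [pred p : int * int | p.1 + p.2 == k]
    (fun p => (X p.1 (x) C p.2) : lmodType A).

Definition tot_dleft (p : int * int) : {linear X (p.1 - 1) (x) C p.2 -> X p.1 (x) C p.2} :=
  tens_map (whole B) (bdiff X (p.1 - 1) p.1) (idfun : {linear C p.2 -> C p.2}).
Definition tot_dright (p : int * int) : {linear X p.1 (x) C (p.2 - 1) -> X p.1 (x) C p.2} :=
  tens_map (whole B) (bimod_id (X p.1)) (cdiff C (p.2 - 1) p.2).

(* d (x (x) c) = dx (x) c + (-1)^i x (x) dc for x in degree i *)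
Definition tot_diff_fun k l (z : tot_obj k) (p : int * int) : X p.1 (x) C p.2 :=
  if l == k + 1 then
    tot_dleft p (z (p.1 - 1, p.2))
      + (-1) ^+ `|p.1|%N *: tot_dright p (z (p.1, p.2 - 1))
  else 0.

Fact tot_diff_off k l (z : tot_obj k) (p : int * int) :
  ~~ (p.1 + p.2 == l) -> tot_diff_fun l z p = 0.
Proof.
move=> pl; rewrite /tot_diff_fun; case: eqP => // lk; rewrite lk in pl.
rewrite !dsum_off ?(linear0, scaler0, addr0) //=; apply: contra pl => /eqP <-.
- by rewrite addrA subrK.
- by rewrite addrAC subrK.
Qed.

Fact tot_diff_fin k l (z : tot_obj k) :
  exists s : seq (int * int), forall p, p \notin s -> tot_diff_fun l z p = 0.
Proof.
have [s hs] := dsum_fin z.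
exists ([seq (p.1 + 1, p.2) | p <- s] ++ [seq (p.1, p.2 + 1) | p <- s]) => p.
rewrite mem_cat negb_or => /andP[p1 p2]; rewrite /tot_diff_fun; case: eqP => // _.
rewrite !hs ?(linear0, scaler0, addr0) //.
- apply: contra p2 => ps; apply/mapP; exists (p.1, p.2 - 1) => //=.
  by rewrite subrK; case: (p).
- apply: contra p1 => ps; apply/mapP; exists (p.1 - 1, p.2) => //=.
  by rewrite subrK; case: (p).
Qed.

Fact tot_diff_lin k l a (z w : tot_obj k) p :
  tot_diff_fun l (a *: z + w) p = a *: tot_diff_fun l z p + tot_diff_fun l w p.
Proof.
rewrite /tot_diff_fun; case: eqP => _; last by rewrite scaler0 addr0.
by rewrite !dsumD !dsumZ !linearP !scalerDr sign_scale addrACA.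
Qed.

Definition tot_diff k l : {linear tot_obj k -> tot_obj l} :=
  dsum_lin (@tot_diff_off k l) (@tot_diff_fin k l) (@tot_diff_lin k l).

Lemma tot_diffE k l z p : tot_diff k l z p = tot_diff_fun l z p.
Proof. by []. Qed.

Fact tot_diff_shape k l z : l != k + 1 -> tot_diff k l z = 0.
Proof. by move=> lk; apply: dsumP => p; rewrite tot_diffE /tot_diff_fun (negbTE lk). Qed.

Fact tot_diffK k l m z : tot_diff l m (tot_diff k l z) = 0.
Proof.
apply: dsumP => p; rewrite tot_diffE /tot_diff_fun dsum0E; case: eqP => // _.
rewrite !tot_diffE /tot_diff_fun; case: eqP => [_|_]; last first.
  by rewrite !linear0 scaler0 addr0.
rewrite !linearD /= !linearZ /= sign_pred.
have comm t : tot_dleft p (tens_map (whole B) (bimod_id (X (p.1 - 1)))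
    (cdiff C (p.2 - 1) p.2) t)
  = tot_dright p (tens_map (whole B) (bdiff X (p.1 - 1) p.1)
    (idfun : {linear C (p.2 - 1) -> C (p.2 - 1)}) t).
  move: t; apply: tens_eq => [t u|t u|x y]; rewrite ?linearD //.
  by rewrite /tot_dleft /tot_dright /= !tens_mapE.
have ll t : tot_dleft p (tens_map (whole B) (bdiff X (p.1 - 1 - 1) (p.1 - 1))
    (idfun : {linear C p.2 -> C p.2}) t) = 0.
  apply: (tens_eq (f := fun t => tot_dleft p (tens_map _ _ _ t)) (g := fun=> 0)) t.
  - by move=> t u; rewrite !linearD.
  - by move=> t u; rewrite addr0.
  - by move=> x y; rewrite /tot_dleft /= !tens_mapE bdiffK pure0l.
have rr t : tot_dright p (tens_map (whole B) (bimod_id (X p.1))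
    (cdiff C (p.2 - 1 - 1) (p.2 - 1)) t) = 0.
  apply: (tens_eq (f := fun t => tot_dright p (tens_map _ _ _ t)) (g := fun=> 0)) t.
  - by move=> t u; rewrite !linearD.
  - by move=> t u; rewrite addr0.
  - by move=> x y; rewrite /tot_dright /= !tens_mapE cdiffK pure0r.
rewrite ll rr comm scaler0 addr0 add0r scaleNr addNr.
by [].
Qed.

Definition tens_complex : complex A := Complex tot_diff_shape tot_diffK.
End TensComplex.

Section TensChainMap.
Variables (C D : complex B) (f : chainMap C D).

Definition tot_map_fun k (z : tot_obj C k) (p : int * int) : X p.1 (x) D p.2 :=
  tens_map (whole B) (bimod_id (X p.1)) (f p.2) (z p).
Fact tot_map_off k z (p : int * int) : ~~ (p.1 + p.2 == k) -> @tot_map_fun k z p = 0.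
Proof. by move=> pk; rewrite /tot_map_fun dsum_off ?linear0. Qed.
Fact tot_map_fin k z :
  exists s : seq (int * int), forall p, p \notin s -> @tot_map_fun k z p = 0.
Proof.
have [s hs] := dsum_fin z; exists s => p /hs zp.
by rewrite /tot_map_fun zp linear0.
Qed.
Fact tot_map_lin k a (z w : tot_obj C k) p :
  tot_map_fun (a *: z + w) p = a *: tot_map_fun z p + tot_map_fun w p.
Proof. by rewrite /tot_map_fun dsumD dsumZ linearP. Qed.
Definition tot_map k : {linear tot_obj C k -> tot_obj D k} :=
  dsum_lin (@tot_map_off k) (@tot_map_fin k) (@tot_map_lin k).

Fact tot_map_diff k l (z : tot_obj C k) :
  tot_map l (tot_diff C k l z) = tot_diff D k l (tot_map k z).
Proof.
apply: dsumP => p; rewrite tot_diffE /tot_diff_fun.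
rewrite [LHS]/(tot_map_fun _ _) /tot_map_fun tot_diffE /tot_diff_fun.
case: eqP => _; last by rewrite linear0.
rewrite linearD linearZ /= /tot_map_fun; congr (_ + _ *: _).
- move: (z _) => t /=; move: t; apply: tens_eq => [t u|t u|x y]; rewrite ?linearD //.
  by rewrite /tot_dleft /= !tens_mapE.

- move: (z _) => t /=; move: t; apply: tens_eq => [t u|t u|x y]; rewrite ?linearD //.
  by rewrite /tot_dright /= !tens_mapE /= cmapE.
Qed.

Definition tens_chainMap : @chainMap A (tens_complex C) (tens_complex D) :=
  @ChainMap _ (tens_complex C) (tens_complex D) tot_map tot_map_diff.
End TensChainMap.

Lemma tens_chainMap_homotopic (C D : complex B) (f g : chainMap C D) :
  homotopic f g -> homotopic (tens_chainMap f) (tens_chainMap g).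
Proof.
move=> [h hh].
pose H (p i j : int) := tens_map (whole B) (bimod_id (X p)) (h i j).
pose F (k l : int) (z : tot_obj C k) (p : int * int) : X p.1 (x) D p.2 :=
  if l == k - 1 then (-1) ^+ `|p.1|%N *: H p.1 (p.2 + 1) p.2 (z (p.1, p.2 + 1)) else 0.
have Foff (k l : int) z (p : int * int) : ~~ (p.1 + p.2 == l) -> F k l z p = 0.
  move=> pl; rewrite /F /H; case: eqP => // lk; rewrite lk in pl.
  rewrite dsum_off ?(linear0, scaler0) //=; apply: contra pl => /eqP <-.
  by rewrite addrA addrK.
have Ffin (k l : int) z : exists s : seq (int * int), forall p, p \notin s -> F k l z p = 0.
  have [s hs] := dsum_fin z; exists [seq (p.1, p.2 - 1) | p <- s] => p ps.
  rewrite /F /H; case: eqP => // _; rewrite hs ?(linear0, scaler0) //.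
  apply: contra ps => ps; apply/mapP; exists (p.1, p.2 + 1) => //=.
  by rewrite addrK; case: (p).
have Flin (k l : int) a z w p : F k l (a *: z + w) p = a *: F k l z p + F k l w p.
  rewrite /F /H; case: eqP => _; last by rewrite scaler0 addr0.
  by rewrite dsumD dsumZ linearP scalerDr sign_scale.
pose hm (k l : int) := dsum_lin (Foff k l) (Ffin k l) (Flin k l).
exists hm => k z; apply: dsumP => p.
change (tot_map_fun f z p - tot_map_fun g z p =
  tot_diff_fun k (hm k (k - 1) z) p + F (k + 1) k (tot_diff C k (k + 1) z) p).
rewrite {1}/tot_diff_fun subrK eqxx /F addrK eqxx tot_diffE /tot_diff_fun eqxx.
have hmE q : hm k (k - 1) z q = (-1) ^+ `|q.1|%N *: H q.1 (q.2 + 1) q.2 (z (q.1, q.2 + 1)).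
  by change (hm k (k - 1) z q) with (F k (k - 1) z q); rewrite /F eqxx.
rewrite !hmE /=.
have ss (V : lmodType A) n (v : V) : (-1) ^+ n *: ((-1) ^+ n *: v) = v.
  by rewrite scalerA -expr2 sqrr_sign scale1r.
rewrite /H !linearD !linearZ /= scalerDr !ss sign_pred scaleNr.
have comm t : tens_map (whole B) (bimod_id (X p.1)) (h (p.2 + 1) p.2)
    (tens_map (whole B) (bdiff X (p.1 - 1) p.1) (idfun : {linear C (p.2 + 1) -> _}) t) =
  tens_map (whole B) (bdiff X (p.1 - 1) p.1) (idfun : {linear D p.2 -> D p.2})
    (tens_map (whole B) (bimod_id (X (p.1 - 1))) (h (p.2 + 1) p.2) t).
  move: t; apply: tens_eq => [t u|t u|x y]; rewrite ?linearD //.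
  by rewrite !tens_mapE.
rewrite comm addrACA addNr add0r.
pose G q := tens_map (whole B) (bimod_id (X p.1)) (cdiff D (p.2 - 1) p.2)
  (tens_map (whole B) (bimod_id (X p.1)) (h q (p.2 - 1)) (z (p.1, q))).
pose G' q := tens_map (whole B) (bimod_id (X p.1)) (h (p.2 + 1) p.2)
  (tens_map (whole B) (bimod_id (X p.1)) (cdiff C q (p.2 + 1)) (z (p.1, q))).
rewrite -[X in _ = X + _]/(G (p.2 - 1 + 1)) -[X in _ = _ + X]/(G' (p.2 + 1 - 1)).
rewrite !addrK /G /G' /tot_map_fun.
have -> : z p = z (p.1, p.2) :> (X p.1 (x) C p.2) by case: (p).
move: (z _) => t /=; move: t; apply: tens_eq => [t u|t u|x y].
- by rewrite !linearD addrACA.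
- by rewrite !linearD addrACA.
- by rewrite !tens_mapE /= -!pureDr -hh pureDr -[- pure _ _ _]add0r -(pure0r _ _ x)
    -{1}(addNr (g p.2 y)) pureDr addrK.
Qed.

Definition tens_functor : functor (homotopy_category B) (homotopy_category A).
Proof.
exists (tens_complex : homotopy_category B -> homotopy_category A) tens_chainMap.
- exact: tens_chainMap_homotopic.
- move=> C; apply: eq_homotopic => k z; apply: dsumP => p.
  rewrite [LHS]/(tens_map _ _ _ _); move: (z p).
  apply: (tens_eq (f := tens_map _ (bimod_id (X p.1)) (chain_id C p.2))
    (g := id)) => [t u|//|x y]; first by rewrite linearD.
  by rewrite tens_mapE.
- move=> C D E f g; apply: eq_homotopic => k z; apply: dsumP => p.
  rewrite [LHS]/(tens_map _ _ _ _) [RHS]/(tens_map _ _ _ (tens_map _ _ _ _)).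
  move: (z p); apply: (tens_eq (f := tens_map _ (bimod_id (X p.1)) (chain_comp f g p.2))
    (g := fun t => tens_map _ (bimod_id (X p.1)) (f p.2)
            (tens_map _ (bimod_id (X p.1)) (g p.2) t))) => [t u|t u|x y].
  - by rewrite linearD.
  - by rewrite !linearD.
  - by rewrite !tens_mapE.
Defined.
End TotalComplex.

Record coeffSystem (A B : pzRingType) (S : finType) := CoeffSystem {
  cs_obj :> {set S} -> bimodType A B;
  cs_res : forall I J : {set S}, I \subset J -> bimodMap (cs_obj I) (cs_obj J);
  cs_resE : forall (I J K : {set S}) (IJ : I \subset J) (JK : J \subset K)
    (IK : I \subset K) x, cs_res JK (cs_res IJ x) = cs_res IK x
}.

Section AssociatedComplex.
Import Order.TTheory.
Variables (A B : pzRingType) (d : Order.disp_t) (S : finOrderType d).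
Variable M : coeffSystem A B S.

Definition nlt (I : {set S}) (s : S) : nat := #|[set t in I | (t < s)%O]|.

Definition cs_cobj (i : int) : bimodType A B :=
  dsum_bimod [pred I : {set S} | #|I|%:Z == i] M.

(* The component on M^J of the differential: the contributions to M^J are
   those of M^I for J = I u {s} with s not in I, that is I = J \ {s}. *)
Definition cs_diff_fun i j (x : cs_cobj i) (J : {set S}) : M J :=
  if j == i + 1 then
    \sum_(s in J) (-1) ^+ nlt (J :\ s) s *: cs_res M (subD1set J s) (x (J :\ s))
  else 0.

Fact cs_diff_off i j (x : cs_cobj i) (J : {set S}) :
  ~~ (#|J|%:Z == j) -> cs_diff_fun j x J = 0.
Proof.
move=> Jj; rewrite /cs_diff_fun; case: eqP => // ji; apply: big1 => s sJ.
rewrite dsum_off ?linear0 ?scaler0 //=; apply: contra Jj => /eqP e.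
by rewrite ji -e (cardsD1 s J) sJ addnC PoszD.
Qed.

Fact cs_diff_fin i j (x : cs_cobj i) :
  exists s : seq {set S}, forall J, J \notin s -> cs_diff_fun j x J = 0.
Proof. by exists (enum {set S}) => J; rewrite mem_enum. Qed.

Fact cs_diff_lin i j a (x y : cs_cobj i) (J : {set S}) :
  cs_diff_fun j (a *: x + y) J = a *: cs_diff_fun j x J + cs_diff_fun j y J.
Proof.
rewrite /cs_diff_fun; case: eqP => _; last by rewrite scaler0 addr0.
rewrite scaler_sumr -big_split; apply: eq_bigr => s _ /=.
rewrite [X in cs_res _ _ X](_ : _ = a *: (x (J :\ s) : M _) + y (J :\ s)) //.
by rewrite linearP scalerDr sign_scale.
Qed.

Fact cs_diff_r i j (x : cs_cobj i) b :
  dsum_lin (@cs_diff_off i j) (@cs_diff_fin i j) (@cs_diff_lin i j)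
    (rscale x b : cs_cobj i) =
  rscale (dsum_lin (@cs_diff_off i j) (@cs_diff_fin i j) (@cs_diff_lin i j) x
    : cs_cobj j) b.
Proof.
apply: dsumP => J; change (cs_diff_fun j (rscale x b) J = rscale (cs_diff_fun j x J) b).
rewrite /cs_diff_fun; case: eqP => _; last by rewrite rscale0.
have -> : forall (F : S -> M J), rscale (\sum_(s in J) F s) b = \sum_(s in J) rscale (F s) b.
  move=> F; apply: (big_morph (fun v : M J => rscale v b)); last exact: rscale0.
  by move=> u v; rewrite rscaleDl.
by apply: eq_bigr => s _; rewrite rscaleZ -bimodMapr.
Qed.

Definition cs_diff i j : bimodMap (cs_cobj i) (cs_cobj j) := BimodMap (@cs_diff_r i j).

Lemma cs_diffE i j x J : cs_diff i j x J = cs_diff_fun j x J.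
Proof. by []. Qed.

Fact cs_diff_shape i j x : j != i + 1 -> cs_diff i j x = 0.
Proof. by move=> ji; apply: dsumP => J; rewrite cs_diffE /cs_diff_fun (negbTE ji). Qed.

Lemma nltD1 (K : {set S}) s t : s \in K -> nlt K t = ((s < t)%O + nlt (K :\ s) t)%N.
Proof.
move=> sK; rewrite /nlt (cardsD1 s [set u in K | (u < t)%O]) inE sK; congr (_ + _)%N.
by apply: eq_card => u; rewrite !inE andbA.
Qed.

Lemma nlt_swap (K : {set S}) s t : s \in K -> t \in K -> (s < t)%O ->
  (nlt (K :\ t) t + nlt (K :\ t :\ s) s = (nlt (K :\ s) s + nlt (K :\ s :\ t) t).+1)%N.
Proof.
move=> sK tK st; have ts : t != s by rewrite eq_sym lt_eqF.
have := nltD1 t tK; rewrite ltxx add0n => <-.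
have := nltD1 s sK; rewrite ltxx add0n => <-.
have tKs : t \in K :\ s by rewrite !inE ts.
rewrite (nltD1 t sK) st (nltD1 t tKs) ltxx add0n.
have sKt : s \in K :\ t by rewrite !inE eq_sym ts.
have := nltD1 s sKt; rewrite ltxx add0n => <-.
rewrite (nltD1 s tK) (le_gtF (ltW st)) !add0n add1n addSn addnC.
by [].
Qed.

Fact cs_diffK i j k x : cs_diff j k (cs_diff i j x) = 0.
Proof.
apply: dsumP => K; rewrite cs_diffE /cs_diff_fun; case: eqP => // _.
have [ji|nji] := eqVneq j (i + 1); last first.
  by rewrite cs_diff_shape //; apply: big1 => s _; rewrite linear0 scaler0.
pose F (L : {set S}) : M K :=
  if @idP (L \subset K) is ReflectT LK then cs_res M LK (x L) else 0.
pose G s t : M K := (-1) ^+ (nlt (K :\ s) s + nlt (K :\ s :\ t) t) *: F (K :\ s :\ t).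
transitivity (\sum_(s in K) \sum_(t in K | t != s) G s t).
  apply: eq_bigr => s sK; rewrite cs_diffE /cs_diff_fun ji eqxx linear_sum scaler_sumr.
  apply: eq_big => [t|t _]; first by rewrite !inE andbC.
  rewrite linearZ /= scalerA -exprD /G /F; congr (_ *: _).
  case: {-}_ / idP => [LK|[]]; first exact: cs_resE.
  exact: subset_trans (subD1set _ _) (subD1set _ _).
have anti s t : s \in K -> t \in K -> (s < t)%O -> G t s = - G s t.
  move=> sK tK st; rewrite /G nlt_swap // exprS mulN1r scaleNr.
  by have -> : K :\ t :\ s = K :\ s :\ t by apply/setP => u; rewrite !inE andbCA.
transitivity (\sum_(s in K) (\sum_(t in K | (s < t)%O) G s t + \sum_(t in K | (t < s)%O) G s t)).
  apply: eq_bigr => s sK; rewrite (bigID (fun t => (s < t)%O)) /=; congr (_ + _).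
    by apply: eq_bigl => t; case: ltgtP; rewrite ?andbF ?andbT.
  by apply: eq_bigl => t; case: ltgtP; rewrite ?andbF ?andbT.
rewrite big_split /=.
rewrite [X in _ + X](exchange_big_dep (mem K)) /=; last by move=> s t _ /andP[].
rewrite -big_split /=; apply: big1 => s sK.
rewrite [X in _ + X](_ : _ = \sum_(t in K | (s < t)%O) - G s t); last first.
  apply: eq_big => [t|t /and3P[tK _ st]]; first by rewrite sK.
  exact: anti.
by rewrite sumrN subrr.
Qed.

Definition cs_complex : bimodComplex A B := BimodComplex cs_diff_shape cs_diffK.
End AssociatedComplex.

Section Coxeter.
Variables (gT : finGroupType) (S : finType) (s : S -> gT).
Local Open Scope group_scope.

(* (gT, S) is a Coxeter system, where S is embedded in gT by s: the distinct
   involutions s i generate gT, and the relations (s i * s j)^m(i, j) = 1, for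
   m(i, j) the order of s i * s j, present gT. *)
Record coxeter_system : Prop := CoxeterSystem {
  cox_inj : injective s;
  cox_gen : <<[set s i | i : S]>> = [set: gT];
  cox_inv : forall i, #[s i] = 2%N;
  cox_pres : forall (G : groupType) (f : S -> G),
    (forall i j, (f i * f j) ^+ #[s i * s j] = 1) ->
    exists phi : gT -> G, {morph phi : x y / x * y} /\ forall i, phi (s i) = f i
}.

Definition has_word (w : gT) (k : nat) : bool :=
  [exists t : k.-tuple S, w == \prod_(i <- t) s i].

(* The least length of a word representing w; the value 0 when there is no
   such word is irrelevant, as S generates gT. *)
Definition len (w : gT) : nat :=
  if pselect (exists k, has_word w k) is left ex then ex_minn ex else 0%N.

Definition parabolic (I : {set S}) : {set gT} := <<[set s i | i in I]>>.
End Coxeter.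

Section Hecke.
Variables (gT : finGroupType) (S : finType) (s : S -> gT).
Variables (R : comPzRingType) (q : S -> R).
Variables (H : pzRingType) (eta : {rmorphism R -> H}) (h : gT -> H).

(* H, an R-algebra through the central morphism eta, is the Hecke algebra, with
   h w for the basis element h_w.  The library's [algType] is not used because
   it excludes the zero ring. *)
Record hecke_algebra : Prop := HeckeAlgebra {
  hecke_central : forall r x, eta r * x = x * eta r;
  hecke_basis : forall x, exists! c : {ffun gT -> R}, x = \sum_w eta (c w) * h w;
  heckeM : forall w w', len s (w * w')%g = (len s w + len s w')%N ->
    h w * h w' = h (w * w')%g;
  hecke_quad : forall i,
    h (s i) ^+ 2 = eta (q i - 1) * h (s i) + eta (q i)
}.

(* The elements of the parabolic subalgebra H_I. *)
Definition hecke_sub (I : {set S}) (x : H) : Prop :=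
  exists c : gT -> R, x = \sum_(w in parabolic s I) eta (c w) * h w.

Lemma hecke_subS (I J : {set S}) : I \subset J ->
  forall x, hecke_sub I x -> hecke_sub J x.
Proof.
move=> IJ x [c ->]; exists (fun w => if w \in parabolic s I then c w else 0).
have PIJ : parabolic s I \subset parabolic s J by apply/genS/imsetS.
rewrite [RHS](big_setID (parabolic s I)) /= (setIidPr PIJ).
rewrite [X in _ = _ + X]big1 ?addr0 => [|w]; last first.
  by rewrite inE => /andP[/negbTE -> _]; rewrite rmorph0 mul0r.
by apply: eq_bigr => w ->.
Qed.

Definition X_obj (I : {set S}) : bimodType H H := tens (hecke_sub I) H^o H^o.

Definition X_res (I J : {set S}) (IJ : I \subset J) : bimodMap (X_obj I) (X_obj J) :=
  tens_widen_bimod H^o H^o (hecke_subS IJ).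

Fact X_resE (I J K : {set S}) (IJ : I \subset J) (JK : J \subset K) (IK : I \subset K) x :
  X_res JK (X_res IJ x) = X_res IK x.
Proof.
apply: (tens_eq (f := fun x => X_res JK (X_res IJ x)) (g := X_res IK)) x.
- by move=> t u; rewrite !linearD.
- by move=> t u; rewrite linearD.
- by move=> x y; rewrite /X_res !tens_widen_bimod_pure.
Qed.

Definition X_system : coeffSystem H H S := CoeffSystem X_resE.
End Hecke.

Definition X_complex (gT : finGroupType) (d : Order.disp_t) (S : finOrderType d)
    (s : S -> gT) (R : comPzRingType) (H : pzRingType) (eta : {rmorphism R -> H})
    (h : gT -> H) : bimodComplex H H :=
  cs_complex (X_system s eta h).

(* Main.v *)
(* For J a subset of S, H is a Frobenius extension of H_J, so that the functor
   X^J (x) - = H (x)_(H_J) - is naturally isomorphic to the coinduction functor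
   Hom_(H_J)(H, -).  This makes X (x) - a complex F of coinduction functors whose
   differential is given by relative traces.  Its inverse G is the complex of the
   same functors, the one of index I being in degree -|I|, whose differential is
   given by the inclusions Hom_(H_I)(H, -) in Hom_(H_J)(H, -) for J
   contained in I.
   An element of F(G(C)) or of G(F(C)) is a family of functions on W, indexed by
   the pairs (J, I), and such a function is determined by its values at the
   minimal representatives of the double cosets W_J w W_I.  There is an acyclic
   matching on the set of these (J, I, W_J w W_I) whose only unmatched element is
   J = I = S, which corresponds to C itself; discrete Morse theory turns it into
   homotopy equivalences of F(G(C)) and G(F(C)) with C, natural in C. *)

From HB Require Import structures.
From mathcomp Require Import all_boot all_order all_algebra all_fingroup.
From mathcomp Require Import zify boolp.
Require Import Defs.

Set Implicit Arguments.
Unset Strict Implicit.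
Unset Printing Implicit Defensive.
Import Order.TTheory GRing.Theory Num.Theory.

(** * Length, inversions and descents *)

(** Evaluating coinduced elements at the basis [h w] turns both composites into families of
    functions on W, and no dual of the complex of bimodules has to be formed. Invertibility of the
    [q i] enters twice: in the factors [qw_inv] of the traces, and in the inverse of [h w0], through
    which a function on the coset w0 W_I is recovered from its value at w0. The differential sends a
    cell to many double cosets, with operators as coefficients, so acyclicity takes the form of
    triangularity for a numerical rank. The differential of C preserves the cells and cancels
    against itself because the homotopy changes the parity of #|J| + #|I|. The obstacle is the
    position of the critical cell: in the order of ranks it lies after the pairs matched through I
    and before those matched through J. Hence neither its inclusion nor its evaluation is a chain
    map. Both become so after composition with a power of the flow, because that power kills the
    subcomplex of families vanishing on the cosets w0 W_I, and modulo this subcomplex its image lies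
    in the critical cell. *)

Section CoxeterGroup.
Variables (gT : finGroupType) (S : finType) (s : S -> gT).
Hypothesis cox : coxeter_system s.
Local Open Scope group_scope.
Local Notation l := (len s).
Implicit Types (w u v d t : gT) (i j : S) (I J K : {set S}) (p : seq S).

Canonical parabolic_group J := Eval hnf in [group of parabolic s J].

Lemma gen_sq i : s i * s i = 1.
Proof. by have := expg_order (s i); rewrite (cox_inv cox) expgS expg1. Qed.

Lemma gen_inv i : (s i)^-1 = s i.
Proof. by apply: (mulgI (s i)); rewrite mulgV gen_sq. Qed.

Lemma genK i : cancel (mulg (s i)) (mulg (s i)).
Proof. by move=> w; rewrite mulgA gen_sq mul1g. Qed.

Lemma genKr i : cancel (mulg^~ (s i)) (mulg^~ (s i)).
Proof. by move=> w; rewrite -mulgA gen_sq mulg1. Qed.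

Lemma conj_gen t i : t ^ s i = s i * t * s i.
Proof. by rewrite conjgE gen_inv mulgA. Qed.

Definition wprod p : gT := \prod_(i <- p) s i.

Lemma wprod_cons i p : wprod (i :: p) = s i * wprod p.
Proof. by rewrite /wprod big_cons. Qed.

Lemma wprod_cat p p' : wprod (p ++ p') = wprod p * wprod p'.
Proof. by rewrite /wprod big_cat. Qed.

Lemma wprod_rev p : wprod (rev p) = (wprod p)^-1.
Proof.
elim: p => [|i p IH]; first by rewrite /wprod !big_nil invg1.
by rewrite rev_cons -cats1 wprod_cat IH !wprod_cons /wprod big_nil mulg1 invMg gen_inv.
Qed.

Lemma parabolic_word J w : w \in parabolic s J ->
  exists2 p, all (mem J) p & w = wprod p.
Proof.
case/gen_prodgP=> n [c cJ ->]; elim: n c cJ => [|n IH] c cJ.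
  by exists [::] => //; rewrite big_ord0 /wprod big_nil.
rewrite big_ord_recl; have [|p pJ ->] := IH (c \o lift ord0).
  by move=> i; apply: cJ.
have /imsetP[i iJ ->] := cJ ord0.
by exists (i :: p); rewrite ?wprod_cons //= iJ.
Qed.

Lemma gen_parabolic J j : j \in J -> s j \in parabolic s J.
Proof. by move=> jJ; apply/mem_gen/imset_f. Qed.

Lemma wprod_parabolic J p : all (mem J) p -> wprod p \in parabolic s J.
Proof.
elim: p => [|i p IH] /=; first by rewrite /wprod big_nil group1.
by case/andP=> iJ pJ; rewrite wprod_cons groupM ?IH ?gen_parabolic.
Qed.

Lemma parabolicT w : w \in parabolic s setT.
Proof.
rewrite /parabolic (_ : [set _ | _ in _] = [set s i | i : S]) ?(cox_gen cox) ?inE //.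
by apply/setP => x; apply/imsetP/imsetP => -[i _ ->]; exists i.
Qed.

Lemma parabolicS I J : I \subset J -> parabolic s I \subset parabolic s J.
Proof. by move=> IJ; apply/genS/imsetS. Qed.

Lemma parabolic0 w : w \in parabolic s set0 -> w = 1.
Proof.
case/parabolic_word=> -[_ ->|i p]; first by rewrite /wprod big_nil.
by rewrite /= inE.
Qed.

Lemma has_wordP w (k : nat) : reflect (exists2 p, size p = k & w = wprod p) (has_word s w k).
Proof.
apply: (iffP existsP) => [[t /eqP ->]|[p pk ->]].
  by exists t => //; rewrite size_tuple.
by move/eqP: pk => pk; exists (Tuple pk).
Qed.

Lemma len_word w : exists2 p, size p = l w & w = wprod p.
Proof.
apply/has_wordP; rewrite /len; case: pselect => [ex|[]]; first by case: ex_minnP.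
have [p _ ->] := parabolic_word (parabolicT w).
by exists (size p); apply/has_wordP; exists p.
Qed.

Lemma len_le p : l (wprod p) <= size p.
Proof.
have hp : has_word s (wprod p) (size p) by apply/has_wordP; exists p.
rewrite /len; case: pselect => [ex|[]]; last by exists (size p).
by case: ex_minnP => k _; apply.
Qed.

Lemma len1 : l 1 = 0%N.
Proof. by apply/eqP; rewrite -leqn0; have := len_le [::]; rewrite /wprod big_nil. Qed.

Lemma len_eq0 w : l w = 0%N -> w = 1.
Proof. by have [p <- we] := len_word w => /size0nil p0; rewrite we p0 /wprod big_nil. Qed.

Lemma lenV w : l w^-1 = l w.
Proof.
suff le w' : l w'^-1 <= l w' by apply/eqP; rewrite eqn_leq le -{1}(invgK w) le.
by have [p <- ->] := len_word w'; rewrite -wprod_rev -(size_rev p) len_le.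
Qed.

Lemma len_mul w w' : l (w * w') <= l w + l w'.
Proof.
have [p <- ->] := len_word w; have [p' <- ->] := len_word w'.
by rewrite -wprod_cat -size_cat len_le.
Qed.

Lemma len_gen_le i : l (s i) <= 1.
Proof. by have := len_le [:: i]; rewrite /wprod big_seq1. Qed.

(* Bourbaki's signed permutations of the reflections, extended to all of gT so
   that the set of reflections need not be introduced. *)
Definition sgn_fun i (x : gT * bool) := (x.1 ^ s i, x.2 (+) (x.1 == s i)).

Lemma sgn_funK i : involutive (sgn_fun i).
Proof.
have e t : (t ^ s i == s i) = (t == s i).
  apply/eqP/eqP => [h|->]; last by rewrite conj_gen gen_sq mul1g.
  by rewrite -(conjgK (s i) t) h gen_inv conj_gen gen_sq mul1g.
by move=> [t b]; rewrite /sgn_fun /= e addbK -conjgM gen_sq conjg1.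
Qed.

Definition sgn_perm i := perm (can_inj (sgn_funK i)).

(** The n-th power of the product conjugates by r^n and flips the sign once for each k < 2n with t =
    r^k s_i. When n is the order of r, these 2n reflections are run through twice, so the number of
    flips is even. *)
Lemma sgn_rel i j : (sgn_perm i * sgn_perm j) ^+ #[s i * s j] = 1.
Proof.
set r := s i * s j.
have sr n : s i * r ^- n = r ^+ n * s i.
  elim: n => [|n IH]; first by rewrite invg1 mulg1 mul1g.
  rewrite {1}expgSr invMg !mulgA (_ : s i * r^-1 = r * s i); last first.
    by rewrite /r invMg !gen_inv !mulgA.
  by rewrite -(mulgA r) IH mulgA -expgS.
have rE : s i * s j = r by [].
clearbody r.
have tr t n : (t ^ r ^+ n == s i) = (t == r ^+ n.*2 * s i).
  by rewrite (can2_eq (conjgK _) (conjgKV _)) conjgE invgK sr mulgA -expgD addnn.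
have tr' t n : ((t ^ r ^+ n) ^ s i == s j) = (t == r ^+ n.*2.+1 * s i).
  rewrite !(can2_eq (conjgK _) (conjgKV _)) gen_inv conj_gen rE.
  by rewrite conjgE invgK -!mulgA sr !mulgA -expgSr -expgD addSn addnn.
have pw n t b : ((sgn_perm i * sgn_perm j) ^+ n) (t, b) =
    (t ^ r ^+ n, b (+) odd (\sum_(k < n.*2) (t == r ^+ k * s i)%g)%N).
  elim: n => [|n IH]; first by rewrite perm1 conjg1 big_ord0 addbF.
  rewrite expgSr permM IH permM !permE /sgn_fun /=.
  rewrite doubleS !big_ord_recr /= !oddD !oddb tr tr'.
  by rewrite -!conjgM -?mulgA rE -expgSr !addbA.
apply/permP => -[t b]; rewrite pw perm1 expg_order conjg1.
rewrite -addnn big_split_ord /=.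
rewrite [X in (_ + X)%N](_ : _ = \sum_(k < #[r]) (t == r ^+ k * s i)%g)%N.
  by rewrite addnn odd_double addbF.
by apply: eq_bigr => k _; rewrite expgD expg_order mul1g.
Qed.

Lemma sgn_ex : exists phi : gT -> {perm gT * bool},
  {morph phi : x y / x * y} /\ forall i, phi (s i) = sgn_perm i.
Proof. exact: (cox_pres cox sgn_rel). Qed.

Definition sgn_rep := sval (cid sgn_ex).

(* For a reflection t, [inversion w t] says that l (t w) < l w. *)
Definition inversion w t : bool := (sgn_rep w (t, false)).2.

Lemma sgn_repM w w' : sgn_rep (w * w') = sgn_rep w * sgn_rep w'.
Proof. exact: (svalP (cid sgn_ex)).1. Qed.

Lemma sgn_rep_gen i : sgn_rep (s i) = sgn_perm i.
Proof. exact: (svalP (cid sgn_ex)).2. Qed.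

Lemma sgn_rep1 : sgn_rep 1 = 1.
Proof. by apply: (mulgI (sgn_rep 1)); rewrite -sgn_repM !mulg1. Qed.

Lemma sgn_repE w t b : sgn_rep w (t, b) = (t ^ w, b (+) inversion w t).
Proof.
have [p _ ->] := parabolic_word (parabolicT w).
elim: p t b => [|i p IH] t b; rewrite /inversion.
  by rewrite /wprod big_nil sgn_rep1 !perm1 conjg1 addbF.
rewrite wprod_cons sgn_repM !permM sgn_rep_gen !permE /sgn_fun /= !IH /=.
by rewrite conjgM addbA.
Qed.

Lemma inversionM w w' t : inversion (w * w') t = inversion w t (+) inversion w' (t ^ w).
Proof. by rewrite {1}/inversion sgn_repM permM sgn_repE /= sgn_repE. Qed.

Lemma inversion1 t : inversion 1 t = false.
Proof. by rewrite /inversion sgn_rep1 perm1. Qed.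

Lemma inversion_gen i t : inversion (s i) t = (t == s i).
Proof. by rewrite /inversion sgn_rep_gen permE. Qed.

(** The strong exchange condition, for words that may fail to be reduced: the cocycle rule
    [inversionM] finds a letter at which the sign flips, and multiplying by t deletes it. *)
Lemma exchange_word p t : inversion (wprod p) t ->
  exists p', [/\ subseq p' p, (size p').+1 = size p & t * wprod p = wprod p'].
Proof.
elim: p t => [|i p IH] t; first by rewrite /wprod big_nil inversion1.
rewrite wprod_cons inversionM inversion_gen; case: eqP => [->|_] /=.
  by exists p; rewrite genK; split=> //; exact: subseq_cons.
case/IH=> p' [sp zp e]; exists (i :: p'); rewrite /= eqxx zp; split => //.
by rewrite wprod_cons -e conj_gen !mulgA gen_sq mul1g.
Qed.

Lemma inversion_len w t : inversion w t -> l (t * w) < l w.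
Proof.
have [p <- ->] := len_word w; case/exchange_word => p' [_ <- ->].
by rewrite ltnS len_le.
Qed.

Definition ldesc w i := inversion w (s i).

Lemma ldesc_inversion w i : ldesc w i = inversion w (s i). Proof. by []. Qed.

Lemma ldesc_gen w i : ldesc (s i * w) i = ~~ ldesc w i.
Proof. by rewrite /ldesc inversionM inversion_gen eqxx conj_gen gen_sq mul1g. Qed.

Lemma len_genM w i : l (s i * w) = if ldesc w i then (l w).-1 else (l w).+1.
Proof.
have up : l (s i * w) <= (l w).+1.
  by apply: leq_trans (len_mul _ _) _; have := len_gen_le i; lia.
have dn : l w <= (l (s i * w)).+1.
  by rewrite -{1}(genK i w); apply: leq_trans (len_mul _ _) _; have := len_gen_le i; lia.
case: ifP => h; first by have := inversion_len h; lia.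
by have := @inversion_len (s i * w) (s i); rewrite -/(ldesc _ i) ldesc_gen h genK; lia.
Qed.

Lemma ldescE w i : ldesc w i = (l (s i * w) < l w).
Proof.
rewrite len_genM; case: ifP => h; last by lia.
by have := inversion_len h; lia.
Qed.

Lemma ldescN w i : (~~ ldesc w i) = (l w < l (s i * w)).
Proof.
rewrite len_genM; case: ifP => h /=; last by lia.
by lia.
Qed.

Definition rdesc w i := ldesc w^-1 i.

Lemma rdescV w i : rdesc w i = ldesc w^-1 i. Proof. by []. Qed.

Lemma len_Mgen w i : l (w * s i) = if rdesc w i then (l w).-1 else (l w).+1.
Proof. by rewrite -lenV invMg gen_inv len_genM lenV. Qed.

Lemma rdescE w i : rdesc w i = (l (w * s i) < l w).
Proof. by rewrite /rdesc ldescE -lenV invMg invgK gen_inv lenV. Qed.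

Lemma rdescN w i : (~~ rdesc w i) = (l w < l (w * s i)).
Proof. by rewrite /rdesc ldescN lenV -[l (_ * w^-1)]lenV invMg invgK gen_inv. Qed.

Lemma len_gen i : l (s i) = 1%N.
Proof. by have := len_genM 1 i; rewrite mulg1 /ldesc inversion1 len1. Qed.

Lemma len_gt0 w i : ldesc w i -> 0 < l w.
Proof. by rewrite ldescE; lia. Qed.

Lemma len1_gen w : l w = 1%N -> exists i, w = s i.
Proof.
have [[|i [|? ?]] pw we] := len_word w; rewrite -pw //= => _.
by exists i; rewrite we /wprod big_seq1.
Qed.

(** Take a shortest word of w in the letters of J. If its first letter were not a descent, it would
    be one of the remaining word, and exchange would give a shorter word, still in J. This avoids
    comparing the length over J with the length over S. *)
Lemma ldesc_parabolic J w : w \in parabolic s J -> w != 1 ->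
  exists2 j, j \in J & ldesc w j.
Proof.
move=> wJ w1.
pose P k := `[< exists p, [/\ all (mem J) p, size p = k & w = wprod p] >].
have exP : exists k, P k.
  by have [p pJ pw] := parabolic_word wJ; exists (size p); apply/asboolP; exists p.
case: (ex_minnP exP) => k /asboolP[[|i p] [pJ pk we]] mink.
  by rewrite we /wprod big_nil eqxx in w1.
move: pJ; rewrite /= => /andP[iJ pJ]; exists i => //.
rewrite we wprod_cons ldesc_gen; apply/negP => /exchange_word[p' [sp zp e]].
have /mink : P (size p').
  apply/asboolP; exists p'; rewrite we wprod_cons e; split => //.
  by apply/allP => x /(mem_subseq sp); move/allP: pJ; apply.
by rewrite -pk /= -zp; lia.
Qed.

Definition lmin J w := [forall j in J, ~~ ldesc w j].
Definition rmin I w := lmin I w^-1.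

Lemma rminV I w : rmin I w = lmin I w^-1. Proof. by []. Qed.

Lemma rminP I w : reflect (forall i, i \in I -> l w < l (w * s i)) (rmin I w).
Proof. by apply: (iffP forall_inP) => h i /h; rewrite -/(rdesc w i) rdescN. Qed.

Lemma lminS I J w : I \subset J -> lmin J w -> lmin I w.
Proof. by move=> /subsetP IJ /forall_inP h; apply/forall_inP => i /IJ; apply: h. Qed.

Lemma lmin1 J : lmin J 1.
Proof. by apply/forall_inP => j _; rewrite /ldesc inversion1. Qed.

Lemma lmin_parabolic J w : lmin J w -> w \in parabolic s J -> w = 1.
Proof.
move=> /forall_inP h wJ; apply/eqP/negPn/negP => /(ldesc_parabolic wJ)[j jJ].
exact/negP/h.
Qed.

(** Passes from the simple reflections of W_J to all of them. An element m of least length in W_J w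
    has no inversion in W_J by [inversion_len]. If w = u m with u nontrivial in W_J, a descent of u
    in J would be a descent of w. *)
Lemma lmin_inv J w j u : lmin J w -> u \in parabolic s J -> j \in J ->
  inversion w (s j ^ u) = false.
Proof.
move=> wJ; have [m /imsetP[u0 u0J me] mmin] :
    exists2 m, m \in [set x * w | x in parabolic s J] &
      forall m', m' \in [set x * w | x in parabolic s J] -> l m <= l m'.
  have w0 : w \in [set x * w | x in parabolic s J].
    by apply/imsetP; exists 1; rewrite ?mul1g ?group1.
  by exists [arg min_(m < w in [set x * w | x in parabolic s J]) l m]; case: arg_minnP.
have minv x i : x \in parabolic s J -> i \in J -> inversion m (s i ^ x) = false.
  move=> xJ iJ; apply/negP => /inversion_len; apply/negP; rewrite -leqNgt.
  apply/mmin/imsetP; exists (s i ^ x * u0); last by rewrite me mulgA.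
  by rewrite groupM // groupJ ?gen_parabolic.
have lm x i : x \in parabolic s J -> i \in J -> ldesc (x * m) i = ldesc x i.
  by move=> xJ iJ; rewrite /ldesc inversionM minv // addbF.
suff -> : w = m by move=> *; apply: minv.
have wm : w = u0^-1 * m by rewrite me mulKg.
have [u1|u1] := eqVneq u0^-1 1; first by rewrite wm u1 mul1g.
have uJ : u0^-1 \in parabolic s J by rewrite groupV.
have [j' jJ] := ldesc_parabolic uJ u1.
by rewrite -(lm _ _ uJ jJ) -wm => h; have := forall_inP wJ _ jJ; rewrite h.
Qed.

Lemma ldesc_lminM J w j u : lmin J w -> u \in parabolic s J -> j \in J ->
  ldesc (u * w) j = ldesc u j.
Proof. by move=> wJ uJ jJ; rewrite /ldesc inversionM (lmin_inv wJ) ?addbF. Qed.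

Lemma len_lminM J w u : lmin J w -> u \in parabolic s J -> l (u * w) = (l u + l w)%N.
Proof.
move=> wJ; case/parabolic_word=> p pJ ->.
elim: p pJ => [|i p IH]; first by rewrite /wprod big_nil mul1g len1.
rewrite /= => /andP[iJ pJ]; rewrite wprod_cons -mulgA !len_genM.
have uJ := wprod_parabolic pJ.
rewrite (ldesc_lminM wJ uJ iJ) IH //; case: ifP => // /len_gt0; lia.
Qed.

Lemma len_rminM I w u : rmin I w -> u \in parabolic s I -> l (w * u) = (l w + l u)%N.
Proof.
move=> wI uI; rewrite -lenV invMg (len_lminM wI) ?groupV // !lenV; exact: addnC.
Qed.

End CoxeterGroup.

(** * Parabolic double cosets and the longest element *)

Section DoubleCosets.
Variables (gT : finGroupType) (S : finType) (s : S -> gT).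
Hypothesis cox : coxeter_system s.
Local Open Scope group_scope.
Local Notation l := (len s).
Local Notation ldesc := (ldesc cox).
Local Notation rdesc := (rdesc cox).
Local Notation lmin := (lmin cox).
Local Notation rmin := (rmin cox).
Local Notation W_ := (parabolic s).
Implicit Types (w u v d t x y : gT) (i j : S) (I J K : {set S}).

Lemma rmin_ldesc I d j : rmin I d -> ldesc d j -> rmin I (s j * d).
Proof.
move=> /rminP h; rewrite ldescE => jd; apply/rminP => i /h.
have := len_Mgen cox (s j * d) i; have := len_genM cox (d * s i) j.
rewrite mulgA; move: jd; rewrite (len_genM cox d j).
by do ![case: ifP => _]; move: (l d) (l (d * s i)) (l (s j * d * s i)) => a b c; lia.
Qed.

(** Deodhar's lemma: if s_j d acquires a right descent k in I, then s_j is an inversion of d s_k but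
    not of d, and the cocycle rule forces the conjugate of s_j by d to be s_k. *)
Lemma deodhar I d j : rmin I d ->
  rmin I (s j * d) \/ exists2 k, k \in I & s j * d = d * s k.
Proof.
move=> dI; case: (boolP (ldesc d j)) => [|ndj]; first by left; apply: rmin_ldesc.
case: (boolP (rmin I (s j * d))) => [|]; first by left.
move=> /forall_inPn[k kI]; rewrite negbK -/(rdesc _ k) rdescE => h.
right; exists k => //; have /rminP/(_ k kI) dk := dI.
have : ldesc (d * s k) j.
  move: (ndj); rewrite ldescN => jd; rewrite ldescE mulgA.
  have := len_genM cox (d * s k) j; have := len_Mgen cox (s j * d) k.
  rewrite mulgA; move: h jd dk; rewrite (len_genM cox d j).
  by do ![case: ifP => _]; move: (l d) (l (d * s k)) (l (s j * d * s k)) => a b c; lia.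
rewrite ?(ldesc_inversion cox) inversionM (negbTE (ndj : ~~ inversion cox d (s j))) inversion_gen /= => /eqP <-.
by rewrite -conjgC.
Qed.

Lemma rmin_uniq I d x : rmin I d -> rmin I x -> d^-1 * x \in W_ I -> x = d.
Proof.
move=> dI xI h; have := len_rminM dI h; rewrite mulKVg.
have h' : x^-1 * d \in W_ I by rewrite -groupV invMg invgK.
have := len_rminM xI h'; rewrite mulKVg => e1 e2.
have /(len_eq0 cox) e : l (d^-1 * x) = 0%N.
  by move: e1 e2; set a := l (d^-1 * x); lia.
by rewrite -[LHS](mulKVg d) e mulg1.
Qed.

Definition dcoset J I w : {set gT} := W_ J :* w * W_ I.

Lemma dcosetP J I w x :
  reflect (exists u v, [/\ u \in W_ J, v \in W_ I & x = u * w * v]) (x \in dcoset J I w).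
Proof.
apply: (iffP mulsgP) => [[y v /rcosetP[u uJ ->] vI ->]|[u [v [uJ vI ->]]]].
  by exists u, v.
by exists (u * w) v => //; apply/rcosetP; exists u.
Qed.

Lemma dcoset_refl J I w : w \in dcoset J I w.
Proof. by apply/dcosetP; exists 1, 1; rewrite !group1 mul1g mulg1. Qed.

Lemma dcoset_sym J I w x : x \in dcoset J I w -> w \in dcoset J I x.
Proof.
case/dcosetP=> u [v [uJ vI ->]]; apply/dcosetP; exists u^-1, v^-1.
by rewrite !groupV uJ vI -!mulgA mulKg mulgV mulg1.
Qed.

Lemma dcoset_trans J I w x y :
  x \in dcoset J I w -> y \in dcoset J I x -> y \in dcoset J I w.
Proof.
case/dcosetP=> u [v [uJ vI ->]] /dcosetP[u' [v' [uJ' vI' ->]]].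
by apply/dcosetP; exists (u' * u), (v * v'); rewrite !groupM // !mulgA.
Qed.

Lemma dcosetS J J' I I' w : J \subset J' -> I \subset I' -> dcoset J I w \subset dcoset J' I' w.
Proof. by move=> JJ' II'; apply/mulgSS/parabolicS/II'; apply/mulSg/parabolicS. Qed.

Lemma dcoset_l J I w u : u \in W_ J -> u * w \in dcoset J I w.
Proof. by move=> uJ; apply/dcosetP; exists u, 1; rewrite group1 mulg1. Qed.

Lemma dcoset_r J I w v : v \in W_ I -> w * v \in dcoset J I w.
Proof. by move=> vI; apply/dcosetP; exists 1, v; rewrite group1 mul1g. Qed.

(** Descents of u are peeled off on the left; by [deodhar] each letter either joins u' or crosses d
    and joins y. The last clause describes the stabiliser of d W_I in W_J: u' = 1 only if every
    letter has crossed. *)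
Lemma dcoset_decomp J I d u : lmin J d -> rmin I d -> u \in W_ J ->
  exists u' y, [/\ u' \in W_ J, y \in W_ I, u * d = u' * d * y, rmin I (u' * d) &
    u' = 1 -> u \in W_ [set j in J | [exists k in I, s j * d == d * s k]]].
Proof.
move=> dJ dI; have [n] := ubnP (l u); elim: n u => // n IH u un uJ.
have [->|u1] := eqVneq u 1.
  by exists 1, 1; rewrite !group1 mulg1 mul1g.
have [j jJ uj] := ldesc_parabolic cox uJ u1.
have u1J : s j * u \in W_ J by rewrite groupM ?gen_parabolic.
have lt1 : l (s j * u) < l u by rewrite -(ldescE cox).
have [|u' [y [uJ' yI e r1 h1]]] := IH _ _ u1J; first by lia.
have e' : u * d = s j * (u' * d) * y by rewrite -[LHS](genK cox j) [s j * (u * d)]mulgA e !mulgA.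
have [r2|[k kI ek]] := deodhar j r1.
  exists (s j * u'), y; rewrite -!mulgA !mulgA in e' r2 *; rewrite -e'.
  split=> //; first by rewrite groupM ?gen_parabolic.
  (* Here u d = d y and s_j u d = s_j d y, with lengths adding on both sides, so s_j u would be
     longer than u. *)
  move=> u'j; exfalso; have u'E : u' = s j by rewrite -[u'](genK cox j) u'j mulg1.
  move: e r1 uJ'; rewrite u'E => e r1 uJ'.
  have ud : u * d = d * y by apply: (mulgI (s j)); rewrite !mulgA e.
  have := congr1 l e; rewrite (len_lminM dJ u1J) (len_rminM r1 yI) (len_lminM dJ uJ') len_gen //.
  by have := congr1 l ud; rewrite (len_lminM dJ uJ) (len_rminM dI yI); lia.
exists u', (s k * y); rewrite groupM ?gen_parabolic // e' ek !mulgA.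
split=> // u'1; rewrite -(genK cox j u) groupM ?h1 //; apply: gen_parabolic.
rewrite inE jJ; apply/existsP; exists k; rewrite kI /=.
by move: ek; rewrite u'1 !mul1g => ->.
Qed.

Lemma dcoset_len J I d x : lmin J d -> rmin I d -> x \in dcoset J I d ->
  l d <= l x /\ (l x = l d -> x = d).
Proof.
move=> dJ dI /dcosetP[u [v [uJ vI ->]]].
have [u' [y [uJ' yI e r h]]] := dcoset_decomp dJ dI uJ.
rewrite e -mulgA (len_rminM r) ?groupM // (len_lminM dJ uJ').
split; first by lia.
move=> le; have /(len_eq0 cox) -> : l u' = 0%N by lia.
have /(len_eq0 cox) -> : l (y * v) = 0%N by move: le; set m := l (y * v); lia.
by rewrite mul1g mulg1.
Qed.

Definition dmin J I w := [arg min_(x < w in dcoset J I w) l x].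

Lemma dmin_in J I w : dmin J I w \in dcoset J I w.
Proof. by rewrite /dmin; case: arg_minnP => //; apply: dcoset_refl. Qed.

Lemma dmin_lmin J I w : lmin J (dmin J I w).
Proof.
rewrite /dmin; case: arg_minnP => [|d dw dm]; first exact: dcoset_refl.
apply/forall_inP => j jJ; apply/negP; rewrite ldescE; apply/negP; rewrite -leqNgt.
by apply/dm/(dcoset_trans dw); rewrite dcoset_l ?gen_parabolic.
Qed.

Lemma dmin_rmin J I w : rmin I (dmin J I w).
Proof.
rewrite /dmin; case: arg_minnP => [|d dw dm]; first exact: dcoset_refl.
apply/forall_inP => i iI; apply/negP; rewrite -/(rdesc d i) rdescE; apply/negP.
by rewrite -leqNgt; apply/dm/(dcoset_trans dw); rewrite dcoset_r ?gen_parabolic.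
Qed.

Lemma dmin_uniq J I w d : lmin J d -> rmin I d -> d \in dcoset J I w -> dmin J I w = d.
Proof.
move=> dJ dI dw; have dm := dcoset_trans (dcoset_sym dw) (dmin_in J I w).
have [le1 eq1] := dcoset_len dJ dI dm.
have [le2 _] := dcoset_len (dmin_lmin J I w) (dmin_rmin J I w) (dcoset_sym dm).
by apply: eq1; apply/eqP; rewrite eqn_leq le1 le2.
Qed.

Lemma dmin_id J I d : lmin J d -> rmin I d -> dmin J I d = d.
Proof. by move=> dJ dI; apply: dmin_uniq => //; apply: dcoset_refl. Qed.

Lemma dmin_eq J I w x : x \in dcoset J I w -> dmin J I x = dmin J I w.
Proof.
move=> xw; apply: dmin_uniq; [exact: dmin_lmin|exact: dmin_rmin|].
exact: dcoset_trans (dcoset_sym xw) (dmin_in _ _ _).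
Qed.

Lemma dmin_len J J' I d w : lmin J d -> rmin I d -> J' \subset J -> w \in dcoset J I d ->
  dmin J' I w <> d -> l d < l (dmin J' I w).
Proof.
move=> dJ dI J'J wd ne.
have h : dmin J' I w \in dcoset J I d.
  apply: dcoset_trans wd _; apply: (subsetP (dcosetS _ J'J (subxx I))); exact: dmin_in.
have [le eq] := dcoset_len dJ dI h; rewrite ltn_neqAle le andbT.
by apply/eqP => e; apply/ne/eq.
Qed.

(** This isolates the term v = 1 of a trace. If d were still minimal, some u v^-1 with u in W_(J :\
    j) would fix d W_I, hence be a product of letters that cross d; j is not among them, so v would
    lie in W_(J :\ j) and be trivial. *)
Lemma dmin_coset_neq J I d j v : lmin J d -> rmin I d ->
  ~~ [exists k in I, s j * d == d * s k] -> v \in W_ J -> rmin (J :\ j) v -> v != 1 ->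
  dmin (J :\ j) I (v^-1 * d) <> d.
Proof.
move=> dJ dI jd vJ vj v1 dm.
have /dcosetP[u [y [uJ yI e]]] : d \in dcoset (J :\ j) I (v^-1 * d) by rewrite -{1}dm dmin_in.
have JJ : W_ (J :\ j) \subset W_ J by apply/parabolicS/subsetDl.
have uvJ : u * v^-1 \in W_ J by rewrite groupM ?groupV // (subsetP JJ).
have ed : u * v^-1 * d = d * y^-1 by rewrite {2}e !mulgA mulgK.
have [u' [z [uJ' zI e' r h]]] := dcoset_decomp dJ dI uvJ.
have u'd : u' * d = d.
  apply: (rmin_uniq dI r); have -> : u' * d = d * y^-1 * z^-1 by rewrite -ed e' mulgK.
  by rewrite -mulgA mulKg groupM ?groupV.
have u'1 : u' = 1 by apply: (mulIg d); rewrite u'd mul1g.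
have {}h := h u'1; have vK : v \in W_ (J :\ j).
  rewrite -groupV -[v^-1](mulKg u) groupM ?groupV //; apply: subsetP h.
  apply/parabolicS/subsetP => i; rewrite !inE => /andP[-> id']; rewrite andbT.
  by apply: contraNneq jd => <-.
have /(lmin_parabolic vj) v1' : v^-1 \in W_ (J :\ j) by rewrite groupV.
by rewrite -invg_eq1 v1' eqxx in v1.
Qed.

Definition longest := [arg max_(w > 1 in [set: gT]) l w].
Local Notation w0 := longest.

Lemma longest_max w : l w <= l w0.
Proof. by rewrite /longest; case: arg_maxnP => [|w' _]; rewrite ?inE //; apply; rewrite inE. Qed.

(** Write u = s_j u' with u' shorter. As s_j is an inversion of w and not of u', its conjugate by u'
    is an inversion of u'^-1 w, so the length drops again. This characterises the longest element by
    its descents. *)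
Lemma all_ldesc_len w u : (forall j, ldesc w j) -> (l u + l (u^-1 * w))%N = l w.
Proof.
move=> h; have [n] := ubnP (l u); elim: n u => // n IH u un.
have [->|u1] := eqVneq u 1; first by rewrite invg1 mul1g len1.
have [j _ uj] := ldesc_parabolic cox (parabolicT cox u) u1.
have [u' uE] : exists u', u = s j * u' by exists (s j * u); rewrite genK.
have nu' : ~~ ldesc u' j by move: uj; rewrite uE ldesc_gen.
have lu' : l u = (l u').+1 by rewrite uE len_genM (negbTE nu').
have := IH u'; rewrite lu' in un => /(_ un) e.
have : inversion cox (u'^-1 * w) (s j ^ u').
  have := h j; rewrite ?(ldesc_inversion cox) -{1}(mulKVg u' w) inversionM.
  by rewrite (negbTE (nu' : ~~ inversion cox u' (s j))).
move/inversion_len; rewrite conjgE -!mulgA mulKVg mulgA -{1}(gen_inv cox j) -invMg -uE.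
have := len_mul cox u (u^-1 * w); rewrite mulKVg lu'.
set a := l (u^-1 * w); move: e; set b := l (u'^-1 * w); lia.
Qed.

Lemma longest_ldesc j : ldesc w0 j.
Proof. by apply: contraTT (longest_max (s j * w0)); rewrite ldescN -ltnNge. Qed.

Lemma longest_uniq w : (forall j, ldesc w j) -> w = w0.
Proof.
move=> h; have e := all_ldesc_len w0 h; have := longest_max w => le.
have /(len_eq0 cox) e1 : l (w0^-1 * w) = 0%N.
  by move: e le; set a := l (w0^-1 * w); lia.
by rewrite -[LHS](mulKVg w0) e1 mulg1.
Qed.

Lemma longestV : w0^-1 = w0.
Proof.
apply: longest_uniq => j; apply: contraTT (longest_max (s j * w0^-1)).
by rewrite ldescN lenV // -ltnNge.
Qed.

Lemma longest_len u : (l u + l (u^-1 * w0))%N = l w0.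
Proof. exact/all_ldesc_len/longest_ldesc. Qed.

Lemma star_ex i : exists j, s i ^ w0 == s j.
Proof.
suff /(len1_gen cox)[j ->] : l (s i ^ w0) = 1%N by exists j.
rewrite conjgE longestV.
have := longest_len (s i * w0); rewrite invMg longestV gen_inv // -mulgA.
have := longest_ldesc i; rewrite ldescE len_genM longest_ldesc.
set a := l (w0 * (s i * w0)); lia.
Qed.

Definition star i : S := xchoose (star_ex i).

Lemma starE i : s (star i) = s i ^ w0.
Proof. by apply/esym/eqP; apply: (xchooseP (star_ex i)). Qed.

Lemma gen_longest i : s i * w0 = w0 * s (star i).
Proof. by rewrite starE -conjgC. Qed.

Lemma starK : involutive star.
Proof.
move=> i; apply: (cox_inj cox).
by rewrite !starE -conjgM -{1}longestV mulVg conjg1.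
Qed.

Lemma gen_parabolicE I i : (s i \in W_ I) = (i \in I).
Proof.
apply/idP/idP => [iI|]; last exact: gen_parabolic.
have i1 : s i != 1 by apply/eqP => e; have := len_gen cox i; rewrite e len1.
have [j jI] := ldesc_parabolic cox iI i1.
by rewrite ?(ldesc_inversion cox) inversion_gen => /eqP/(cox_inj cox) <-.
Qed.

(** For d left J-minimal, these are the j that can be added to J or removed from it with d remaining
    the minimal representative, and that do not cross d to become a letter of I. *)
Definition ups I d : {set S} := [set j | ~~ ldesc d j && rmin I (s j * d)].

Lemma ups_lmin I J d j : lmin J d -> j \in ups I d -> lmin (j |: J) d.
Proof.
move=> /forall_inP dJ; rewrite inE => /andP[h _].
by apply/forall_inP => i; rewrite !inE => /orP[/eqP ->|/dJ].
Qed.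

Lemma ups_neq I d j : rmin I d -> j \in ups I d -> ~~ [exists k in I, s j * d == d * s k].
Proof.
move=> dI; rewrite inE => /andP[_ r]; apply/existsPn => k; apply/negP => /andP[kI /eqP e].
have := len_gen cox k; have := len1 s.
suff -> : s k = 1 by move=> ->.
have e1 : s j * d = d by apply: (rmin_uniq dI r); rewrite e mulKg gen_parabolic.
by apply: (mulgI d); rewrite -e e1 mulg1.
Qed.

(** The longest w in d W_I has all left descents. For each j, either s_j w stays in the coset, or
    s_j d is right minimal and j, not being in [ups I d], is a descent of d; in that case l (s_j w)
    = l (s_j d) + l (d^-1 w) is smaller than l w. *)
Lemma ups0_longest I d : rmin I d -> ups I d = set0 -> d^-1 * w0 \in W_ I.
Proof.
move=> dI u0; pose P x := d^-1 * x \in W_ I.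
have Pd : P d by rewrite /P mulVg group1.
suff [w Pw wmax] : exists2 w, P w & forall x, P x -> l x <= l w.
  rewrite -(longest_uniq (w := w)) // => j; rewrite ldescE.
  have [r|[k kI e]] := deodhar j dI; last first.
    have /wmax : P (s j * w).
      have dwE : d^-1 * (s j * w) = s k * (d^-1 * w).
        by rewrite -{1}(mulKVg d w) (mulgA (s j)) e -mulgA mulKg.
      by rewrite /P dwE groupM ?gen_parabolic.
    by rewrite len_genM; case: ifP; [move/len_gt0|]; lia.
  have jd : ldesc d j.
    apply: contraT => ndj; have : j \in ups I d by rewrite inE ndj.
    by rewrite u0 inE.
  have := len_rminM r Pw; have := len_rminM dI Pw; rewrite -!mulgA mulKVg => -> ->.
  by move: jd; rewrite ldescE; lia.
by exists [arg max_(x > d | P x) l x]; case: arg_maxnP.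
Qed.

Lemma ups_longest I d : rmin I d -> d^-1 * w0 \in W_ I -> ups I d = set0.
Proof.
move=> dI dw; apply/setP => j; rewrite !inE; apply/negP => /andP[ndj r].
have := len_rminM r dw; have := len_rminM dI dw; rewrite -mulgA mulKVg.
have := longest_max (s j * w0); move: ndj; rewrite ldescN.
set a := l (d^-1 * w0); set b := l (s j * w0); set c := l (s j * d); lia.
Qed.

Lemma lmin_longest I J d : rmin I d -> d^-1 * w0 \in W_ I ->
  lmin J d = (star @: J \subset I).
Proof.
move=> dI dw; apply/forall_inP/subsetP => [h _ /imsetP[j jJ ->]|h j jJ].
  rewrite -gen_parabolicE; have [r|[k kI e]] := deodhar j dI.
    have : j \in ups I d by rewrite inE h.
    by rewrite ups_longest // inE.
  have -> : s (star j) = (d^-1 * w0)^-1 * (s k * (d^-1 * w0)).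
    rewrite -[LHS](mulKg w0) -gen_longest invMg invgK -!mulgA; congr (_ * _).
    by rewrite (mulgA d) -e -mulgA mulKVg.
  by rewrite groupM ?groupV // groupM ?gen_parabolic.
apply/negP; rewrite ldescE => lt.
have : d^-1 * (s j * d) \in W_ I.
  have -> : s j * d = w0 * (s (star j) * (w0^-1 * d)).
    by rewrite mulgA -gen_longest -mulgA mulKVg.
  rewrite mulgA groupM // groupM ?gen_parabolic ?h ?imset_f //.
  by rewrite -groupV invMg invgK.
by move/(len_rminM dI); rewrite mulKVg; lia.
Qed.

End DoubleCosets.

(** * The acyclic matching *)

Section Morse.
Variables (gT : finGroupType) (S : finType) (s : S -> gT).
Hypothesis cox : coxeter_system s.
Local Open Scope group_scope.
Local Notation l := (len s).
Local Notation rdesc := (rdesc cox).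
Local Notation lmin := (lmin cox).
Local Notation rmin := (rmin cox).
Local Notation W_ := (parabolic s).
Local Notation dmin := (dmin s).
Local Notation w0 := (longest s).
Local Notation star := (star cox).
Local Notation ups := (ups cox).
Implicit Types (w u v d x y : gT) (i j : S) (I J K : {set S}).

Variables (X : Type) (A : pzRingType) (M : lmodType A).
Local Notation V := (X -> M).
Implicit Types (b : X -> M) (f : gT -> X -> M).

Definition vzero : V := fun => 0%R.
Definition vsign (n : nat) b : V := fun a => ((-1) ^+ n *: b a)%R.

Variables (L R : S -> V -> V) (kap kap' : {set S} -> {set S} -> S -> nat) (rho op : gT -> V -> V).

(** Common axioms for the two orders of composition. [rho w] models the action of the inverse of
    h_(w0) times h_w on the right-hand side, and [op v] the coefficient of v in a trace. *)
Record biaction : Prop := Biaction {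
  bi_L0 : forall j, L j vzero = vzero;
  bi_R0 : forall j, R j vzero = vzero;
  bi_LN : forall j b, L j (fun a => - b a)%R = (fun a => - L j b a)%R;
  bi_RN : forall j b, R j (fun a => - b a)%R = (fun a => - R j b a)%R;
  bi_LD : forall j b b', L j (fun a => b a + b' a)%R = (fun a => L j b a + L j b' a)%R;
  bi_RD : forall j b b', R j (fun a => b a + b' a)%R = (fun a => R j b a + R j b' a)%R;
  bi_rhoD : forall w b b',
    rho w (fun a => b a + b' a)%R = (fun a => rho w b a + rho w b' a)%R;
  bi_LR : forall i j b, L j (R i b) = R i (L j b);
  bi_Rinj : forall i, injective (R i);
  bi_rho0 : forall w, rho w vzero = vzero;
  bi_Lrho : forall j w b, L j (rho w b) = rho w (L j b);
  bi_rho1 : forall b, rho w0 b = b;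
  bi_rhoR : forall i w b, l w < l (w * s i) -> rho (w * s i) b = R i (rho w b);
  bi_rhoL : forall j w b, l w < l (s j * w) -> rho (s j * w) b = rho w (R (star j) b);
  bi_op0 : forall w, op w vzero = vzero;
  bi_op1 : forall b, op 1 b = b
}.
Hypothesis bi : biaction.

(** Only steps that increase the length are imposed: at a descending step the quadratic relation
    intervenes, and its effect follows from the ascending steps, as in [ext_gen]. *)
Definition biequiv J I (f : gT -> V) : Prop :=
  (forall j w, j \in J -> l w < l (s j * w) -> f (s j * w) = L j (f w)) /\
  (forall i w, i \in I -> l w < l (w * s i) -> f (w * s i) = R i (f w)).

Lemma biequivS J J' I I' f : J' \subset J -> I' \subset I -> biequiv J I f -> biequiv J' I' f.
Proof.
move=> /subsetP JJ /subsetP II [h1 h2].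
by split=> [j w /JJ|i w /II]; [apply: h1|apply: h2].
Qed.

Lemma vsignE n b : vsign n b = if odd n then (fun a => - b a)%R else b.
Proof.
apply: funext => a; rewrite /vsign -signr_odd.
by case: (odd n); rewrite ?expr1 ?expr0 ?scaleN1r ?scale1r.
Qed.

Lemma vsign0 n : vsign n vzero = vzero.
Proof. by apply: funext => a; rewrite /vsign /vzero scaler0. Qed.

Lemma vsignK n b : vsign n (vsign n b) = b.
Proof. by apply: funext => a; rewrite /vsign scalerA -expr2 sqrr_sign scale1r. Qed.

Lemma vsign_L n j b : L j (vsign n b) = vsign n (L j b).
Proof. by rewrite !vsignE; case: (odd n); rewrite ?(bi_LN bi). Qed.

Lemma vsign_R n j b : R j (vsign n b) = vsign n (R j b).
Proof. by rewrite !vsignE; case: (odd n); rewrite ?(bi_RN bi). Qed.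

Lemma biequiv_sign J I n f : biequiv J I f -> biequiv J I (fun w => vsign n (f w)).
Proof.
by case=> h1 h2; split=> [j w jJ lt|i w iI lt]; rewrite ?vsign_L ?vsign_R ?h1 ?h2.
Qed.

Lemma biequivD J I f f' : biequiv J I f -> biequiv J I f' ->
  biequiv J I (fun w a => f w a + f' w a)%R.
Proof.
case=> fl fr [fl' fr']; split=> [j w jJ lt|i w iI lt].
  by rewrite (bi_LD bi) fl // fl'.
by rewrite (bi_RD bi) fr // fr'.
Qed.

Lemma biequiv0 J I : biequiv J I (fun => vzero).
Proof. by split=> *; rewrite ?(bi_L0 bi) ?(bi_R0 bi). Qed.

Lemma biequiv_eq J I f f' w : biequiv J I f -> biequiv J I f' ->
  f (dmin J I w) = f' (dmin J I w) -> f w = f' w.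
Proof.
move=> [fl fr] [fl' fr']; have [n] := ubnP (l w); elim: n w => // n IH w wn e.
have [wJ|] := boolP (lmin J w); last first.
  case/forall_inPn=> j jJ; rewrite negbK ldescE => lt.
  have lt' : l (s j * w) < l (s j * (s j * w)) by rewrite genK.
  have := fl _ _ jJ lt'; have := fl' _ _ jJ lt'; rewrite genK // => -> ->.
  congr (L j _); apply: IH; first exact: leq_trans lt _.
  by rewrite (dmin_eq (w := w) cox) // dcoset_l ?gen_parabolic.
have [wI|] := boolP (rmin I w); last first.
  case/forall_inPn=> i iI; rewrite negbK -/(rdesc w i) rdescE => lt.
  have lt' : l (w * s i) < l (w * s i * s i) by rewrite (genKr cox).
  have := fr _ _ iI lt'; have := fr' _ _ iI lt'; rewrite (genKr cox) => -> ->.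
  congr (R i _); apply: IH; first exact: leq_trans lt _.
  by rewrite (dmin_eq (w := w) cox) // dcoset_r ?gen_parabolic.
by move: e; rewrite (dmin_id wJ wI).
Qed.

Lemma biequiv_dmin0 J I f w : biequiv J I f -> f (dmin J I w) = vzero -> f w = vzero.
Proof. by move=> bf e; apply: (biequiv_eq bf (biequiv0 J I)). Qed.

Lemma long_dmin J I w : star @: J \subset I -> w0^-1 * w \in W_ I ->
  dmin J I w = dmin set0 I w.
Proof.
move=> JI wI; have dI := dmin_rmin cox set0 I w.
have /dcosetP[u [v [/parabolic0 -> vI]]] := dmin_in s set0 I w; rewrite mul1g => dw.
have d0 : (dmin set0 I w)^-1 * w0 \in W_ I.
  by rewrite dw invMg -mulgA groupM ?groupV // -groupV invMg invgK.
apply: dmin_uniq => //; first by rewrite (lmin_longest J dI d0).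
by rewrite dw dcoset_r.
Qed.

Lemma long_ups J I w : star @: J \subset I -> w0^-1 * w \in W_ I -> ups I (dmin J I w) = set0.
Proof.
move=> JI wI; rewrite long_dmin //; apply: ups_longest; first exact: dmin_rmin.
have /dcosetP[u [v [/parabolic0 -> vI]]] := dmin_in s set0 I w; rewrite mul1g => ->.
by rewrite invMg -mulgA groupM ?groupV // -groupV invMg invgK.
Qed.

Lemma conj_longest J I u : star @: J \subset I -> u \in W_ J -> u ^ w0 \in W_ I.
Proof.
move=> /subsetP JI /parabolic_word[p pJ ->]; elim: p pJ => [|j p IH] /=.
  by rewrite /wprod big_nil conj1g group1.
case/andP=> jJ pJ; rewrite wprod_cons conjMg groupM ?IH // -(starE cox).
by rewrite gen_parabolic ?JI ?imset_f.
Qed.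

Lemma ups0_long J I w : ups I (dmin J I w) = set0 ->
  star @: J \subset I /\ w0^-1 * w \in W_ I.
Proof.
move=> u0; have dI := dmin_rmin cox J I w; have dw := ups0_longest dI u0.
have JI : star @: J \subset I by rewrite -(lmin_longest J dI dw) dmin_lmin.
split=> //; have /dcosetP[u [v [uJ vI ->]]] := dcoset_sym (dmin_in s J I w).
have -> : w0^-1 * (u * dmin J I w * v) = u ^ w0 * (w0^-1 * dmin J I w) * v.
  by rewrite conjgE -!mulgA mulKVg.
by rewrite groupM // groupM ?(conj_longest JI uJ) // -groupV invMg invgK.
Qed.

(** Induction downwards from w0: some w s_i with i in I is longer than w and lies in the same coset.
    Both sides at w s_i are [R i] of the sides at w, and [R i] is injective. *)
Lemma biequiv_rho J I f w : biequiv J I f -> w0^-1 * w \in W_ I -> f w = rho w (f w0).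
Proof.
case=> _ fr; have [n] := ubnP (l w0 - l w); elim: n w => // n IH w wn wI.
have [e|ne] := eqVneq (w^-1 * w0) 1.
  by rewrite -[w0](mulKVg w) e mulg1 -{2}[w](mulg1 w) -e mulKVg (bi_rho1 bi).
have wI' : w^-1 * w0 \in W_ I by rewrite -groupV invMg invgK.
have [i iI id] := ldesc_parabolic cox wI' ne.
have lt : l w < l (w * s i).
  have := longest_len cox w; have := longest_len cox (w * s i).
  rewrite invMg gen_inv // -mulgA; move: id; rewrite ldescE.
  by set a := l (_ * (_ * _)); set b := l (_ * w0); lia.
apply: (bi_Rinj bi (i := i)); rewrite -fr // -(bi_rhoR bi) //; apply: IH.
  by have := longest_max s (w * s i); lia.
by rewrite mulgA groupM ?gen_parabolic.
Qed.

Local Notation fam := ({set S} -> {set S} -> gT -> V).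
Implicit Types (e : fam).

Definition ups_pick I d := [pick j in ups I d].
Definition star_pick J := [pick i | i \notin star @: J].

(* The homotopy of an acyclic matching of the cells (J, I, W_J w W_I).  Let d be
   minimal in W_J w W_I.  If [ups I d] is not empty, the cell is matched by
   adding to J, or removing from it, some j in [ups I d].  Otherwise the double
   coset is w0 W_I and [star @: J \subset I] (see [ups0_long]), and the cell is
   matched by adding to I, or removing from it, some i outside [star @: J].
   Only the cell J = I = S is left over. *)
Definition sig e : fam := fun J I w =>
  let d := dmin J I w in
  if ups_pick I d is Some j then
    if j \in J then vzero else vsign (kap (j |: J) I j) (e (j |: J) I w)
  else if star_pick J is Some i then
    if i \in I then vsign (kap' J (I :\ i) i) (rho w (e J (I :\ i) w0)) else vzero
  else vzero.

Definition biequivs e := forall J I, biequiv J I (e J I).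

Lemma ups_pickP I d j : ups_pick I d = Some j -> j \in ups I d.
Proof. by rewrite /ups_pick; case: pickP => // ? h [<-]. Qed.

Lemma ups_pick0 I d : ups_pick I d = None -> ups I d = set0.
Proof.
rewrite /ups_pick; case: pickP => // h _; apply/setP => j; rewrite in_set0.
exact: h.
Qed.

Lemma sig_biequiv e : biequivs e -> biequivs (sig e).
Proof.
move=> be J I; split=> [j w jJ lt|i w iI lt]; rewrite /sig.
  rewrite (dmin_eq (w := w) cox) ?dcoset_l ?gen_parabolic //.
  case E: (ups_pick _ _) => [j'|].
    case: ifP => _; rewrite ?(bi_L0 bi) // vsign_L; congr vsign.
    by case: (be (j' |: J) I) => h _; apply: h; rewrite // inE jJ orbT.
  case E': (star_pick J) => [i|]; rewrite ?(bi_L0 bi) //.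
  case: ifP => iI; rewrite ?(bi_L0 bi) // vsign_L (bi_rhoL bi) // (bi_Lrho bi).
  congr vsign; congr (rho w _); have [fl fr] := be J (I :\ i).
  have [JI _] := ups0_long (ups_pick0 E).
  (* The pick i avoids [star @: J], so e J (I :\ i) is still right equivariant for star j. As s_j w0
     = w0 s_(star j), its values at w0 and at s_j w0 show that [L j] and [R (star j)] agree on the
     value at w0. *)
  have jI : star j \in I :\ i.
    rewrite !inE (subsetP JI) ?imset_f // andbT; apply: contraTneq (imset_f star jJ) => ->.
    by move: E'; rewrite /star_pick; case: pickP => // i' ? [<-].
  have lt' : l (s j * w0) < l (s j * (s j * w0)) by rewrite (genK cox) -(ldescE cox) longest_ldesc.
  have e1 : w0 = s j * w0 * s (star j) by rewrite gen_longest (genKr cox).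
  have lt2 : l (s j * w0) < l (s j * w0 * s (star j)) by rewrite -e1 -(ldescE cox) longest_ldesc.
  have := fr _ _ jI lt2; rewrite -e1 => e2.
  have := fl _ _ jJ lt'; rewrite genK // => e3.
  by rewrite {1}e3 e2 (bi_LR bi).
rewrite (dmin_eq (w := w) cox) ?dcoset_r ?gen_parabolic //.
case: (ups_pick _ _) => [j'|].
  case: ifP => _; rewrite ?(bi_R0 bi) // vsign_R; congr vsign.
  by case: (be (j' |: J) I) => _ h; apply: h.
case: (star_pick J) => [i'|]; rewrite ?(bi_R0 bi) //.
by case: ifP => iI'; rewrite ?(bi_R0 bi) // vsign_R (bi_rhoR bi).
Qed.

Lemma sigD e e' J I w a :
  sig (fun J I w a => e J I w a + e' J I w a)%R J I w a = (sig e J I w a + sig e' J I w a)%R.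
Proof.
rewrite /sig; case: (ups_pick _ _) => [j|].
  by case: ifP => _; rewrite /vsign /vzero ?addr0 // scalerDr.
case: (star_pick J) => [i|]; rewrite /vzero ?addr0 //.
by case: ifP => _; rewrite ?addr0 // /vsign (bi_rhoD bi) scalerDr.
Qed.

(** Stated only at left J-minimal d, where the product of h_(v^-1) and h_d is again a basis element;
    equivariance determines the other values. *)
Definition Dspec e De := forall J I d a, lmin J d -> De J I d a =
  (\sum_(j in J) (-1) ^+ kap J I j *:
     \sum_(v in W_ J | rmin (J :\ j) v) op v (e (J :\ j) I (v^-1 * d)%g) a +
   \sum_(i in ~: I) (-1) ^+ kap' J I i *: e J (i |: I) d a)%R.

(* [rank1] and [rank2] order the pairs matched through J and through I, the
   latter coming first, so that the differential is triangular with respect to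
   the matching. *)
Definition miss (o : option S) I := if o is Some i then #|I :\ i| else #|I|.
Definition rank2 J I := (#|J| * #|S|.+1 + (#|S| - miss (star_pick J) I))%N.
(** The rank of the critical cell J = I = S: above [rank2] whenever J is not S, and below every
    [rank1]. *)
Definition ranktop := (#|S| * #|S|.+1)%N.
(** A lexicographic order written in mixed radix: the rank grows when I shrinks, then when d gets
    shorter, then when J grows. [miss] leaves out the pick, so the two cells of a pair have the same
    rank. *)
Definition rank1 J I d := (ranktop.+1 +
  (((#|S| - #|I|) * (l w0).+1 + (l w0 - l d)) * #|S|.+1 + miss (ups_pick I d) J))%N.
Definition rankmax := (ranktop.+1 + ((#|S| * (l w0).+1 + l w0) * #|S|.+1 + #|S|).+1)%N.

(** On a coset w0 W_I the filtration reads the value at w0, which does not move with I as the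
    shortest element does; [biequiv_rho] recovers the other values. *)
Definition Fil k e :=
  (forall J I d, lmin J d -> rmin I d -> ups I d != set0 -> rank1 J I d < k ->
     e J I d = vzero) /\
  (forall J I, star @: J \subset I -> rank2 J I < k -> e J I w0 = vzero).

Lemma FilW k k' e : k' <= k -> Fil k e -> Fil k' e.
Proof.
by move=> kk [h1 h2]; split=> *; [apply: h1|apply: h2] => //; apply: leq_trans kk.
Qed.

Lemma star_pickP J i : star_pick J = Some i -> i \notin star @: J.
Proof. by rewrite /star_pick; case: pickP => // ? h [<-]. Qed.

Lemma star_pickT J i : star_pick J = Some i -> J != setT.
Proof.
move/star_pickP; apply: contraNneq => ->.
by apply/imsetP; exists (star i); rewrite ?starK.
Qed.

Lemma star_subD1 J I i : star_pick J = Some i -> star @: J \subset I -> star @: J \subset I :\ i.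
Proof. by move=> /star_pickP iJ JI; rewrite subsetD1 JI. Qed.

Lemma miss_le o I : miss o I <= #|S|.
Proof. by case: o => [i|]; apply: max_card. Qed.

Lemma rank2_lt J I : J != setT -> rank2 J I < ranktop.
Proof.
move=> JT; have lt : #|J| < #|S|.
  rewrite -cardsT; apply: proper_card; by rewrite properT.
by rewrite /rank2 /ranktop; nia.
Qed.

Lemma rank2_1 J I J' I' d : J != setT \/ I = setT -> rank2 J I < rank1 J' I' d.
Proof.
have [-> [//|->]|JT _] := eqVneq J setT.
  rewrite /rank2 /rank1 /ranktop /star_pick; case: pickP => [i|_ /=].
    case/negP; apply/imsetP; exists (star i); rewrite ?starK //.
  by rewrite cardsT subnn addn0 addSn ltnS leq_addr.
by rewrite (leq_trans (rank2_lt I JT)) // /rank1 addSn leqW // leq_addr.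
Qed.

Lemma rank1_lt J I J' I' d d' :
  #|I'| < #|I| \/ I = I' /\ (l d' < l d \/ d = d' /\ miss (ups_pick I d) J < miss (ups_pick I d') J') ->
  rank1 J I d < rank1 J' I' d'.
Proof.
have ld := longest_max s d; have ld' := longest_max s d'.
have m := miss_le (ups_pick I d) J; have m' := miss_le (ups_pick I' d') J'.
rewrite /rank1; case=> [lt|[<- [lt|[<- lt]]]].
- have lt' : (#|S| - #|I| < #|S| - #|I'|)%N by have := max_card I; lia.
  nia.
- have : (l w0 - l d < l w0 - l d')%N by lia.
  nia.
- by rewrite ltn_add2l ltn_add2l.
Qed.

Lemma rank1_max J I d : rank1 J I d < rankmax.
Proof.
have m := miss_le (ups_pick I d) J; rewrite /rank1 /rankmax ltn_add2l ltnS.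
apply: leq_add => //; rewrite leq_mul2r; apply/orP; right; apply: leq_add; last exact: leq_subr.
by rewrite leq_mul2r leq_subr orbT.
Qed.

Lemma Fil_vanish k e J I w : biequivs e -> Fil k e ->
  (ups I (dmin J I w) != set0 -> rank1 J I (dmin J I w) < k) ->
  (ups I (dmin J I w) = set0 -> rank2 J I < k) -> e J I w = vzero.
Proof.
move=> be [h1 h2] k1 k2; have [u0|u0] := eqVneq (ups I (dmin J I w)) set0.
  have [JI wI] := ups0_long u0.
  by rewrite (biequiv_rho (be J I) wI) h2 ?k2 // (bi_rho0 bi).
by apply: (biequiv_dmin0 (be J I)); apply: h1; rewrite ?k1 ?dmin_lmin ?dmin_rmin.
Qed.

Lemma Fil_vanish1 e J I w J' I' d : biequivs e -> Fil (rank1 J' I' d) e ->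
  (ups I (dmin J I w) != set0 -> rank1 J I (dmin J I w) < rank1 J' I' d) ->
  e J I w = vzero.
Proof.
move=> be fe k1; apply: Fil_vanish be fe k1 _ => /ups0_long[JI _].
apply: rank2_1; have [JT|] := eqVneq J setT; [right|by left].
apply/eqP; rewrite -subTset; apply: subset_trans JI; apply/subsetP => i _.
by apply/imsetP; exists (star i); rewrite ?starK ?JT.
Qed.

Lemma Fil_vanish2 e k J I w : biequivs e -> Fil k e ->
  star @: J \subset I -> w0^-1 * w \in W_ I -> rank2 J I < k -> e J I w = vzero.
Proof.
move=> be fe JI wI lt; apply: (Fil_vanish be fe) => //.
by rewrite (long_ups JI wI) eqxx.
Qed.

Lemma sig1_I e J I d i : biequivs e -> lmin J d -> rmin I d -> Fil (rank1 J I d) e ->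
  i \notin I -> forall w, sig e J (i |: I) w = vzero.
Proof.
move=> be dJ dI fe iI w; have ltI : #|I| < #|i |: I| by rewrite cardsU1 iI add1n.
rewrite /sig; case E: (ups_pick _ _) => [j|].
  case: ifP => _ //; rewrite (Fil_vanish1 be fe) ?vsign0 // => _.
  by apply: rank1_lt; left.
case E': (star_pick J) => [i'|] //; case: ifP => // _.
have [JI wI] := ups0_long (ups_pick0 E).
rewrite (Fil_vanish2 be fe) ?(bi_rho0 bi) ?vsign0 ?mulVg ?group1 ?star_subD1 //.
by apply: rank2_1; left; apply: star_pickT E'.
Qed.

Lemma sig1_J e J I d j w : biequivs e -> lmin J d -> rmin I d -> Fil (rank1 J I d) e ->
  w \in dcoset s J I d -> dmin (J :\ j) I w <> d -> sig e (J :\ j) I w = vzero.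
Proof.
move=> be dJ dI fe wd ne; have sJ : J :\ j \subset J by apply: subsetDl.
have lt := dmin_len dJ dI sJ wd ne.
rewrite /sig; case E: (ups_pick _ _) => [j'|].
  case: ifP => // j'J; rewrite (Fil_vanish1 be fe) ?vsign0 // => _.
  suff -> : dmin (j' |: J :\ j) I w = dmin (J :\ j) I w by apply: rank1_lt; right; split; [|left].
  apply: dmin_uniq; [|exact: dmin_rmin|].
    by apply: ups_lmin (ups_pickP E); apply: dmin_lmin.
  by apply: (subsetP (dcosetS _ _ _ _)); last exact: dmin_in; rewrite ?subsetUr.
case E': (star_pick _) => [i'|] //; case: ifP => // _.
have [JI wI] := ups0_long (ups_pick0 E).
rewrite (Fil_vanish2 be fe) ?(bi_rho0 bi) ?vsign0 ?mulVg ?group1 ?star_subD1 //.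
by apply: rank2_1; left; apply: star_pickT E'.
Qed.

Lemma sig_at e J I w d j : dmin J I w = d -> ups_pick I d = Some j ->
  sig e J I w = if j \in J then vzero else vsign (kap (j |: J) I j) (e (j |: J) I w).
Proof. by rewrite /sig => -> ->. Qed.

Lemma vsumE (a : X) (n : nat) b : b = vzero -> ((-1) ^+ n *: b a)%R = 0%R.
Proof. by move=> ->; rewrite scaler0. Qed.

(** The pick j0 returns e J I d through the term v = 1, in the differential of [sig e] if j0 is in J
    and in [sig De] otherwise. Every other term is a value of [sig] that vanishes by definition, or
    involves a larger I, a longer representative or a smaller J, hence a cell of lower rank. *)
Lemma morse1 e De Dse J I d a :
  biequivs e -> Dspec e De -> Dspec (sig e) Dse ->
  lmin J d -> rmin I d -> ups I d != set0 -> Fil (rank1 J I d) e ->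
  e J I d a = (Dse J I d a + sig De J I d a)%R.
Proof.
move=> be eD eDs dJ dI u0 fe.
have dd J' : lmin J' d -> dmin J' I d = d by move=> h; apply: dmin_id.
case E: (ups_pick I d) => [j0|]; last by rewrite (ups_pick0 E) eqxx in u0.
have j0u := ups_pickP E; have nj0 := ups_neq dI j0u.
have dJ0 := ups_lmin dJ j0u.
have inJ J' v : v \in W_ J' -> v^-1 * d \in dcoset s J' I d.
  by move=> vJ; rewrite dcoset_l ?groupV.
rewrite (sig_at De (dd _ dJ) E) eDs //.
rewrite [X in (_ + X + _)%R]big1 ?addr0 => [|i]; last first.
  by rewrite inE => iI; apply: vsumE; apply: (sig1_I be dJ dI fe).
case: ifP => j0J.
  rewrite addr0 (bigD1 j0) //= [X in (_ + X)%R]big1 ?addr0 => [|j /andP[jJ jj0]]; last first.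
    rewrite big1 ?scaler0 // => v /andP[vJ _].
    suff -> : sig e (J :\ j) I (v^-1 * d) = vzero by rewrite (bi_op0 bi).
    have [dm|/eqP dm] := eqVneq (dmin (J :\ j) I (v^-1 * d)) d.
      by rewrite (sig_at _ dm E) !inE eq_sym jj0 j0J.
    exact: (sig1_J be dJ dI fe (inJ _ _ vJ) dm).
  rewrite (bigD1 1) /=; last by rewrite group1 ?(rminV cox) invg1 lmin1.
  rewrite [X in (_ + X)%R]big1 ?addr0 => [|v /andP[/andP[vJ vr] v1]]; last first.
    rewrite (sig1_J be dJ dI fe (inJ _ _ vJ)) ?(bi_op0 bi) //.
    exact: dmin_coset_neq.
  rewrite (bi_op1 bi) invg1 mul1g (sig_at (d := d) _ _ E); last first.
    by apply/dd/lminS/dJ/subsetDl.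
  rewrite !inE eqxx /= setD1K //.
  by rewrite -[LHS](congr1 (fun b => b a) (vsignK (kap J I j0) (e J I d))).
rewrite big1 ?add0r => [|j jJ]; last first.
  rewrite big1 ?scaler0 // => v /andP[vJ _].
  suff -> : sig e (J :\ j) I (v^-1 * d) = vzero by rewrite (bi_op0 bi).
  have [dm|/eqP dm] := eqVneq (dmin (J :\ j) I (v^-1 * d)) d; last first.
    exact: (sig1_J be dJ dI fe (inJ _ _ vJ) dm).
  rewrite (sig_at _ dm E) !inE j0J andbF (Fil_vanish1 be fe) ?vsign0 // => _.
  have -> : dmin (j0 |: J :\ j) I (v^-1 * d) = d.
    apply: dmin_uniq => //; first by apply: lminS dJ0; apply/setUS/subsetDl.
    rewrite -{1}dm; apply: (subsetP (dcosetS _ _ _ _)); last exact: dmin_in; rewrite ?subsetUr //.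
  apply: rank1_lt; right; split=> //; right; split=> //; rewrite E /=.
  rewrite setU1K ?inE ?j0J ?andbF //.
  have -> : J :\ j0 = J.
    by apply/setP => z; rewrite !inE; case: eqVneq => [->|_] //=; rewrite j0J.
  by rewrite [X in _ < X](cardsD1 j) jJ.
rewrite /vsign eD // scalerDr.
rewrite [X in (_ + _ *: X)%R]big1 ?scaler0 ?addr0 => [|i]; last first.
  rewrite inE => iI; apply: vsumE; apply: (Fil_vanish1 be fe) => _.
  by apply: rank1_lt; left; rewrite cardsU1 iI add1n.
rewrite (bigD1 j0) ?setU11 //= [X in (_ + X)%R]big1 ?addr0 => [|j /andP[jJ jj0]]; last first.
  rewrite big1 ?scaler0 // => v /andP[vJ _].
  suff -> : e ((j0 |: J) :\ j) I (v^-1 * d) = vzero by rewrite (bi_op0 bi).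
  apply: (Fil_vanish1 be fe) => _.
  have [dm|/eqP dm] := eqVneq (dmin ((j0 |: J) :\ j) I (v^-1 * d)) d; last first.
    apply: rank1_lt; right; split=> //; left.
    by apply: (dmin_len dJ0 dI _ _ dm); rewrite ?subsetDl // inJ.
  rewrite dm; apply: rank1_lt; right; split=> //; right; split=> //; rewrite E /=.
  have jJ' : j \in J by move: jJ; rewrite !inE (negbTE jj0).
  have -> : ((j0 |: J) :\ j) :\ j0 = J :\ j.
    apply/setP => z; rewrite !inE; case: eqVneq => [->|_] //=.
    by rewrite j0J andbF.
  have -> : J :\ j0 = J.
    by apply/setP => z; rewrite !inE; case: eqVneq => [->|_] //=; rewrite j0J.
  by rewrite [X in _ < X](cardsD1 j) jJ'.
rewrite setU1K ?j0J // (bigD1 1) /=; last by rewrite group1 ?(rminV cox) invg1 lmin1.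
rewrite [X in (_ *: (_ + X))%R]big1 ?addr0 => [|v /andP[/andP[vJ vr] v1]]; last first.
  rewrite (Fil_vanish1 be fe) ?(bi_op0 bi) // => _; apply: rank1_lt; right; split=> //; left.
  apply: (dmin_len dJ0 dI _ (inJ _ _ vJ)); first exact: subsetUr.
  by have := dmin_coset_neq (j := j0) dJ0 dI nj0 vJ; rewrite setU1K ?j0J // => /(_ vr v1).
by rewrite invg1 mul1g (bi_op1 bi) scalerA -expr2 sqrr_sign scale1r.
Qed.

Lemma dmin_long J I : star @: J \subset I -> w0^-1 * dmin J I w0 \in W_ I.
Proof.
move=> JI; rewrite long_dmin ?mulVg ?group1 //.
have /dcosetP[u [v [/parabolic0 -> vI ->]]] := dmin_in s set0 I w0.
by rewrite mul1g mulKg.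
Qed.

Lemma mul_long J I v d : star @: J \subset I -> v \in W_ J -> w0^-1 * d \in W_ I ->
  w0^-1 * (v^-1 * d) \in W_ I.
Proof.
move=> JI vJ dI; have -> : w0^-1 * (v^-1 * d) = v^-1 ^ w0 * (w0^-1 * d).
  by rewrite conjgE -!mulgA mulKVg.
by rewrite groupM // (conj_longest JI) ?groupV.
Qed.

Lemma star_T J I : star @: J \subset I -> J = setT -> I = setT.
Proof.
move=> JI JT; apply/eqP; rewrite -subTset; apply: subset_trans JI; apply/subsetP => i _.
by apply/imsetP; exists (star i); rewrite ?starK ?JT.
Qed.

Lemma starS J J' I : J \subset J' -> star @: J' \subset I -> star @: J \subset I.
Proof. by move=> JJ'; apply/subset_trans/imsetS. Qed.

Lemma Dspec_long e De J I a : biequivs e -> Dspec e De -> star @: J \subset I ->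
  (forall j, j \in J -> e (J :\ j) I w0 = vzero) ->
  De J I (dmin J I w0) a =
    (\sum_(i in ~: I) (-1) ^+ kap' J I i *: e J (i |: I) (dmin J I w0) a)%R.
Proof.
move=> be eD JI e0; rewrite eD ?dmin_lmin // big1 ?add0r // => j jJ.
rewrite big1 ?scaler0 // => v /andP[vJ _].
rewrite (biequiv_rho (be _ I)) ?e0 ?(bi_rho0 bi) ?(bi_op0 bi) //.
exact: mul_long JI vJ (dmin_long JI).
Qed.

Lemma sig_long e J I w : star @: J \subset I -> w0^-1 * w \in W_ I ->
  sig e J I w = if star_pick J is Some i then
    if i \in I then vsign (kap' J (I :\ i) i) (rho w (e J (I :\ i) w0)) else vzero
  else vzero.
Proof.
move=> JI wI; rewrite /sig; case E: (ups_pick _ _) => [j|] //.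
by have := ups_pickP E; rewrite (long_ups JI wI) inE.
Qed.

(** Transfers an identity from the shortest element of the coset, where [Dspec] applies, to w0,
    where the filtration is stated. *)
Lemma biequiv_long J I f f' : biequiv J I f -> biequiv J I f' ->
  (forall a, f (dmin J I w0) a = f' (dmin J I w0) a) -> f w0 = f' w0.
Proof. by move=> bf bf' e; apply: (biequiv_eq bf bf'); apply: funext => a. Qed.

(** The trace terms come from J :\ j, whose [rank2] is lower whatever I is. Among the inclusions,
    adding any i other than the pick also lowers the rank, so only the pick returns e J I w0. The
    assumption on J guarantees that there is a pick. *)
Lemma morse2 e De Dse J I a :
  biequivs e -> biequivs De -> biequivs Dse -> Dspec e De -> Dspec (sig e) Dse ->
  J != setT -> star @: J \subset I -> Fil (rank2 J I) e ->
  e J I w0 a = (Dse J I w0 a + sig De J I w0 a)%R.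
Proof.
move=> be bDe bDs eD eDs JT JI fe.
case E: (star_pick J) => [i0|]; last first.
  case/eqP: JT; apply/eqP; rewrite -subTset; apply/subsetP => i _.
  move: E; rewrite /star_pick; case: pickP => // h _.
  have := h (star i); rewrite mem_imset; last exact: can_inj (starK cox).
  by move=> /negbFE.
have n0 := vsignK; have dI := dmin_long JI.
have wS I' : I \subset I' -> w0^-1 * dmin J I w0 \in W_ I'.
  by move=> II'; apply: (subsetP (parabolicS _ II')).
have rk I' : #|I :\ i0| < #|I' :\ i0| -> rank2 J I' < rank2 J I.
  move=> lt; rewrite /rank2 ltn_add2l E /=.
  by apply: ltn_sub2l => //; apply: leq_trans lt (max_card _).
have U1 i : i \notin I -> i != i0 -> (i |: I) :\ i0 = i |: (I :\ i0).
  move=> _ ii0; apply/setP => z; rewrite !inE; case: (eqVneq z i) => [->|_] //=.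
  by rewrite ii0.
have c1 i : i \notin I -> i != i0 -> #|I :\ i0| < #|(i |: (I :\ i0)) :\ i0|.
  move=> iI ii0; rewrite -U1 // setDDl setUid U1 // cardsU1 !inE (negbTE iI) andbF.
  by rewrite add1n.
have sJ I' j : I \subset I' -> j \in J -> sig e (J :\ j) I' w0 = vzero.
  move=> II' jJ; have JI' : star @: (J :\ j) \subset I'.
    by apply: subset_trans II'; apply: starS JI; apply: subsetDl.
  rewrite sig_long ?mulVg ?group1 //; case E': (star_pick _) => [i|] //; case: ifP => // _.
  suff -> : e (J :\ j) (I' :\ i) w0 = vzero by rewrite (bi_rho0 bi) vsign0.
  case: fe => _; apply; first exact: star_subD1.
  by rewrite /rank2 [in X in _ < X](cardsD1 j J) jJ; nia.
rewrite (sig_long De JI) ?mulVg ?group1 // E (bi_rho1 bi).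
case: ifP => iI.
  have -> : Dse J I w0 = vzero.
    apply: (biequiv_long (bDs J I) (biequiv0 J I)) => a'.
    rewrite (Dspec_long _ (sig_biequiv be) eDs) //; last by move=> j; apply: sJ.
    rewrite big1 // => i; rewrite inE => niI.
    have ii0 : i != i0 by apply: contraNneq niI => ->.
    have JiI : star @: J \subset i |: I by apply: subset_trans JI (subsetUr _ _).
    apply: vsumE; rewrite sig_long ?wS ?subsetUr // E inE iI orbT.
    suff -> : e J ((i |: I) :\ i0) w0 = vzero by rewrite (bi_rho0 bi) vsign0.
    by case: fe => _; apply; rewrite ?star_subD1 // rk // U1 // c1.
  have JI0 := star_subD1 E JI; have sI0 : I :\ i0 \subset I by apply: subsetDl.
  have -> : De J (I :\ i0) w0 = vsign (kap' J (I :\ i0) i0) (e J I w0).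
    apply: (biequiv_long (bDe J (I :\ i0))
      (biequivS (subxx J) sI0 (biequiv_sign _ (be J I)))) => a'.
    rewrite (Dspec_long _ be eD) //; last first.
      move=> j jJ; case: fe => _; apply; first by apply: starS JI0; apply: subsetDl.
      rewrite /rank2 [in X in _ < X](cardsD1 j J) jJ.
      by have := miss_le (star_pick (J :\ j)) (I :\ i0); nia.
    rewrite (bigD1 i0) /=; last by rewrite !inE eqxx.
    rewrite setD1K // big1 ?addr0 // => i /andP[]; rewrite !inE => niI ii0.
    rewrite ii0 /= in niI; apply: vsumE.
    have d'I := dmin_long JI0.
    rewrite (biequiv_rho (be J (i |: I :\ i0))); last first.
      by apply: (subsetP (parabolicS _ _)) d'I; apply: subsetUr.
    suff -> : e J (i |: I :\ i0) w0 = vzero by rewrite (bi_rho0 bi).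
    case: fe => _; apply; first by apply: subset_trans JI0 (subsetUr _ _).
    by rewrite rk // c1.
  by rewrite n0 /vzero add0r.
rewrite /vzero addr0; have -> // : Dse J I w0 = e J I w0.
apply: (biequiv_long (bDs J I) (be J I)) => a'.
rewrite (Dspec_long _ (sig_biequiv be) eDs) //; last by move=> j; apply: sJ.
rewrite (bigD1 i0) /=; last by rewrite !inE iI.
rewrite big1 ?addr0 => [|i /andP[]]; last first.
  rewrite inE => niI ii0; apply: vsumE.
  have JiI : star @: J \subset i |: I by apply: subset_trans JI (subsetUr _ _).
  by rewrite sig_long ?wS ?subsetUr // E !inE eq_sym (negbTE ii0) iI.
have JiI : star @: J \subset i0 |: I by apply: subset_trans JI (subsetUr _ _).
rewrite sig_long ?wS ?subsetUr // E setU11 setU1K ?iI //.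
rewrite -(biequiv_rho (be J I)) //.
exact: (congr1 (fun b => b a') (n0 _ _)).
Qed.

(** The families vanishing on every coset w0 W_I, the critical cell included. They are stable under
    the differential and under [sig], and the flow is nilpotent on them. *)
Definition Klong e := forall J I, star @: J \subset I -> e J I w0 = vzero.

Lemma Klong_D e De : biequivs e -> biequivs De -> Dspec e De -> Klong e -> Klong De.
Proof.
move=> be bDe eD Ke J I JI; apply: (biequiv_long (bDe J I) (biequiv0 J I)) => a.
rewrite (Dspec_long _ be eD) // => [|j jJ]; last first.
  by apply: Ke; apply: starS JI; apply: subsetDl.
apply: big1 => i _; have JiI : star @: J \subset i |: I by apply: subset_trans JI (subsetUr _ _).
apply: vsumE; rewrite (biequiv_rho (be J (i |: I))) ?Ke ?(bi_rho0 bi) //.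
by apply: (subsetP (parabolicS _ _)) (dmin_long JI); apply: subsetUr.
Qed.

Lemma Klong_sig e : Klong e -> Klong (sig e).
Proof.
move=> Ke J I JI; rewrite sig_long ?mulVg ?group1 //.
case E: (star_pick J) => [i|] //; case: ifP => // _.
by rewrite Ke ?(bi_rho0 bi) ?vsign0 // star_subD1.
Qed.

Definition top_supported e := forall J I w, J != setT \/ I != setT -> e J I w = vzero.

Lemma top_D e De : biequivs e -> biequivs De -> Dspec e De -> top_supported e -> Klong De.
Proof.
move=> be bDe eD te J I JI; apply: (biequiv_long (bDe J I) (biequiv0 J I)) => a.
rewrite (Dspec_long _ be eD) // => [|j jJ]; last first.
  by apply: te; left; apply/eqP => /setP/(_ j); rewrite !inE eqxx.
apply: big1 => i; rewrite inE => iI; apply: vsumE; apply: te; left.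
by apply: contraNneq iI => /(star_T JI) ->.
Qed.

Lemma top_sig e J I w : top_supported e -> sig e J I w = vzero.
Proof.
move=> te; rewrite /sig; case E: (ups_pick _ _) => [j|].
  case: ifP => // _; have [IT|IT] := eqVneq I setT; last by rewrite te ?vsign0 //; right.
  have := ups_pickP E; rewrite IT ups_longest ?inE ?dmin_rmin //.
  exact: (parabolicT cox).
case E': (star_pick J) => [i|] //; case: ifP => // _.
rewrite te ?(bi_rho0 bi) ?vsign0 //; right.
by apply/eqP => /setP/(_ i); rewrite !inE eqxx.
Qed.

Lemma Fil0 e : Fil 0 e.
Proof. by split. Qed.

Lemma Fil_long e J I : Fil ranktop e -> star @: J \subset I -> J != setT -> e J I w0 = vzero.
Proof. by move=> [_ h] JI JT; apply: h => //; apply: rank2_lt. Qed.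

Lemma Fil_max e J I w : biequivs e -> Klong e -> Fil rankmax e -> e J I w = vzero.
Proof.
move=> be Ke [h _]; have [u0|u0] := eqVneq (ups I (dmin J I w)) set0.
  have [JI wI] := ups0_long u0.
  by rewrite (biequiv_rho (be J I) wI) Ke // (bi_rho0 bi).
by apply: (biequiv_dmin0 (be J I)); apply: h; rewrite ?dmin_lmin ?dmin_rmin ?rank1_max.
Qed.

Section Step.
Variables (e De Dse G : fam) (k : nat).
Hypotheses (be : biequivs e) (bDe : biequivs De) (bDs : biequivs Dse).
Hypotheses (eD : Dspec e De) (eDs : Dspec (sig e) Dse).
Hypothesis GE : forall J I w a, G J I w a = (e J I w a - (Dse J I w a + sig De J I w a))%R.
Hypothesis fe : Fil k e.

(** Below [ranktop] all ranks are of the form [rank2] with J different from S, so [morse2] covers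
    them. *)
Lemma Fil_step_low : k < ranktop -> Fil k.+1 G.
Proof.
move=> kt; split=> [J I d _ _ _ lt|J I JI lt].
  by have := leq_trans lt kt; rewrite /rank1 addSn ltnNge leqW ?leq_addr.
apply: funext => a; have [JT|JT] := eqVneq J setT.
  by have := leq_trans lt kt; rewrite JT /rank2 /ranktop cardsT ltnNge leq_addr.
rewrite GE -(morse2 _ be bDe bDs eD eDs) ?subrr //; apply: FilW fe; exact: lt.
Qed.

(** Vanishing on the cosets w0 W_I carries the filtration past the critical cell, where no identity
    like [morse2] holds; [morse1] deals with the remaining cells. *)
Lemma Fil_step_high : Klong G -> Fil k.+1 G.
Proof.
move=> KG; split=> [J I d dJ dI u0 lt|J I JI _]; last exact: KG.
apply: funext => a; rewrite GE -(morse1 _ be eD eDs) ?subrr //.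
by apply: FilW fe; exact: lt.
Qed.
End Step.

End Morse.

Local Open Scope ring_scope.

(** * Reducing a complex by iterating a flow *)

Section ChainReduction.
Variables (A : pzRingType) (T C : complex A).
Variables (iota : forall k, {linear C k -> T k}) (pr : forall k, {linear T k -> C k}).
Variable sigma : forall k l, {linear T k -> T l}.
Variable K : forall k, T k -> Prop.
Variable m : nat.
Local Notation D := (cdiff T).

(* The flow of discrete Morse theory: it increases the filtration for which the
   homotopy [sigma] inverts the differential on the graded pieces. *)
Definition flow_fun k (z : T k) : T k :=
  z - (D (k - 1) k (sigma k (k - 1) z) + sigma (k + 1) k (D k (k + 1) z)).
Fact flow_linear k : linear (@flow_fun k).
Proof.
move=> a x y; rewrite /flow_fun !linearP /= [X in _ - X]addrACA -scalerDr.
by rewrite scalerBr opprD addrACA.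
Qed.
Definition flow_lin k : {linear T k -> T k} :=
  HB.pack (@flow_fun k) (GRing.isLinear.Build A _ _ _ (@flow_fun k) (@flow_linear k)).

Fact flow_diff i j x : flow_lin j (D i j x) = D i j (flow_lin i x).
Proof.
have [->|ji] := eqVneq j (i + 1); last by rewrite !cdiff_shape // linear0.
rewrite /= /flow_fun cdiffK linear0 addr0 linearB linearD /= cdiffK add0r.
(* The two composites pass through the degrees i + 1 - 1 and i. Abstracting the degree in [G] allows
   the equality to be rewritten under dependent types. *)
pose G r := D r (i + 1) (sigma (i + 1) r (D i (i + 1) x)).
by rewrite -[X in _ - X]/(G _) -[X in _ = _ - X]/(G _) addrK.
Qed.
Definition flow : chainMap T T := ChainMap flow_diff.

Lemma flow_homotopic : homotopic (chain_id T) flow.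
Proof. by exists sigma => k z; rewrite /= /flow_fun opprB addrCA subrr addr0. Qed.

Fixpoint flow_iter n : chainMap T T :=
  if n is n'.+1 then chain_comp flow (flow_iter n') else chain_id T.

Lemma flow_iter_homotopic n : homotopic (flow_iter n) (chain_id T).
Proof.
elim: n => [|n IH]; first exact: homotopic_refl.
have h := homotopic_comp (homotopic_sym flow_homotopic) IH.
by apply: homotopic_trans h _; apply: eq_homotopic.
Qed.

Local Notation gm := (flow_iter m).
Hypothesis K_diff : forall k l z, K z -> K (D k l z).
Hypothesis K_iota : forall k l c, K (D k l (iota k c) - iota l (cdiff C k l c)).
Hypothesis K_flow : forall k (z : T k), K z -> gm k z = 0.
Hypothesis K_im : forall k (z : T k), K (gm k z - iota k (pr k (gm k z))).
Hypothesis pr_iota : forall k c, pr k (iota k c) = c.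
Hypothesis pr_flow : forall k c, pr k (gm k (iota k c)) = c.
Hypothesis K_pr : forall k (z : T k), K z -> pr k z = 0.

(** [iota] commutes with the differentials only up to K, and m steps of the flow kill K. *)
Fact red_in_diff i j x : (gm j \o iota j : {linear C j -> T j}) (cdiff C i j x) =
  D i j ((gm i \o iota i : {linear C i -> T i}) x).
Proof.
rewrite /= -cmapE; apply/eqP; rewrite -subr_eq0 -linearB -oppr_eq0 -linearN opprB.
by rewrite K_flow.
Qed.
Definition red_in : chainMap C T := ChainMap red_in_diff.

(** After m steps z agrees with iota (pr z) up to K. As K is a subcomplex killed by [pr], the
    differential may be computed on iota (pr z), again up to K. *)
Fact red_out_diff i j x : (pr j \o gm j : {linear T j -> C j}) (D i j x) =
  cdiff C i j ((pr i \o gm i : {linear T i -> C i}) x).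
Proof.
rewrite /= cmapE -{1}(subrK (iota i (pr i (gm i x))) (gm i x)) linearD linearD.
rewrite K_pr ?add0r; last exact/K_diff/K_im.
set c := pr i _; rewrite -[D i j _](subrK (iota j (cdiff C i j c))) linearD pr_iota.
by rewrite K_pr ?add0r.
Qed.
Definition red_out : chainMap T C := ChainMap red_out_diff.

Lemma red_outK : homotopic (chain_comp red_out red_in) (chain_id C).
Proof.
apply: eq_homotopic => k c /=; set z := gm k (iota k c).
rewrite -(subrK (iota k (pr k z)) z) linearD linearD K_flow; last exact: K_im.
by rewrite linear0 add0r /z !pr_flow.
Qed.

Lemma red_inK : homotopic (chain_comp red_in red_out) (chain_id T).
Proof.
apply: homotopic_trans (homotopic_comp (flow_iter_homotopic m) (flow_iter_homotopic m)).
apply: eq_homotopic => k z /=; apply/eqP; rewrite eq_sym -subr_eq0 -linearB.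
by rewrite K_flow.
Qed.

End ChainReduction.

(** * Coinduction and relative traces *)

Section Coinduction.
Variables (A : pzRingType) (P : A -> Prop).

(* Hom_P(A, M), on which A acts by (a f)(x) = f(x a). *)
Record coind (M : lmodType A) := Coind {
  coind_fun :> A -> M;
  coindD : forall x y, coind_fun (x + y) = coind_fun x + coind_fun y;
  coindP : forall a x, P a -> coind_fun (a * x) = a *: coind_fun x
}.

Section Module.
Variable M : lmodType A.
Implicit Types f g : coind M.

Lemma coind_eq f g : f =1 g -> f = g.
Proof.
case: f g => [f fD fP] [g gD gP] /= /funext fg; subst g.
by congr Coind; apply: Prop_irrelevance.
Qed.

HB.instance Definition _ := gen_eqMixin (coind M).
HB.instance Definition _ := gen_choiceMixin (coind M).

Program Definition coind0 := @Coind M (fun => 0) _ _.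
Next Obligation. by rewrite addr0. Qed.
Next Obligation. by rewrite scaler0. Qed.
Program Definition coind_opp f := @Coind M (fun x => - f x) _ _.
Next Obligation. by rewrite coindD opprD. Qed.
Next Obligation. by rewrite coindP // scalerN. Qed.
Program Definition coind_add f g := @Coind M (fun x => f x + g x) _ _.
Next Obligation. by rewrite !coindD addrACA. Qed.
Next Obligation. by rewrite !coindP // scalerDr. Qed.
Program Definition coind_scale a f := @Coind M (fun x => f (x * a)) _ _.
Next Obligation. by rewrite mulrDl coindD. Qed.
Next Obligation. by rewrite -mulrA coindP. Qed.

Fact coind_addA : associative coind_add.
Proof. by move=> f g k; apply: coind_eq => x /=; rewrite addrA. Qed.
Fact coind_addC : commutative coind_add.
Proof. by move=> f g; apply: coind_eq => x /=; rewrite addrC. Qed.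
Fact coind_add0 : left_id coind0 coind_add.
Proof. by move=> f; apply: coind_eq => x /=; rewrite add0r. Qed.
Fact coind_addN : left_inverse coind0 coind_opp coind_add.
Proof. by move=> f; apply: coind_eq => x /=; rewrite addNr. Qed.
HB.instance Definition _ :=
  GRing.isZmodule.Build (coind M) coind_addA coind_addC coind_add0 coind_addN.

Fact coind_scaleA a b f : coind_scale a (coind_scale b f) = coind_scale (a * b) f.
Proof. by apply: coind_eq => x /=; rewrite mulrA. Qed.
Fact coind_scale1 f : coind_scale 1 f = f.
Proof. by apply: coind_eq => x /=; rewrite mulr1. Qed.
Fact coind_scaleDr : right_distributive coind_scale +%R.
Proof. by move=> a f g; apply: coind_eq. Qed.
Fact coind_scaleDl f : {morph coind_scale^~ f : a b / a + b}.
Proof. by move=> a b; apply: coind_eq => x /=; rewrite mulrDr coindD. Qed.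
HB.instance Definition _ := GRing.Zmodule_isLmodule.Build A (coind M)
  coind_scaleA coind_scale1 coind_scaleDr coind_scaleDl.

Lemma coindDE f g x : (f + g) x = f x + g x. Proof. by []. Qed.
Lemma coindZE a f x : (a *: f) x = f (x * a). Proof. by []. Qed.
Lemma coind_x0 f : f 0 = 0.
Proof. by apply: (addrI (f 0)); rewrite -coindD !addr0. Qed.
Lemma coind_xN f x : f (- x) = - f x.
Proof. by apply: (addrI (f x)); rewrite -coindD !subrr coind_x0. Qed.
Lemma coind_xsum f (I : Type) (r : seq I) (Q : pred I) (F : I -> A) :
  f (\sum_(i <- r | Q i) F i) = \sum_(i <- r | Q i) f (F i).
Proof. by apply: (big_morph f); [exact: coindD|exact: coind_x0]. Qed.
Lemma coind_sumE (I : Type) (r : seq I) (Q : pred I) (F : I -> coind M) x :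
  (\sum_(i <- r | Q i) F i) x = \sum_(i <- r | Q i) F i x.
Proof. by apply: (big_morph (fun f : coind M => f x)). Qed.
End Module.

Section Map.
Variables (M N : lmodType A) (g : {linear M -> N}).
Program Definition coind_map_fun (f : coind M) := @Coind N (fun x => g (f x)) _ _.
Next Obligation. by rewrite coindD linearD. Qed.
Next Obligation. by rewrite coindP // linearZ. Qed.
Fact coind_map_linear : linear coind_map_fun.
Proof. by move=> a f k; apply: coind_eq => x; rewrite /= linearD. Qed.
Definition coind_map : {linear coind M -> coind N} :=
  HB.pack coind_map_fun (GRing.isLinear.Build A _ _ _ coind_map_fun coind_map_linear).
Lemma coind_mapE f x : coind_map f x = g (f x). Proof. by []. Qed.
End Map.
End Coinduction.

(** * Hecke algebras as Frobenius extensions of their parabolic subalgebras *)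

Section HeckeAlgebra.
Variables (gT : finGroupType) (S : finType) (s : S -> gT).
Hypothesis cox : coxeter_system s.
Variables (R : comPzRingType) (q : S -> R).
Hypothesis q_inv : forall i : S, exists r : R, q i * r = 1.
Hypothesis q_conj : forall (i j : S) (w : gT), s j = (s i ^ w)%g -> q i = q j.
Variables (H : pzRingType) (eta : {rmorphism R -> H}) (h : gT -> H).
Hypothesis hecke : hecke_algebra s q eta h.
Local Notation l := (len s).
Local Notation ldesc := (ldesc cox).
Local Notation rdesc := (rdesc cox).
Local Notation lmin := (lmin cox).
Local Notation rmin := (rmin cox).
Local Notation W_ := (parabolic s).
Local Notation w0 := (longest s).
Local Notation star := (star cox).
Local Notation sub := (hecke_sub s eta h).
Implicit Types (w u v d : gT) (i j : S) (I J K : {set S}) (r : R) (x y z : H).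

Definition coef x : {ffun gT -> R} := sval (cid (hecke_basis hecke x)).

Lemma coefE x : x = \sum_w eta (coef x w) * h w.
Proof. exact: (svalP (cid (hecke_basis hecke x))).1. Qed.

Lemma coef_uniq x (c : gT -> R) : x = \sum_w eta (c w) * h w -> coef x =1 c.
Proof.
move=> xc w; have <- : [ffun w => c w] = coef x; last by rewrite ffunE.
have [_ h1] := svalP (cid (hecke_basis hecke x)); apply/esym/h1.
by rewrite {1}xc; apply: eq_bigr => v _; rewrite ffunE.
Qed.

Lemma coefD x y w : coef (x + y) w = coef x w + coef y w.
Proof.
apply: (coef_uniq (c := fun w => coef x w + coef y w)).
rewrite {1}(coefE x) {1}(coefE y) -big_split; apply: eq_bigr => v _.
by rewrite rmorphD mulrDl.
Qed.

Lemma coefZ r x w : coef (eta r * x) w = r * coef x w.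
Proof.
apply: (coef_uniq (c := fun w => r * coef x w)).
rewrite {1}(coefE x) mulr_sumr; apply: eq_bigr => v _.
by rewrite rmorphM mulrA.
Qed.

Lemma coef_h v w : coef (h v) w = (w == v)%:R.
Proof.
apply: (coef_uniq (c := fun w => (w == v)%:R)).
rewrite (bigD1 v) //= eqxx rmorph1 mul1r big1 ?addr0 // => u /negbTE ->.
by rewrite rmorph0 mul0r.
Qed.

Section Extension.
Variable M : lmodType H.

Definition ext (f : gT -> M) x : M := \sum_w eta (coef x w) *: f w.

Lemma extD f x y : ext f (x + y) = ext f x + ext f y.
Proof.
by rewrite /ext -big_split; apply: eq_bigr => w _; rewrite coefD rmorphD scalerDl.
Qed.

Lemma extZ f r x : ext f (eta r * x) = eta r *: ext f x.
Proof.
rewrite /ext scaler_sumr; apply: eq_bigr => w _.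
by rewrite coefZ rmorphM scalerA.
Qed.

Lemma ext_h f w : ext f (h w) = f w.
Proof.
rewrite /ext (bigD1 w) //= big1 => [|v /negbTE vw]; rewrite coef_h.
  by rewrite eqxx rmorph1 scale1r addr0.
by rewrite vw rmorph0 scale0r.
Qed.

Definition rlinear (f : H -> M) :=
  (forall x y, f (x + y) = f x + f y) /\ (forall r x, f (eta r * x) = eta r *: f x).

Lemma rlinear_eq f g : rlinear f -> rlinear g -> (forall w, f (h w) = g (h w)) -> f =1 g.
Proof.
move=> [fD fZ] [gD gZ] fg x; rewrite (coefE x).
have add0 (k : H -> M) : (forall x y, k (x + y) = k x + k y) -> k 0 = 0.
  by move=> kD; apply: (addrI (k 0)); rewrite -kD !addr0.
rewrite (big_morph f fD (add0 _ fD)) (big_morph g gD (add0 _ gD)).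
by apply: eq_bigr => w _; rewrite fZ gZ fg.
Qed.

Lemma rlinear_ext f : rlinear (ext f).
Proof. by split; [exact: extD|exact: extZ]. Qed.

Lemma rlinear_mul (f : H -> M) y : rlinear f -> rlinear (fun x => f (x * y)).
Proof. by case=> fD fZ; split=> [x z|r x]; rewrite ?mulrDl ?fD // -mulrA fZ. Qed.

Lemma rlinear_mull (f : H -> M) y : rlinear f -> rlinear (fun x => f (y * x)).
Proof.
case=> fD fZ; split=> [x z|r x]; rewrite ?mulrDr ?fD //.
by rewrite mulrA -(hecke_central hecke) -mulrA fZ.
Qed.

Lemma rlinear_scale (f : H -> M) a : rlinear f -> rlinear (fun x => a *: f x).
Proof.
case=> fD fZ; split=> [x z|r x]; rewrite ?fD ?scalerDr // fZ !scalerA.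
by rewrite (hecke_central hecke).
Qed.

Lemma rlinear_sum (T : Type) (p : seq T) (Q : pred T) (f : T -> H -> M) :
  (forall t, rlinear (f t)) -> rlinear (fun x => \sum_(t <- p | Q t) f t x).
Proof.
move=> fl; split=> [x z|r x].
  by rewrite -big_split; apply: eq_bigr => t _; case: (fl t) => ->.
by rewrite scaler_sumr; apply: eq_bigr => t _; case: (fl t) => _ ->.
Qed.
End Extension.

Lemma eta_mulCA r x y : x * (eta r * y) = eta r * (x * y).
Proof. by rewrite mulrA -(hecke_central hecke) mulrA. Qed.

Lemma rlinear_id : rlinear (fun x => x : H^o).
Proof. by split. Qed.

Lemma h_mul w w' : l (w * w')%g = (l w + l w')%N -> h w * h w' = h (w * w')%g.
Proof. exact: (@heckeM _ _ _ _ _ _ _ _ hecke). Qed.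

Lemma h1 : h 1%g = 1.
Proof.
have h1h w : h 1%g * h w = h w by rewrite h_mul ?mul1g // len1.
suff e x : h 1%g * x = x by rewrite -[LHS]mulr1 e.
apply: (rlinear_eq (M := H^o) (f := fun x => h 1%g * x) (g := id)) => //.
  exact: rlinear_mull rlinear_id.
Qed.

Lemma gen_hM_up i w : ~~ ldesc w i -> h (s i) * h w = h (s i * w)%g.
Proof. by move=> ni; rewrite h_mul // len_genM (negbTE ni) len_gen. Qed.

Lemma h_genM_up i w : ~~ rdesc w i -> h w * h (s i) = h (w * s i)%g.
Proof. by move=> ni; rewrite h_mul // len_Mgen (negbTE ni) len_gen // addn1. Qed.

Lemma gen_sqE i : h (s i) * h (s i) = eta (q i - 1) * h (s i) + eta (q i).
Proof. by rewrite -expr2 (hecke_quad hecke). Qed.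

Lemma gen_hM_down i w : ldesc w i ->
  h (s i) * h w = eta (q i - 1) * h w + eta (q i) * h (s i * w)%g.
Proof.
move=> di; have ni : ~~ ldesc (s i * w)%g i by rewrite ldesc_gen negbK.
rewrite -{1 2}(genK cox i w) -(gen_hM_up ni) mulrA gen_sqE mulrDl -mulrA.
by [].
Qed.

Lemma h_genM_down i w : rdesc w i ->
  h w * h (s i) = eta (q i - 1) * h w + eta (q i) * h (w * s i)%g.
Proof.
move=> di; have ni : ~~ rdesc (w * s i)%g i.
  by move: di; rewrite ?(rdescV cox) invMg (gen_inv cox) ldesc_gen negbK.
rewrite -{1 2}(genKr cox i w) -(h_genM_up ni) -[LHS]mulrA gen_sqE mulrDr.
by rewrite mulrA -!(hecke_central hecke) -mulrA.
Qed.

Lemma sub_eta J r : sub J (eta r).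
Proof.
exists (fun w => r * (w == 1%g)%:R).
rewrite (bigD1 1%g) ?group1 //= big1 => [|w /andP[_ /negbTE ->]].
  by rewrite eqxx mulr1 addr0 h1 mulr1.
by rewrite mulr0 rmorph0 mul0r.
Qed.

Lemma sub_h J w : w \in W_ J -> sub J (h w).
Proof.
move=> wJ; exists (fun v => (v == w)%:R).
rewrite (bigD1 w) //= big1 => [|v /andP[_ /negbTE ->]].
  by rewrite eqxx rmorph1 mul1r addr0.
by rewrite rmorph0 mul0r.
Qed.

Lemma sub_gen J j : j \in J -> sub J (h (s j)).
Proof. by move=> jJ; apply/sub_h/gen_parabolic. Qed.

Section SubLinear.
Variables (J : {set S}) (M : lmodType H) (f : H -> M).
Hypotheses (fl : rlinear f) (fj : forall j x, j \in J -> f (h (s j) * x) = h (s j) *: f x).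

Lemma sub_linear a x : sub J a -> f (a * x) = a *: f x.
Proof.
have fw w : w \in W_ J -> f (h w * x) = h w *: f x.
  have [n] := ubnP (l w); elim: n w => // n IH w wn wJ.
  have [->|w1] := eqVneq w 1%g; first by rewrite h1 mul1r scale1r.
  have [j jJ wj] := ldesc_parabolic cox wJ w1.
  have nj : ~~ ldesc (s j * w)%g j by rewrite ldesc_gen negbK.
  have lt : (l (s j * w)%g < l w)%N by rewrite -(ldescE cox).
  rewrite -(genK cox j w) -(gen_hM_up nj) -mulrA fj // IH ?scalerA //.
    exact: leq_trans lt _.
  by rewrite groupM ?gen_parabolic.
case=> c ->; rewrite mulr_suml scaler_suml.
have [fD fZ] := fl; have f0 : f 0 = 0 by apply: (addrI (f 0)); rewrite -fD !addr0.
rewrite (big_morph f fD f0); apply: eq_bigr => w wJ.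
by rewrite -mulrA fZ fw // scalerA.
Qed.
End SubLinear.

Local Notation coind J M := (@coind H (sub J) M).

Lemma coind_rlinear J M (f : coind J M) : rlinear f.
Proof.
by split=> [x y|r x]; rewrite ?coindD // coindP //; apply: sub_eta.
Qed.

Lemma coind_gen J M (f : coind J M) j x : j \in J -> f (h (s j) * x) = h (s j) *: f x.
Proof. by move=> jJ; rewrite coindP //; apply: sub_gen. Qed.

Definition mkcoind J (M : lmodType H) (f : H -> M) (fl : rlinear f)
    (fj : forall j x, j \in J -> f (h (s j) * x) = h (s j) *: f x) : coind J M :=
  Coind fl.1 (fun a x => @sub_linear J M f fl fj a x).

(** At a descent, f w is h (s j) applied to f (s_j w), and the quadratic relation satisfied by h (s
    j) gives linearity there as well. *)
Lemma ext_gen J (M : lmodType H) (f : gT -> M) :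
  (forall j w, j \in J -> (l w < l (s j * w)%g)%N -> f (s j * w)%g = h (s j) *: f w) ->
  forall j x, j \in J -> ext f (h (s j) * x) = h (s j) *: ext f x.
Proof.
move=> fj j x jJ; apply: (rlinear_eq (f := fun x => ext f (h (s j) * x))
  (g := fun x => h (s j) *: ext f x)) => [||w].
- exact/rlinear_mull/rlinear_ext.
- exact/rlinear_scale/rlinear_ext.
have [d|d] := boolP (ldesc w j); last first.
  by rewrite gen_hM_up // !ext_h fj // -(ldescN cox).
rewrite gen_hM_down // extD !extZ !ext_h.
have lt : (l (s j * w)%g < l (s j * (s j * w))%g)%N by rewrite genK // -(ldescE cox).
have e := fj _ _ jJ lt; rewrite genK // in e.
by rewrite [in RHS]e scalerA gen_sqE scalerDl -scalerA -e.
Qed.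

Lemma coind_eq_lmin J M (f g : coind J M) :
  (forall d, lmin J d -> f (h d) = g (h d)) -> f = g.
Proof.
move=> fg; apply: coind_eq; apply: rlinear_eq; try exact: coind_rlinear.
move=> w; have [n] := ubnP (l w); elim: n w => // n IH w wn.
have [|] := boolP (lmin J w); first exact: fg.
case/forall_inPn=> j jJ; rewrite negbK => d.
have nj : ~~ ldesc (s j * w)%g j by rewrite ldesc_gen negbK.
have lt : (l (s j * w)%g < l w)%N by rewrite -(ldescE cox).
rewrite -(genK cox j w) -(gen_hM_up nj) !coind_gen // IH //.
exact: leq_trans lt _.
Qed.

Definition qinv i := sval (cid (q_inv i)).
Lemma qinvP i : q i * qinv i = 1.
Proof. exact: svalP (cid (q_inv i)). Qed.

(* The value 1 is irrelevant: it is taken when t is not a reflection. *)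
Definition refl_inv (t : gT) : R :=
  if [pick i | s i \in (t ^: [set: gT])%g] is Some i then qinv i else 1.

Lemma refl_invJ t w : refl_inv (t ^ w)%g = refl_inv t.
Proof.
rewrite /refl_inv (eq_pick (Q := fun i => s i \in (t ^: [set: gT])%g)) // => i.
by rewrite classGidl ?inE.
Qed.

Lemma refl_inv_gen i : refl_inv (s i) * q i = 1.
Proof.
rewrite /refl_inv; case: pickP => [j /imsetP[w _ e]|/(_ i)]; last by rewrite class_refl.
by rewrite (q_conj e) mulrC qinvP.
Qed.

(* The inverse of the product q_w of the q_s along a reduced word of w; the
   inversions of w give it without the choice of a word. *)
Definition qw_inv w : R := \prod_(t | inversion cox w t) refl_inv t.

Lemma qw_inv1 : qw_inv 1%g = 1.
Proof. by rewrite /qw_inv big_pred0 // => t; rewrite inversion1. Qed.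

(** The inversions of s_i w are s_i and the conjugates by s_i of those of w; [refl_inv] is constant
    on conjugacy classes. *)
Lemma qw_inv_gen i w : ~~ ldesc w i -> qw_inv (s i * w)%g = refl_inv (s i) * qw_inv w.
Proof.
move=> ni; rewrite /qw_inv (bigD1 (s i)) /=; last first.
  by have := ldesc_gen cox w i; rewrite ?(ldesc_inversion cox) ni.
congr (_ * _); rewrite (reindex_inj (conjg_inj (s i))) /=.
apply: eq_big => [t|t _]; last exact: refl_invJ.
rewrite inversionM inversion_gen -conjgM gen_sq // conjg1.
have -> : (t ^ s i == s i)%g = (t == s i).
  have sii : (s i ^ s i = s i)%g by rewrite conj_gen // gen_sq // mul1g.
  by rewrite -{2}sii (inj_eq (conjg_inj _)).
case: eqP => [->|_]; last by rewrite andbT.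
by rewrite andbF; apply/esym/negbTE.
Qed.

Section Trace.
Variables K J : {set S}.

Section TraceModule.
Variable M : lmodType H.

Definition trace_term (f : H -> M) v x : M :=
  (eta (qw_inv v) * h v) *: f (h v^-1%g * x).
Definition trace_fun (f : H -> M) x : M := \sum_(v in W_ J | rmin K v) trace_term f v x.

Lemma trace_term_rlinear f v : rlinear f -> rlinear (trace_term f v).
Proof. by move=> fl; apply/rlinear_scale/rlinear_mull. Qed.

Lemma trace_rlinear f : rlinear f -> rlinear (trace_fun f).
Proof. by move=> fl; apply: rlinear_sum => v; apply: trace_term_rlinear. Qed.

(** The factor [refl_inv (s j)] gained by [qw_inv (s j * v)] cancels the q j of the quadratic
    relation, so that h (s j) exchanges the cross terms of v and s_j v. *)
Lemma trace_pair (f : coind K M) v j x : ~~ ldesc v j ->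
  trace_term f v (h (s j) * x) + trace_term f (s j * v)%g (h (s j) * x) =
  h (s j) *: (trace_term f v x + trace_term f (s j * v)%g x).
Proof.
move=> nj; have fl := coind_rlinear f; have cen := hecke_central hecke.
have nr : ~~ rdesc v^-1%g j by rewrite ?(rdescV cox) invgK.
rewrite /trace_term (qw_inv_gen nj) -(gen_hM_up nj).
have -> : h (s j * v)^-1%g = h v^-1%g * h (s j) by rewrite invMg (gen_inv cox) h_genM_up.
have -> : h v^-1%g * h (s j) * (h (s j) * x) =
    eta (q j - 1) * (h v^-1%g * h (s j) * x) + eta (q j) * (h v^-1%g * x).
  by rewrite -!mulrA [h (s j) * (_ * _)]mulrA gen_sqE mulrDl mulrDr -mulrA !eta_mulCA.
rewrite coindD !fl.2 scalerDr !scalerA [RHS]scalerDr !scalerA mulrA.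
set fa := f (h v^-1%g * x); set fb := f (_ * _ * _).
set c := eta (qw_inv v); set g := h (s j); set a := h v.
have -> : g * (eta (refl_inv (s j) * qw_inv v) * (g * a)) =
    eta (refl_inv (s j) * qw_inv v * (q j - 1)) * (g * a) + c * a.
  rewrite eta_mulCA [g * (g * a)]mulrA gen_sqE mulrDl mulrDr -mulrA !mulrA -!rmorphM; congr (_ + _).
  by rewrite mulrAC refl_inv_gen mul1r.
have -> : eta (refl_inv (s j) * qw_inv v) * (g * a) * eta (q j) = g * (c * a).
  by rewrite -(hecke_central hecke) mulrA -rmorphM [q j * _]mulrC mulrAC refl_inv_gen mul1r eta_mulCA.
have -> : eta (refl_inv (s j) * qw_inv v) * (g * a) * eta (q j - 1) =
    eta (refl_inv (s j) * qw_inv v * (q j - 1)) * (g * a).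
  by rewrite -(hecke_central hecke) mulrA -rmorphM mulrC.
by rewrite scalerDl addrA [LHS]addrC [_ + (_ *: fb)]addrC.

Qed.

Lemma trace_fix (f : coind K M) v j k x : ~~ ldesc v j -> ~~ rdesc v k -> k \in K ->
  (s j * v = v * s k)%g -> trace_term f v (h (s j) * x) = h (s j) *: trace_term f v x.
Proof.
move=> nj nk kK e; rewrite /trace_term scalerA eta_mulCA gen_hM_up // e -(h_genM_up nk).
rewrite [in RHS]mulrA -[RHS]scalerA -(coind_gen f _ kK) !mulrA; congr (_ *: f (_ * _)).
rewrite h_genM_up ?(rdescV cox) ?invgK // gen_hM_up ?(nk : ~~ ldesc v^-1%g k) //.
by congr h; apply: invg_inj; rewrite !invMg !invgK !(gen_inv cox).
Qed.

(** By [deodhar], left multiplication by s_j permutes the minimal representatives v apart from those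
    with s_j v = v s_k and k in K. The first are grouped by [trace_pair]; for the others h (s j)
    crosses h v and becomes h (s k), for which f is linear. *)
Lemma trace_gen (f : coind K M) j x : j \in J ->
  trace_fun f (h (s j) * x) = h (s j) *: trace_fun f x.
Proof.
move=> jJ; have VJ v : (s j * v \in W_ J)%g = (v \in W_ J).
  by apply: groupMl; rewrite gen_parabolic.
have split (F : gT -> M) : \sum_(v in W_ J | rmin K v) F v =
    \sum_(v | (v \in W_ J) && rmin K v && (~~ ldesc v j && rmin K (s j * v)%g))
      (F v + F (s j * v)%g) +
    \sum_(v | (v \in W_ J) && rmin K v && (~~ ldesc v j && ~~ rmin K (s j * v)%g)) F v.
  rewrite (bigID (fun v => ldesc v j)) /= big_split /= [X in _ = X + _]addrC -addrA.
  congr (_ + _).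
    rewrite (reindex_inj (mulgI (s j))) /=; apply: eq_bigl => v.
    rewrite VJ ldesc_gen; case: (v \in _) => //=; rewrite andbC.
    case nj: (ldesc v j) => /=; first by rewrite !andbF.
    apply/idP/andP => [r|[_ ->]] //; split=> //.
    by have := rmin_ldesc r (j := j); rewrite genK //; apply; rewrite ldesc_gen nj.
  by rewrite (bigID (fun v => rmin K (s j * v)%g)) /=; congr (_ + _); apply: eq_bigl => v;
    rewrite andbA.
rewrite /trace_fun !split scalerDr !scaler_sumr; congr (_ + _).
  by apply: eq_bigr => v /andP[_ /andP[nj _]]; apply: trace_pair.
apply: eq_bigr => v /andP[/andP[vJ vr] /andP[nj nr]].
have [r|[k kK e]] := deodhar j vr; first by rewrite r in nr.
apply: (trace_fix f x nj _ kK e).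
by rewrite rdescN; have /rminP := vr; apply.
Qed.

Definition trace_elt (f : coind K M) : coind J M :=
  mkcoind (trace_rlinear (coind_rlinear f)) (fun j x jJ => trace_gen f x jJ).

Fact trace_linear : linear trace_elt.
Proof.
move=> a f g; apply: coind_eq => x; rewrite /= /trace_fun -big_split; apply: eq_bigr => v _.
by rewrite /trace_term /= mulrA scalerDr.
Qed.

Definition trace : {linear coind K M -> coind J M} :=
  HB.pack trace_elt (GRing.isLinear.Build H _ _ _ trace_elt trace_linear).

Lemma trace_lmin (f : coind K M) d : lmin J d -> trace f (h d) =
  \sum_(v in W_ J | rmin K v) (eta (qw_inv v) * h v) *: f (h (v^-1 * d)%g).
Proof.
move=> dJ; apply: eq_bigr => v /andP[vJ _]; rewrite /trace_term h_mul //.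
by rewrite (len_lminM dJ) ?groupV.
Qed.
End TraceModule.

Lemma trace_natural (M N : lmodType H) (g : {linear M -> N}) (f : coind K M) :
  trace N (coind_map (sub K) g f) = coind_map (sub J) g (trace M f).
Proof.
by apply: coind_eq => x; rewrite /= linear_sum; apply: eq_bigr => v _; rewrite linearZ.
Qed.
End Trace.

(** The anti-automorphism of H sending h_w to h_(w^-1). It yields the right-handed versions of the
    statements about [proj]. *)
Definition flip : H -> H := ext (M := H^o) (fun w => h w^-1%g).

Lemma flip_rlinear : rlinear (M := H^o) flip.
Proof. exact: rlinear_ext. Qed.

Lemma flip_h w : flip (h w) = h w^-1%g.
Proof. exact: (ext_h (M := H^o)). Qed.

Lemma flipK : involutive flip.
Proof.
apply: (rlinear_eq (M := H^o) (f := fun x => flip (flip x)) (g := id)) => [|//|w].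
  by have [fD fZ] := flip_rlinear; split=> [x y|r x]; rewrite ?fD // !fZ.
by rewrite !flip_h invgK.
Qed.

Lemma rlinear_flip_mulr a : rlinear (M := H^o) (fun x => flip x * a).
Proof.
have [fD fZ] := flip_rlinear; split=> [x y|r x]; rewrite ?fD ?mulrDl // fZ.
by rewrite -[LHS]mulrA.
Qed.

Lemma flip_gen i x : flip (h (s i) * x) = flip x * h (s i).
Proof.
have [fD fZ] := flip_rlinear.
apply: (rlinear_eq (M := H^o) (f := fun x => flip (h (s i) * x))
  (g := fun x => flip x * h (s i))) x => [||w].
- exact: rlinear_mull flip_rlinear.
- exact: rlinear_flip_mulr.
have [d|d] := boolP (ldesc w i).
  rewrite gen_hM_down // fD !fZ !flip_h h_genM_down; last by rewrite ?(rdescV cox) invgK.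
  by rewrite invMg (gen_inv cox).
rewrite gen_hM_up // !flip_h h_genM_up; last by rewrite ?(rdescV cox) invgK.
by rewrite invMg (gen_inv cox).
Qed.

Lemma flipM x y : flip (x * y) = flip y * flip x.
Proof.
have fl := flip_rlinear; have [fD fZ] := fl.
apply: (rlinear_eq (M := H^o) (f := fun x => flip (x * y))
  (g := fun x => flip y * flip x)) x => [||w].
- by split=> [x z|r x]; rewrite ?mulrDl ?fD // -mulrA fZ.
- split=> [x z|r x]; first by rewrite fD mulrDr.
  by rewrite fZ; apply: eta_mulCA.
rewrite flip_h; have [n] := ubnP (l w); elim: n w => // n IH w wn.
have [->|w1] := eqVneq w 1%g; first by rewrite invg1 h1 mul1r mulr1.
have [j _ wj] := ldesc_parabolic cox (parabolicT cox w) w1.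
have nj : ~~ ldesc (s j * w)%g j by rewrite ldesc_gen negbK.
have lt : (l (s j * w)%g < l w)%N by rewrite -(ldescE cox).
rewrite -{1}(genK cox j w) -(gen_hM_up nj) -mulrA flip_gen IH; last exact: leq_trans lt _.
by rewrite -mulrA h_genM_up ?(rdescV cox) ?invgK // invMg (gen_inv cox) (genKr cox).
Qed.

(* The Frobenius map of the extension H of H_J; the dual bases are given by the
   [h v], for v right J-minimal, and the [qw_inv v h v^-1]: see [dual_expand]. *)
Definition proj J : H -> H := ext (M := H^o) (fun w => if w \in W_ J then h w else 0).

Lemma proj_rlinear J : rlinear (M := H^o) (proj J).
Proof. exact: rlinear_ext. Qed.

Lemma proj_h J w : proj J (h w) = if w \in W_ J then h w else 0.
Proof. exact: (ext_h (M := H^o)). Qed.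

Lemma proj_sub J x : sub J (proj J x).
Proof.
exists (coef x); rewrite big_mkcond; apply: eq_bigr => w _.
by case: ifP => _; rewrite ?scaler0.
Qed.

Lemma proj_gen J j x : j \in J -> proj J (h (s j) * x) = h (s j) * proj J x.
Proof.
move=> jJ; apply: (ext_gen (M := H^o)) jJ => j' w jJ lt.
rewrite groupMl ?gen_parabolic //; case: ifP => _; last by rewrite scaler0.
by rewrite -gen_hM_up // ldescN.
Qed.

Definition proj_coind J : coind J H^o :=
  @mkcoind J H^o (proj J) (proj_rlinear J) (fun j x jJ => proj_gen x jJ).

Lemma flip_proj J x : flip (proj J x) = proj J (flip x).
Proof.
have [fD fZ] := flip_rlinear; have [pD pZ] := proj_rlinear J.
apply: (rlinear_eq (M := H^o) (f := fun x => flip (proj J x))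
  (g := fun x => proj J (flip x))) x => [||w].
- by split=> [x y|r x]; rewrite ?pD ?fD // pZ fZ.
- by split=> [x y|r x]; rewrite ?fD ?pD // fZ pZ.
rewrite proj_h flip_h proj_h groupV; case: ifP => _; rewrite ?flip_h //.
by apply: (addrI (flip 0)); rewrite -fD !addr0.
Qed.

Lemma projMl J a x : sub J a -> proj J (a * x) = a * proj J x.
Proof. exact: (coindP (proj_coind J)). Qed.

Lemma flip_sub J a : sub J a -> sub J (flip a).
Proof.
move=> aJ; have e : proj J a = a.
  have [pD pZ] := proj_rlinear J; have p0 : proj J 0 = 0.
    by apply: (addrI (proj J 0)); rewrite -pD !addr0.
  case: aJ => c ->; rewrite (big_morph _ pD p0); apply: eq_bigr => w wJ.
  by rewrite pZ proj_h wJ.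
by rewrite -e flip_proj; apply: proj_sub.
Qed.

Lemma projMr J a x : sub J a -> proj J (x * a) = proj J x * a.
Proof.
move=> aJ; apply: (can_inj flipK); rewrite flipM !flip_proj flipM projMl //.
exact: flip_sub.
Qed.

(** It suffices to compare at left J-minimal d. For d = 1 only v = 1 contributes, a right K-minimal
    element of W_K being trivial. For other d, having v^-1 d in W_K would put d in W_J. *)
Lemma trace_proj K J : K \subset J -> trace K J H^o (proj_coind K) = proj_coind J.
Proof.
move=> KJ; apply: coind_eq_lmin => d dJ; rewrite trace_lmin //= proj_h.
have [e|d1] := eqVneq d 1%g.
  rewrite e group1 (bigD1 1%g) /=; last by rewrite group1 ?(rminV cox) invg1 lmin1.
  rewrite qw_inv1 rmorph1 invg1 !mulg1 proj_h group1 h1 mul1r scale1r big1 ?addr0 //.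
  move=> v /andP[/andP[vJ vr] v1]; rewrite mulg1 proj_h; case: ifP => [vK|]; last by rewrite scaler0.
  by rewrite -invg_eq1 (lmin_parabolic vr vK) eqxx in v1.
rewrite [RHS]ifF; last by apply: contraNF d1 => /(lmin_parabolic dJ) ->.
apply: big1 => v /andP[vJ _]; rewrite proj_h ifF ?scaler0 //.
apply: contraNF d1 => /(subsetP (parabolicS s KJ)); rewrite groupMl ?groupV //.
by move=> /(lmin_parabolic dJ) ->.
Qed.

Lemma proj_trace K J x : K \subset J ->
  proj J x = \sum_(v in W_ J | rmin K v) eta (qw_inv v) * h v * proj K (h v^-1%g * x).
Proof. by move=> KJ; rewrite -[LHS](congr1 (fun f : coind J H^o => f x) (trace_proj KJ)). Qed.

Lemma projT x : proj setT x = x.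
Proof.
apply: (rlinear_eq (M := H^o) (f := proj setT) (g := id)) => // [|w].
  exact: proj_rlinear.
by rewrite proj_h (parabolicT cox).
Qed.

(** This is [proj_trace] from J to S, where the projection is the identity. *)
Lemma dual_expand J x :
  x = \sum_(v | rmin J v) eta (qw_inv v) * h v * proj J (h v^-1%g * x).
Proof.
rewrite -{1}(projT x) (proj_trace x (subsetT J)); apply: eq_bigl => v.
by rewrite (parabolicT cox).
Qed.

Lemma dual_expand_r J x :
  x = \sum_(v | rmin J v) eta (qw_inv v) * proj J (x * h v) * h v^-1%g.
Proof.
have [fD fZ] := flip_rlinear; apply: (can_inj flipK); rewrite {1}(dual_expand J (flip x)).
have f0 : flip 0 = 0 by apply: (addrI (flip 0)); rewrite -fD !addr0.
rewrite (big_morph _ fD f0); apply: eq_bigr => v _.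
rewrite -!mulrA fZ flipM flip_proj flipM !flip_h invgK.
by [].
Qed.

Lemma h_unit w : exists x, x * h w = 1 /\ h w * x = 1.
Proof.
have gen i : exists x, x * h (s i) = 1 /\ h (s i) * x = 1.
  (* The quadratic relation reads h_s (h_s - (q_s - 1)) = q_s. *)
  exists (eta (qinv i) * (h (s i) - eta (q i - 1))).
  have e : (h (s i) - eta (q i - 1)) * h (s i) = eta (q i).
    by rewrite mulrBl gen_sqE addrAC subrr add0r.
  rewrite -mulrA e eta_mulCA mulrBr -(hecke_central hecke (q i - 1)) gen_sqE addrAC subrr add0r.
  by rewrite -rmorphM mulrC qinvP rmorph1.
have [n] := ubnP (l w); elim: n w => // n IH w wn.
have [->|w1] := eqVneq w 1%g; first by exists 1; rewrite h1 mulr1.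
have [j _ wj] := ldesc_parabolic cox (parabolicT cox w) w1.
have nj : ~~ ldesc (s j * w)%g j by rewrite ldesc_gen negbK.
have lt : (l (s j * w)%g < l w)%N by rewrite -(ldescE cox).
have [|x [x1 x2]] := IH (s j * w)%g; first exact: leq_trans lt _.
have [y [y1 y2]] := gen j; exists (x * y).
rewrite -(genK cox j w) -(gen_hM_up nj); split.
  by rewrite -mulrA (mulrA y) y1 mul1r.
by rewrite -mulrA (mulrA _ x) x2 mul1r.
Qed.

Definition longest_inv : H := sval (cid (h_unit w0)).
Lemma longest_invK : longest_inv * h w0 = 1.
Proof. exact: (svalP (cid (h_unit w0))).1. Qed.
Lemma longest_invV : h w0 * longest_inv = 1.
Proof. exact: (svalP (cid (h_unit w0))).2. Qed.

Lemma longest_inv_gen j : longest_inv * h (s j) = h (s (star j)) * longest_inv.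
Proof.
suff e : h (s j) * h w0 = h w0 * h (s (star j)).
  by rewrite -[LHS]mulr1 -longest_invV !mulrA -(mulrA longest_inv) e !mulrA longest_invK mul1r.
have d := longest_ldesc cox j; set x := (s j * w0)%g.
have nj : ~~ ldesc x j by rewrite ldesc_gen d.
have xE : x = (w0 * s (star j))%g by rewrite /x gen_longest.
have e1 : h w0 = h (s j) * h x by rewrite gen_hM_up // genK.
have e2 : h w0 = h x * h (s (star j)).
  by rewrite h_genM_up xE ?(genKr cox) // rdescN (genKr cox) -xE -(ldescE cox).
by rewrite {1}e2 mulrA -e1.
Qed.

End HeckeAlgebra.

Lemma coind_sign (A : pzRingType) (P : A -> Prop) (M : lmodType A) n (f : coind P M) x :
  ((-1) ^+ n *: f) x = (-1) ^+ n *: f x.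
Proof.
rewrite coindZE -signr_odd; case: (odd n); rewrite ?expr0 ?mulr1 ?scale1r //.
by rewrite expr1 mulrN1 coind_xN scaleN1r.
Qed.

(** * Complexes of coinduction functors *)

Section CoindMap.
Variables (A : pzRingType) (P : A -> Prop) (M N : lmodType A) (g : {linear M -> N}).
Lemma coind_mapD f k : coind_map P g (f + k) = coind_map P g f + coind_map P g k.
Proof. exact: linearD. Qed.
Lemma coind_mapZ a f : coind_map P g (a *: f) = a *: coind_map P g f.
Proof. exact: linearZ. Qed.
End CoindMap.

Section CoindComplex.
Variables (A : pzRingType) (T : finType) (P : T -> A -> Prop).

Local Notation family M := (forall t : T, coind (P t) M).

(* A finite complex of functors M |-> Hom_(P t)(A, M), the one of index t being
   in degree [cc_deg t]. *)
Record coindComplex := CoindComplex {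
  cc_deg : T -> int;
  cc_diff : forall M : lmodType A, family M -> family M;
  cc_linear : forall (M : lmodType A) a (z w : family M) t,
    cc_diff (fun t => a *: z t + w t) t = a *: cc_diff z t + cc_diff w t;
  cc_natural : forall (M N : lmodType A) (g : {linear M -> N}) (z : family M) t,
    cc_diff (fun t => coind_map (P t) g (z t)) t = coind_map (P t) g (cc_diff z t);
  cc_shape : forall (M : lmodType A) (z : family M) t,
    (forall u, cc_deg u + 1 = cc_deg t -> z u = 0) -> cc_diff z t = 0;
  cc_diffK : forall (M : lmodType A) (z : family M) t, cc_diff (cc_diff z) t = 0
}.

Variable F : coindComplex.
Local Notation deg := (cc_deg F).
Local Notation theta := (cc_diff F).
Local Notation sg t := ((-1) ^+ `|deg t|%N).

Lemma cc_ext (M : lmodType A) (z w : family M) t : (forall u, z u = w u) ->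
  theta z t = theta w t.
Proof.
by move=> zw; rewrite (_ : z = w) //; apply: functional_extensionality_dep.
Qed.

Lemma cc_D (M : lmodType A) (z w : family M) t :
  theta (fun t => z t + w t) t = theta z t + theta w t.
Proof.
rewrite -[theta z t]scale1r -cc_linear; apply: cc_ext => u.
by rewrite scale1r.
Qed.

Lemma cc_0 (M : lmodType A) t : theta (fun t => 0 : coind (P t) M) t = 0.
Proof. exact: cc_shape. Qed.

Lemma cc_Z (M : lmodType A) a (z : family M) t :
  theta (fun t => a *: z t) t = a *: theta z t.
Proof.
rewrite -[RHS]addr0 -(cc_0 M t) -cc_linear; apply: cc_ext => u.
by rewrite addr0.
Qed.

Lemma sign_succ (i : int) : (-1) ^+ `|(i + 1)%R|%N = - (-1) ^+ `|i|%N :> A.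
Proof. by rewrite -[in RHS](addrK 1 i) sign_pred opprK. Qed.

(** Only components of degree one less reach t, and their sign is opposite to that of t. This is the
    anticommutation that makes the total differential square to zero. *)
Lemma cc_sign (M : lmodType A) (z : family M) t :
  theta (fun u => sg u *: z u) t = - (sg t *: theta z t).
Proof.
apply/eqP; rewrite -addr_eq0 -cc_Z -cc_D; apply/eqP/cc_shape => u ut.
by rewrite -ut sign_succ scaleNr addrN.
Qed.

Section TotComplex.
Variable C : complex A.

Definition ctot_obj (k : int) : lmodType A :=
  dsum [pred p : T * int | deg p.1 + p.2 == k] (fun p => coind (P p.1) (C p.2) : lmodType A).

(** The total degree k leaves a single integer for each of the finitely many t. *)
Lemma off_fin k (z : forall p : T * int, coind (P p.1) (C p.2)) :
  (forall p, ~~ (deg p.1 + p.2 == k) -> z p = 0) ->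
  exists r : seq (T * int), forall p, p \notin r -> z p = 0.
Proof.
move=> zk; exists [seq (t, k - deg t) | t <- enum T] => -[t i] ti; apply: zk.
apply: contra ti => /eqP e; apply/mapP; exists t; rewrite ?mem_enum //.
by congr (_, _); move: e => /= <-; rewrite addrC addKr.
Qed.

Definition ctot_diff_fun k l (z : ctot_obj k) (p : T * int) : coind (P p.1) (C p.2) :=
  if l == k + 1 then
    theta (fun t => z (t, p.2) : coind (P t) (C p.2)) p.1
      + sg p.1 *: coind_map (P p.1) (cdiff C (p.2 - 1) p.2) (z (p.1, p.2 - 1))
  else 0.

Fact ctot_diff_off k l (z : ctot_obj k) (p : T * int) :
  ~~ (deg p.1 + p.2 == l) -> ctot_diff_fun l z p = 0.
Proof.
move=> pl; rewrite /ctot_diff_fun; case: eqP => // lk; rewrite lk in pl.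
rewrite cc_shape ?add0r => [|u up].
  rewrite dsum_off ?linear0 ?scaler0 //=; apply: contra pl => /eqP <-.
  by rewrite addrA subrK.
rewrite dsum_off //=; apply: contra pl => /eqP <-.
by rewrite -up addrAC.
Qed.

Fact ctot_diff_fin k l (z : ctot_obj k) :
  exists r : seq (T * int), forall p, p \notin r -> ctot_diff_fun l z p = 0.
Proof. exact: off_fin (@ctot_diff_off k l z). Qed.

Fact ctot_diff_lin k l a (z w : ctot_obj k) p :
  ctot_diff_fun l (a *: z + w) p = a *: ctot_diff_fun l z p + ctot_diff_fun l w p.
Proof.
rewrite /ctot_diff_fun; case: eqP => _; last by rewrite scaler0 addr0.
by rewrite cc_linear dsumD dsumZ linearP !scalerDr sign_scale addrACA.
Qed.

Definition ctot_diff k l : {linear ctot_obj k -> ctot_obj l} :=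
  dsum_lin (@ctot_diff_off k l) (@ctot_diff_fin k l) (@ctot_diff_lin k l).

Lemma ctot_diffE k l z p : ctot_diff k l z p = ctot_diff_fun l z p.
Proof. by []. Qed.

Fact ctot_diff_shape k l z : l != k + 1 -> ctot_diff k l z = 0.
Proof. by move=> lk; apply: dsumP => p; rewrite ctot_diffE /ctot_diff_fun (negbTE lk). Qed.

Fact ctot_diffK k l m z : ctot_diff l m (ctot_diff k l z) = 0.
Proof.
apply: dsumP => p; rewrite ctot_diffE /ctot_diff_fun dsum0E; case: eqP => // _.
have [lk|lk] := eqVneq l (k + 1); last first.
  by rewrite ctot_diff_shape // linear0 scaler0 addr0; apply: cc_0.
have dE q : ctot_diff k l z q = theta (fun t => z (t, q.2) : coind (P t) (C q.2)) q.1
      + sg q.1 *: coind_map (P q.1) (cdiff C (q.2 - 1) q.2) (z (q.1, q.2 - 1)).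
  by rewrite ctot_diffE /ctot_diff_fun lk eqxx.
rewrite (cc_ext (w := fun t => theta (fun t => z (t, p.2) : coind (P t) (C p.2)) t
   + sg t *: coind_map (P t) (cdiff C (p.2 - 1) p.2) (z (t, p.2 - 1)))); last first.
  by move=> u; rewrite dE.
rewrite cc_D cc_diffK add0r cc_sign dE [(_, _).1]/= [(_, _).2]/=.
rewrite coind_mapD coind_mapZ [_ *: (_ + _)]scalerDr.
rewrite (cc_natural F (cdiff C (p.2 - 1) p.2) (fun t => z (t, p.2 - 1))) addrA addNr add0r.
by apply: coind_eq => x; rewrite !coind_sign /= cdiffK !scaler0.
Qed.

Definition ctot : complex A := Complex ctot_diff_shape ctot_diffK.
End TotComplex.

Section TotMap.
Variables (C D : complex A) (f : chainMap C D).

Definition ctot_map_fun k (z : ctot_obj C k) (p : T * int) : coind (P p.1) (D p.2) :=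
  coind_map (P p.1) (f p.2) (z p).
Fact ctot_map_off k z (p : T * int) : ~~ (deg p.1 + p.2 == k) -> @ctot_map_fun k z p = 0.
Proof. by move=> pk; rewrite /ctot_map_fun dsum_off ?linear0. Qed.
Fact ctot_map_fin k z : exists r : seq (T * int), forall p, p \notin r -> @ctot_map_fun k z p = 0.
Proof. exact: off_fin (@ctot_map_off k z). Qed.
Fact ctot_map_lin k a (z w : ctot_obj C k) p :
  ctot_map_fun (a *: z + w) p = a *: ctot_map_fun z p + ctot_map_fun w p.
Proof. by rewrite /ctot_map_fun dsumD dsumZ linearP. Qed.
Definition ctot_map k : {linear ctot_obj C k -> ctot_obj D k} :=
  dsum_lin (@ctot_map_off k) (@ctot_map_fin k) (@ctot_map_lin k).

Fact ctot_map_diff k l (z : ctot_obj C k) :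
  ctot_map l (ctot_diff C k l z) = ctot_diff D k l (ctot_map k z).
Proof.
apply: dsumP => p; rewrite ctot_diffE /ctot_diff_fun.
rewrite [LHS]/(ctot_map_fun _ _) /ctot_map_fun ctot_diffE /ctot_diff_fun.
case: eqP => _; last by rewrite linear0.
rewrite coind_mapD coind_mapZ -(cc_natural F (f p.2)); congr (_ + _ *: _).
by apply: coind_eq => x; rewrite /= cmapE.
Qed.

Definition ctot_chainMap : chainMap (ctot C) (ctot D) :=
  @ChainMap _ (ctot C) (ctot D) ctot_map ctot_map_diff.
End TotMap.

Lemma ctot_chainMap_homotopic (C D : complex A) (f g : chainMap C D) :
  homotopic f g -> homotopic (ctot_chainMap f) (ctot_chainMap g).
Proof.
move=> [h hh].
pose E (k l : int) (z : ctot_obj C k) (p : T * int) : coind (P p.1) (D p.2) :=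
  if l == k - 1 then sg p.1 *: coind_map (P p.1) (h (p.2 + 1) p.2) (z (p.1, p.2 + 1)) else 0.
have Eoff (k l : int) z (p : T * int) : ~~ (deg p.1 + p.2 == l) -> E k l z p = 0.
  move=> pl; rewrite /E; case: eqP => // lk; rewrite lk in pl.
  rewrite dsum_off ?(linear0, scaler0) //=; apply: contra pl => /eqP <-.
  by rewrite addrA addrK.
have Efin (k l : int) z := off_fin (Eoff k l z).
have Elin (k l : int) a z w p : E k l (a *: z + w) p = a *: E k l z p + E k l w p.
  rewrite /E; case: eqP => _; last by rewrite scaler0 addr0.
  by rewrite dsumD dsumZ linearP scalerDr sign_scale.
pose hm (k l : int) := dsum_lin (Eoff k l) (Efin k l) (Elin k l).
exists hm => k z; apply: dsumP => p.
change (ctot_map_fun f z p - ctot_map_fun g z p =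
  ctot_diff_fun k (hm k (k - 1) z) p + E (k + 1) k (ctot_diff C k (k + 1) z) p).
rewrite {1}/ctot_diff_fun subrK eqxx /E addrK eqxx ctot_diffE /ctot_diff_fun eqxx.
have hmE q : hm k (k - 1) z q = sg q.1 *: coind_map (P q.1) (h (q.2 + 1) q.2) (z (q.1, q.2 + 1)).
  by change (hm k (k - 1) z q) with (E k (k - 1) z q); rewrite /E eqxx.
rewrite (cc_ext (w := fun t => sg t *: coind_map (P t) (h (p.2 + 1) p.2) (z (t, p.2 + 1)))); last first.
  by move=> u; rewrite hmE.
rewrite cc_sign (cc_natural F (h (p.2 + 1) p.2) (fun t => z (t, p.2 + 1))) hmE ![(_, _).1]/= ![(_, _).2]/=.
have ss (V : lmodType A) n (v : V) : (-1) ^+ n *: ((-1) ^+ n *: v) = v.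
  by rewrite scalerA -expr2 sqrr_sign scale1r.
rewrite !coind_mapD !coind_mapZ scalerDr !ss addrACA addNr add0r.
apply: coind_eq => x.
pose G r := cdiff D (p.2 - 1) p.2 (h r (p.2 - 1) ((z (p.1, r) : coind _ _) x)).
pose G' r := h (p.2 + 1) p.2 (cdiff C r (p.2 + 1) ((z (p.1, r) : coind _ _) x)).
rewrite -[RHS]/(G (p.2 - 1 + 1) + G' (p.2 + 1 - 1)) addrK addrK /G /G'.
have zp : (z p : coind (P p.1) (C p.2)) = z (p.1, p.2) by case: (p).
rewrite -[LHS]/(f p.2 ((z p : coind _ _) x) - g p.2 ((z p : coind _ _) x)) zp.
exact: hh.
Qed.

Definition ctot_functor : functor (homotopy_category A) (homotopy_category A).
Proof.
exists (ctot : homotopy_category A -> homotopy_category A) ctot_chainMap.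
- exact: ctot_chainMap_homotopic.
- by move=> C; apply: eq_homotopic => k z; apply: dsumP => p; apply: coind_eq.
- by move=> C D E f g; apply: eq_homotopic => k z; apply: dsumP => p; apply: coind_eq.
Defined.

End CoindComplex.

(** * The complexes of traces and of inclusions *)

Section CoindRes.
Variables (A : pzRingType) (P Q : A -> Prop) (PQ : forall a, P a -> Q a) (M : lmodType A).
Definition coind_res_fun (f : coind Q M) : coind P M :=
  Coind (coindD f) (fun a x Pa => coindP f x (PQ Pa)).
Fact coind_res_linear : linear coind_res_fun.
Proof. by move=> a f g; apply: coind_eq. Qed.
Definition coind_res : {linear coind Q M -> coind P M} :=
  HB.pack coind_res_fun (GRing.isLinear.Build A _ _ _ coind_res_fun coind_res_linear).
End CoindRes.

Lemma antisym_sum (d : Order.disp_t) (T : finOrderType d) (V : zmodType)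
    (Q : pred T) (G : T -> T -> V) :
  (forall s t, Q s -> Q t -> (s < t)%O -> G t s = - G s t) ->
  \sum_(s | Q s) \sum_(t | Q t && (t != s)) G s t = 0.
Proof.
move=> anti; pose lt_sum := \sum_(s | Q s) \sum_(t | Q t && (s < t)%O) G s t.
pose gt_sum := \sum_(s | Q s) \sum_(t | Q t && (t < s)%O) G s t.
have -> : \sum_(s | Q s) \sum_(t | Q t && (t != s)) G s t = lt_sum + gt_sum.
  rewrite -big_split; apply: eq_bigr => s _ /=.
  rewrite (bigID (fun t => (s < t)%O)) /=; congr (_ + _); apply: eq_bigl => t.
    by case: ltgtP; rewrite ?andbT ?andbF.
  by case: ltgtP; rewrite ?andbT ?andbF.
suff -> : gt_sum = - lt_sum by rewrite addrN.
rewrite /gt_sum (exchange_big_dep Q) /=; last by move=> s t _ /andP[].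
rewrite -sumrN; apply: eq_bigr => s Qs; rewrite -sumrN.
apply: eq_big => [t|t /and3P[Qt _ st]]; last exact: anti.
by rewrite Qs.
Qed.

Section FG.
Variables (gT : finGroupType) (d : Order.disp_t) (S : finOrderType d) (s : S -> gT).
Hypothesis cox : coxeter_system s.
Variables (R : comPzRingType) (q : S -> R).
Hypothesis q_inv : forall i : S, exists r : R, q i * r = 1.
Hypothesis q_conj : forall (i j : S) (w : gT), s j = (s i ^ w)%g -> q i = q j.
Variables (H : pzRingType) (eta : {rmorphism R -> H}) (h : gT -> H).
Hypothesis hecke : hecke_algebra s q eta h.
Local Notation rmin := (rmin cox).
Local Notation sub := (hecke_sub s eta h).
Local Notation coind J M := (@coind H (sub J) M).
Local Notation trace K J M := (trace cox q_inv q_conj hecke K J M).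
Local Notation proj := (proj hecke).
Local Notation qw_inv := (qw_inv cox q_inv).
Implicit Types (I J K : {set S}).

Section IndElt.
Variables (J : {set S}) (M : lmodType H) (a : H) (m : M).
Fact ind_eltD x y : proj J ((x + y) * a) *: m = proj J (x * a) *: m + proj J (y * a) *: m.
Proof. by rewrite mulrDl (proj_rlinear hecke J).1 scalerDl. Qed.
Fact ind_eltP b x : sub J b -> proj J (b * x * a) *: m = b *: (proj J (x * a) *: m).
Proof. by move=> bJ; rewrite -mulrA (projMl cox) // scalerA. Qed.
Definition ind_elt : coind J M := Coind ind_eltD ind_eltP.
End IndElt.

(** Expanding the argument in the right-handed dual bases shows that the elements [ind_elt] span, so
    identities between traces can be checked on them. *)
Lemma ind_expand J M (f : coind J M) :
  f = \sum_(v | rmin J v) ind_elt J (eta (qw_inv v) * h v) (f (h v^-1%g)).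
Proof.
apply: coind_eq => x; rewrite coind_sumE {1}(dual_expand_r cox q_inv q_conj hecke J x) coind_xsum.
apply: eq_bigr => v _ /=; rewrite (eta_mulCA hecke) (proj_rlinear hecke J).2.
rewrite -mulrA coindP; last exact: (sub_eta hecke).
by rewrite coindP ?scalerA //; apply: proj_sub.
Qed.

(* [ind_elt J a m] corresponds to a (x) m in H (x)_(H_J) M: the trace is the
   canonical map between these tensor products. *)
Lemma trace_ind K J (M : lmodType H) a (m : M) : K \subset J ->
  trace K J M (ind_elt K a m) = ind_elt J a m.
Proof.
move=> KJ; apply: coind_eq => x /=.
rewrite (proj_trace cox q_inv q_conj hecke (x * a) KJ) scaler_suml.
by apply: eq_bigr => v _; rewrite /trace_term /= scalerA mulrA.
Qed.

Lemma trace_trans K J I M (f : coind K M) : K \subset J -> J \subset I ->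
  trace J I M (trace K J M f) = trace K I M f.
Proof.
move=> KJ JI; rewrite (ind_expand f) !linear_sum; apply: eq_bigr => v _.
by rewrite !trace_ind // (subset_trans KJ).
Qed.

Lemma traceZ K J M a (f : coind K M) : trace K J M (a *: f) = a *: trace K J M f.
Proof. exact: linearZ. Qed.

Definition trace_diff (M : lmodType H) (z : forall J, coind J M) J : coind J M :=
  \sum_(j in J) (-1) ^+ nlt (J :\ j) j *: trace (J :\ j) J M (z (J :\ j)).

Lemma setD1C J i j : J :\ i :\ j = J :\ j :\ i.
Proof. by apply/setP => k; rewrite !inE andbCA. Qed.

Program Definition trace_complex : coindComplex sub :=
  {| cc_deg := fun J => #|J|%:Z; cc_diff := trace_diff |}.
Next Obligation.
rewrite /trace_diff scaler_sumr -big_split; apply: eq_bigr => j _.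
by rewrite linearP scalerDr sign_scale.
Qed.
Next Obligation.
rewrite -[RHS]/(coind_map (sub t) g _) /trace_diff [RHS]linear_sum; apply: eq_bigr => j _.
by rewrite trace_natural coind_mapZ.
Qed.
Next Obligation.
apply: big1 => j jJ; rewrite H0 ?linear0 ?scaler0 //.
by rewrite (cardsD1 j t) jJ addnC PoszD.
Qed.
Next Obligation.
rewrite /trace_diff; pose F (L : {set S}) : coind t M := trace L t M (z L).
transitivity (\sum_(j in t) \sum_(i | (i \in t) && (i != j))
  (-1) ^+ (nlt (t :\ j) j + nlt (t :\ j :\ i) i) *: F (t :\ j :\ i)).
  apply: eq_bigr => j jt; rewrite linear_sum scaler_sumr.
  apply: eq_big => [i|i _]; first by rewrite !inE andbC.
  by rewrite traceZ scalerA -exprD trace_trans ?subsetDl.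
apply: antisym_sum => i j it jt ij.
by rewrite nlt_swap // exprS mulN1r scaleNr setD1C.
Qed.

Definition incl_diff (M : lmodType H) (z : forall J, coind J M) I : coind I M :=
  \sum_(i in ~: I) (-1) ^+ nlt I i *:
    coind_res (hecke_subS (subsetUr [set i] I)) M (z (i |: I)).

Lemma incl_diffE (M : lmodType H) (z : forall J, coind J M) I x :
  incl_diff z I x = \sum_(i in ~: I) (-1) ^+ nlt I i *: z (i |: I) x.
Proof. by rewrite coind_sumE; apply: eq_bigr => i _; rewrite coind_sign. Qed.

Program Definition incl_complex : coindComplex sub :=
  {| cc_deg := fun I => - #|I|%:Z; cc_diff := incl_diff |}.
Next Obligation.
rewrite /incl_diff scaler_sumr -big_split; apply: eq_bigr => j _.
by rewrite linearP scalerDr sign_scale.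
Qed.
Next Obligation.
rewrite -[RHS]/(coind_map (sub t) g _) /incl_diff [RHS]linear_sum; apply: eq_bigr => j _.
by rewrite coind_mapZ; congr (_ *: _); apply: coind_eq.
Qed.
Next Obligation.
apply: big1 => j; rewrite inE => jt; rewrite H0 ?linear0 ?scaler0 //.
by rewrite cardsU1 jt PoszD opprD addrAC subrr add0r.
Qed.
Next Obligation.
apply: coind_eq => x; rewrite incl_diffE.
transitivity (\sum_(i in ~: t) \sum_(j | (j \in ~: t) && (j != i))
  (-1) ^+ (nlt t i + nlt (i |: t) j) *: z (j |: (i |: t)) x).
  apply: eq_bigr => i it; rewrite incl_diffE scaler_sumr.
  apply: eq_big => [j|j _]; first by rewrite !inE negb_or andbC.
  by rewrite scalerA -exprD.
apply: antisym_sum => i j; rewrite !inE => it jt ij.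
have ji : j != i by rewrite eq_sym lt_eqF.
have ii : i \in i |: (j |: t) by rewrite setU11.
have jj : j \in i |: (j |: t) by rewrite !inE eqxx orbT.
have jt' : j \notin i |: t by rewrite !inE negb_or ji.
have Ki : (i |: (j |: t)) :\ i = j |: t by rewrite setU1K // !inE negb_or eq_sym ji.
have Kj : (i |: (j |: t)) :\ j = i |: t by rewrite setUCA setU1K.
(* [nlt_swap] compares the two orders of removing elements; for i |: (j |: t) this compares the two
   orders of adding i and j to t. *)
have := nlt_swap ii jj ij; rewrite Ki Kj !setU1K // => e.
by rewrite [in RHS]addnC e exprS mulN1r scaleNr opprK addnC setUCA.
Qed.

End FG.

(** * The isomorphism of X (x) - with the complex of traces *)

Section Frobenius.
Variables (gT : finGroupType) (d : Order.disp_t) (S : finOrderType d) (s : S -> gT).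
Hypothesis cox : coxeter_system s.
Variables (R : comPzRingType) (q : S -> R).
Hypothesis q_inv : forall i : S, exists r : R, q i * r = 1.
Hypothesis q_conj : forall (i j : S) (w : gT), s j = (s i ^ w)%g -> q i = q j.
Variables (H : pzRingType) (eta : {rmorphism R -> H}) (h : gT -> H).
Hypothesis hecke : hecke_algebra s q eta h.
Local Notation l := (len s).
Local Notation rmin := (rmin cox).
Local Notation W_ := (parabolic s).
Local Notation sub := (hecke_sub s eta h).
Local Notation coind J M := (@coind H (sub J) M).
Local Notation trace K J M := (trace cox q_inv q_conj hecke K J M).
Local Notation proj := (proj hecke).
Local Notation qw_inv := (qw_inv cox q_inv).
Local Notation X := (X_complex s eta h).
Local Notation X_ J := (X_obj s eta h J).
Local Notation trc := (trace_complex cox q_inv q_conj hecke).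
Implicit Types (I J K : {set S}).

(** The Frobenius pairing of H with H (x)_(H_J) H: left H_J-linear in w and right H-linear in the
    tensor. It identifies the tensor product with a coinduction. *)
Definition pair_fun J w (x y : H) : H := proj J (w * x) * y.

Lemma pair_bal J w : balanced (M := H^o) (N := H^o) (sub J) (pair_fun J w).
Proof.
have [pD _] := proj_rlinear hecke J.
split=> [x x' y|x y y'|x b y bJ]; rewrite /pair_fun ?mulrDr //.
  by rewrite pD mulrDl.
by rewrite mulrA (projMr cox) // -mulrA.
Qed.

Definition pairing J w (t : X_ J) : H :=
  @tens_lift H H (sub J) H^o H^o H (pair_fun J w) t.

Lemma pairing_pure J w x y : pairing w (pure (sub J) x y : X_ J) = proj J (w * x) * y.
Proof. exact: (tens_lift_pure (pair_bal J w)). Qed.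

Lemma pairingD J w (t u : X_ J) : pairing w (t + u) = pairing w t + pairing w u.
Proof. exact: (tens_liftD (pair_bal J w)). Qed.

Lemma pairing0 J w : pairing w (0 : X_ J) = 0.
Proof. by apply: (addrI (pairing w (0 : X_ J))); rewrite -pairingD !addr0. Qed.

Lemma pairing_sum J w (I : Type) (r : seq I) (Q : pred I) (F : I -> X_ J) :
  pairing w (\sum_(i <- r | Q i) F i) = \sum_(i <- r | Q i) pairing w (F i).
Proof. by apply: (big_morph (@pairing J w)); [exact: pairingD|exact: pairing0]. Qed.

Lemma pairingZ J w a (t : X_ J) : pairing w (a *: t) = pairing (w * a) t.
Proof.
apply: (tens_eq (f := fun t : X_ J => pairing w (a *: t)) (g := @pairing J (w * a))) t.
- by move=> t u; rewrite scalerDr pairingD.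
- by move=> t u; rewrite pairingD.
- by move=> x y; rewrite pureZ !pairing_pure -[a *: x]/(a * x) mulrA.
Qed.

Lemma pairing_sign J w n (t : X_ J) : pairing w ((-1) ^+ n *: t) = (-1) ^+ n * pairing w t.
Proof.
rewrite -signr_odd; case: (odd n); rewrite ?expr0 ?scale1r ?mul1r // expr1 scaleN1r mulN1r.
by apply: (addrI (pairing w t)); rewrite -pairingD !subrr pairing0.
Qed.

Lemma pairing_r J w (t : X_ J) b : pairing w (rscale t b) = pairing w t * b.
Proof.
apply: (tens_eq (f := fun t : X_ J => pairing w (rscale t b))
  (g := fun t : X_ J => pairing w t * b)) t.
- by move=> t u; rewrite rscaleDl pairingD.
- by move=> t u; rewrite pairingD mulrDl.
- by move=> x y; rewrite pure_rscale !pairing_pure -[rscale y b]/(y * b) mulrA.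
Qed.

Lemma pairing_wD J w w' (t : X_ J) : pairing (w + w') t = pairing w t + pairing w' t.
Proof.
apply: (tens_eq (f := @pairing J (w + w')) (g := fun t => pairing w t + pairing w' t)) t.
- by move=> t u; rewrite pairingD.
- by move=> t u; rewrite !pairingD addrACA.
- by move=> x y; rewrite !pairing_pure mulrDl (proj_rlinear hecke J).1 mulrDl.
Qed.

Lemma pairing_wP J a w (t : X_ J) : sub J a -> pairing (a * w) t = a * pairing w t.
Proof.
move=> aJ; apply: (tens_eq (f := @pairing J (a * w)) (g := fun t => a * pairing w t)) t.
- by move=> t u; rewrite pairingD.
- by move=> t u; rewrite pairingD mulrDr.
- by move=> x y; rewrite !pairing_pure -mulrA (projMl cox) // mulrA.
Qed.

(** Here the restriction maps of X become relative traces: [proj_trace] expresses [proj J] through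
    [proj K]. *)
Lemma pairing_res K J (KJ : K \subset J) w (t : X_ K) :
  pairing w (X_res s eta h KJ t) =
  \sum_(v in W_ J | rmin K v) eta (qw_inv v) * h v * pairing (h v^-1%g * w) t.
Proof.
apply: (tens_eq (f := fun t => pairing w (X_res s eta h KJ t)) (g := fun t =>
  \sum_(v in W_ J | rmin K v) eta (qw_inv v) * h v * pairing (h v^-1%g * w) t)) t.
- by move=> t u; rewrite linearD pairingD.
- by move=> t u; rewrite -big_split; apply: eq_bigr => v _; rewrite pairingD mulrDr.
- move=> x y; rewrite /X_res tens_widen_bimod_pure pairing_pure.
  rewrite (proj_trace cox q_inv q_conj hecke _ KJ) mulr_suml; apply: eq_bigr => v _.
  by rewrite pairing_pure !mulrA.
Qed.

Lemma pairing_expand J (t : X_ J) :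
  t = \sum_(v | rmin J v)
    rscale (pure (sub J) (eta (qw_inv v) * h v : H^o) (1 : H^o) : X_ J) (pairing (h v^-1%g) t).
Proof.
apply: (tens_eq (f := id) (g := fun t : X_ J => \sum_(v | rmin J v)
  rscale (pure (sub J) (eta (qw_inv v) * h v : H^o) (1 : H^o) : X_ J) (pairing (h v^-1%g) t))) t.
- by [].
- by move=> t u; rewrite -big_split; apply: eq_bigr => v _; rewrite pairingD rscaleDr.
- move=> x y; rewrite {1}(dual_expand cox q_inv q_conj hecke J x).
  rewrite (big_morph (fun x : H^o => pure (sub J) x y) (id1 := 0) (op1 := +%R)); last first.
  - exact: pure0l.
  - by move=> *; rewrite pureDl.
  apply: eq_bigr => v _; rewrite pure_rscale pairing_pure.
  rewrite -[rscale _ _]/(1 * (proj J (h v^-1%g * x) * y)) mul1r.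
  rewrite -[_ * _ * proj J _]/(rscale (eta (qw_inv v) * h v : H^o) (proj J (h v^-1%g * x))).
  by rewrite pure_bal //; apply: proj_sub.
Qed.

Section Alpha.
Variables (i : int) (J : {set S}) (M : lmodType H).

Section Elt.
Variables (xi : X i) (m : M).
Fact alpha_eltD x y : pairing (x + y) (xi J) *: m = pairing x (xi J) *: m + pairing y (xi J) *: m.
Proof. by rewrite pairing_wD scalerDl. Qed.
Fact alpha_eltP a x : sub J a -> pairing (a * x) (xi J) *: m = a *: (pairing x (xi J) *: m).
Proof. by move=> aJ; rewrite pairing_wP // scalerA. Qed.
Definition alpha_elt : coind J M := Coind alpha_eltD alpha_eltP.
End Elt.

Lemma alpha_bal : balanced (whole H) alpha_elt.
Proof.
split=> [x x' y|x y y'|x b y _]; apply: coind_eq => w /=.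
- by rewrite -scalerDl -pairingD.
- by rewrite scalerDr.
- change (pairing w (rscale (x J : X_ J) b) *: y = pairing w (x J) *: (b *: y)).
  by rewrite pairing_r scalerA.
Qed.

Definition alpha_fun (t : tens (whole H) (X i) M) : coind J M := tens_lift alpha_elt t.

Fact alpha_linear : linear alpha_fun.
Proof.
apply: tens_lift_linear alpha_bal _ => a x y; apply: coind_eq => w /=.
change (pairing w (a *: (x J : X_ J)) *: y = pairing (w * a) (x J) *: y).
by rewrite pairingZ.
Qed.

Definition alpha : {linear tens (whole H) (X i) M -> coind J M} :=
  HB.pack alpha_fun (GRing.isLinear.Build H _ _ _ alpha_fun alpha_linear).

Lemma alpha_pure (xi : X i) m : alpha (pure (whole H) xi m) = alpha_elt xi m.
Proof. exact: (tens_lift_pure alpha_bal). Qed.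
End Alpha.

Section Beta.
Variables (i : int) (J : {set S}).

Definition beta_gen_fun (v : gT) K : X_ K :=
  if (K == J) && (#|K|%:Z == i) then pure (sub K) (eta (qw_inv v) * h v : H^o) (1 : H^o) else 0.
Fact beta_gen_off v K : ~~ (#|K|%:Z == i) -> beta_gen_fun v K = 0.
Proof. by rewrite /beta_gen_fun => /negbTE ->; rewrite andbF. Qed.
Fact beta_gen_fin v : exists r : seq {set S}, forall K, K \notin r -> beta_gen_fun v K = 0.
Proof. by exists (enum {set S}) => K; rewrite mem_enum. Qed.
Definition beta_gen v : X i := DSum (@beta_gen_off v) (beta_gen_fin v).

Variable M : lmodType H.
Definition beta_fun (f : coind J M) : tens (whole H) (X i) M :=
  \sum_(v | rmin J v) pure (whole H) (beta_gen v) (f (h v^-1%g)).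

Lemma betaD f g : beta_fun (f + g) = beta_fun f + beta_fun g.
Proof. by rewrite /beta_fun -big_split; apply: eq_bigr => v _; rewrite pureDr. Qed.
Lemma beta0 : beta_fun 0 = 0.
Proof. by apply: (addrI (beta_fun 0)); rewrite -betaD !addr0. Qed.
End Beta.

(** The content is the vanishing for K different from J. Repeating the left-hand side in the other
    case avoids a transport from K to J; [alpha_betaK] treats that case. *)
Lemma alpha_beta i J K M (f : coind K M) : #|J|%:Z = i ->
  alpha i J M (beta_fun i f) = if K == J then alpha i J M (beta_fun i f) else 0.
Proof.
move=> Ji; case: eqP => // KJ; rewrite linear_sum; apply: big1 => v _.
rewrite alpha_pure; apply: coind_eq => w /=.
by rewrite /beta_gen_fun ifF ?pairing0 ?scale0r //; case: eqP => // /esym.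
Qed.

Lemma alpha_betaK i J M (f : coind J M) : #|J|%:Z = i -> alpha i J M (beta_fun i f) = f.
Proof.
move=> Ji; rewrite linear_sum [RHS](ind_expand cox q_inv q_conj hecke f).
apply: eq_bigr => v _; rewrite alpha_pure; apply: coind_eq => w /=.
by rewrite /beta_gen_fun eqxx Ji eqxx pairing_pure mulr1.
Qed.

Lemma beta_alpha i M (t : tens (whole H) (X i) M) :
  \sum_(J : {set S} | #|J|%:Z == i) beta_fun i (alpha i J M t) = t.
Proof.
apply: (tens_eq (f := fun t => \sum_(J : {set S} | #|J|%:Z == i) beta_fun i (alpha i J M t))
  (g := id)) t => [t u|//|xi m].
  by rewrite -big_split; apply: eq_bigr => J _; rewrite linearD betaD.
have pD (x y : X i) : pure (whole H) (x + y) m = pure (whole H) x m + pure (whole H) y m.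
  exact: pureDl.
have p0 : pure (whole H) (0 : X i) m = 0 by exact: pure0l.
have pureL (r : seq gT) (Q : pred gT) (F : gT -> X i) :
    \sum_(v <- r | Q v) pure (whole H) (F v) m = pure (whole H) (\sum_(v <- r | Q v) F v) m.
  exact/esym/(big_morph _ pD p0).
pose E J : X i := \sum_(v | rmin J v) rscale (beta_gen i J v) (pairing (h v^-1%g) (xi J)).
have -> : \sum_(J : {set S} | #|J|%:Z == i) beta_fun i (alpha i J M (pure (whole H) xi m)) =
    \sum_(J : {set S} | #|J|%:Z == i) pure (whole H) (E J) m.
  apply: eq_bigr => J Ji; rewrite /E -pureL; apply: eq_bigr => v _.
  by rewrite alpha_pure /= -pure_bal.
have -> : \sum_(J : {set S} | #|J|%:Z == i) pure (whole H) (E J) m =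
    pure (whole H) (\sum_(J : {set S} | #|J|%:Z == i) E J) m.
  exact/esym/(big_morph _ pD p0).
congr (pure _ _ _); apply: dsumP => K.
have ev (I : Type) (r : seq I) (Q : pred I) (F : I -> X i) :
    (\sum_(v <- r | Q v) F v) K = \sum_(v <- r | Q v) (F v K : X_ K).
  by apply: (big_morph (fun x : X i => x K : X_ K)).
rewrite ev; have [Ki|nKi] := eqVneq (#|K|%:Z) i; last first.
  rewrite (dsum_off xi) // big1 // => J _; rewrite ev big1 // => v _.
  by rewrite -[LHS]/(rscale (beta_gen_fun i J v K) _) beta_gen_off ?rscale0.
rewrite (bigD1 K) ?Ki //= big1 ?addr0 => [|J /andP[_ JK]]; last first.
  rewrite ev big1 // => v _; rewrite -[LHS]/(rscale (beta_gen_fun i J v K) _).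
  by rewrite /beta_gen_fun eq_sym (negbTE JK) rscale0.
rewrite [RHS](pairing_expand (xi K)) ev; apply: eq_bigr => v _.
by rewrite -[LHS]/(rscale (beta_gen_fun i K v K) _) /beta_gen_fun eqxx Ki eqxx.
Qed.

Lemma alpha_dleft J M (t : tens (whole H) (X (#|J|%:Z - 1)) M) :
  alpha #|J|%:Z J M (tens_map (whole H) (bdiff X (#|J|%:Z - 1) #|J|%:Z) (idfun : {linear M -> M}) t) =
  \sum_(j in J) (-1) ^+ nlt (J :\ j) j *:
    trace (J :\ j) J M (alpha (#|J|%:Z - 1) (J :\ j) M t).
Proof.
apply: (tens_eq (f := fun t => alpha #|J|%:Z J M (tens_map (whole H)
  (bdiff X (#|J|%:Z - 1) #|J|%:Z) (idfun : {linear M -> M}) t))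
  (g := fun t => \sum_(j in J) (-1) ^+ nlt (J :\ j) j *:
    trace (J :\ j) J M (alpha (#|J|%:Z - 1) (J :\ j) M t))) t => [t u|t u|xi m].
- by rewrite !linearD.
- by rewrite -big_split; apply: eq_bigr => j _; rewrite !linearD scalerDr.
rewrite tens_mapE alpha_pure; apply: coind_eq => w; rewrite coind_sumE [LHS]/=.
rewrite /cs_diff_fun subrK eqxx pairing_sum scaler_suml; apply: eq_bigr => j jJ.
rewrite pairing_sign pairing_res coind_sign -scalerA; congr (_ *: _).
rewrite scaler_suml; apply: eq_bigr => v _.
by rewrite /trace_term alpha_pure /= scalerA.
Qed.

Lemma alpha_map i J (M N : lmodType H) (g : {linear M -> N}) (t : tens (whole H) (X i) M) :
  alpha i J N (tens_map (whole H) (bimod_id (X i)) g t) = coind_map (sub J) g (alpha i J M t).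
Proof.
apply: (tens_eq (f := fun t => alpha i J N (tens_map (whole H) (bimod_id (X i)) g t))
  (g := fun t => coind_map (sub J) g (alpha i J M t))) t => [t u|t u|xi m].
- by rewrite !linearD.
- by rewrite !linearD.
by rewrite tens_mapE !alpha_pure; apply: coind_eq => w /=; rewrite linearZ.
Qed.

Section Phi.
Variable C : complex H.

Definition phi_fun k (z : tens_complex X C k) (p : {set S} * int) : coind p.1 (C p.2) :=
  alpha #|p.1|%:Z p.1 (C p.2) (z (#|p.1|%:Z, p.2)).
Fact phi_off k z (p : {set S} * int) : ~~ (cc_deg trc p.1 + p.2 == k) -> @phi_fun k z p = 0.
Proof. by move=> pk; rewrite /phi_fun dsum_off ?linear0. Qed.
Fact phi_lin k a (z w : tens_complex X C k) p :
  phi_fun (a *: z + w) p = a *: phi_fun z p + phi_fun w p.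
Proof. by rewrite /phi_fun dsumD dsumZ linearP. Qed.
Definition phi k : {linear tens_complex X C k -> ctot trc C k} :=
  dsum_lin (@phi_off k) (fun z => off_fin (@phi_off k z)) (@phi_lin k).

Fact phi_diff k l (z : tens_complex X C k) :
  phi l (cdiff (tens_complex X C) k l z) = cdiff (ctot trc C) k l (phi k z).
Proof.
apply: dsumP => p; change (alpha #|p.1|%:Z p.1 (C p.2)
  (tot_diff_fun l z (#|p.1|%:Z, p.2)) = ctot_diff_fun l (phi k z) p).
rewrite /tot_diff_fun /ctot_diff_fun.
case: eqP => _; last by rewrite linear0.
rewrite linearD; congr (_ + _).
  rewrite [LHS]alpha_dleft /cc_diff /= /trace_diff; apply: eq_bigr => j jp; congr (_ *: _).
  rewrite -[RHS]/(trace _ _ _ (alpha _ _ _ _)) -[LHS]/(trace _ _ _ (alpha _ _ _ _)).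
  congr (trace _ _ _ _).
  pose G r := alpha r (p.1 :\ j) (C p.2) (z (r, p.2)).
  rewrite -[LHS]/(G _) -[RHS]/(G _); congr G.
  by rewrite (cardsD1 j p.1) jp addnC PoszD addrK.
rewrite linearZ; congr (_ *: _).
exact: alpha_map.
Qed.

Definition phi_map : chainMap (tens_complex X C) (ctot trc C) :=
  @ChainMap _ (tens_complex X C) (ctot trc C) phi phi_diff.

Definition psi_fun k (f : ctot trc C k) (p : int * int) : tens (whole H) (X p.1) (C p.2) :=
  \sum_(J : {set S} | #|J|%:Z == p.1) beta_fun p.1 (f (J, p.2) : coind J (C p.2)).
Fact psi_off k f (p : int * int) : ~~ (p.1 + p.2 == k) -> @psi_fun k f p = 0.
Proof.
move=> pk; apply: big1 => J /eqP Jp; rewrite dsum_off ?beta0 //=.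
by rewrite Jp.
Qed.
Fact psi_fin k f : exists r : seq (int * int), forall p, p \notin r -> @psi_fun k f p = 0.
Proof.
have [r fr] := dsum_fin f; exists [seq (#|p.1|%:Z, p.2) | p : {set S} * int <- r] => p pr.
apply: big1 => J /eqP Jp; rewrite fr ?beta0 //; apply: contra pr => pr.
by apply/mapP; exists (J, p.2) => //=; rewrite Jp; case: (p).
Qed.
Definition psi k (f : ctot trc C k) : tens_complex X C k := DSum (@psi_off k f) (@psi_fin k f).

Lemma phiK k z : psi (phi k z) = z.
Proof.
apply: dsumP => p; rewrite -[LHS]/(psi_fun (phi k z) p) /psi_fun.
have -> : z p = z (p.1, p.2) :> tens (whole H) (X p.1) (C p.2) by case: (p).
rewrite -[RHS](beta_alpha (z (p.1, p.2))); apply: eq_bigr => J /eqP Jp.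
congr beta_fun; rewrite -[LHS]/(alpha #|J|%:Z J (C p.2) (z (#|J|%:Z, p.2))).
pose G r := alpha r J (C p.2) (z (r, p.2)).
by rewrite -[LHS]/(G _) -[RHS]/(G _) Jp.
Qed.

Lemma psiK k f : phi k (psi f) = f.
Proof.
apply: dsumP => p; rewrite -[LHS]/(phi_fun (psi f) p) /phi_fun.
rewrite -[X in alpha _ _ _ X]/(\sum_(J : {set S} | #|J|%:Z == #|p.1|%:Z)
  beta_fun #|p.1|%:Z (f (J, p.2) : coind J (C p.2))).
rewrite linear_sum (bigD1 p.1) //= big1 ?addr0 => [|J /andP[_ /negbTE Jp]].
  by rewrite [LHS](alpha_betaK (f (p.1, p.2) : coind p.1 (C p.2))) //; case: (p).
by rewrite [LHS](@alpha_beta #|p.1|%:Z p.1 J _ (f (J, p.2) : coind J (C p.2))) // Jp.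
Qed.
End Phi.
End Frobenius.

Section ChainIso.
Variables (A : pzRingType) (C D : complex A) (f : chainMap C D) (g : forall k, D k -> C k).
Hypotheses (fK : forall k, cancel (f k) (@g k)) (gK : forall k, cancel (@g k) (f k)).

Fact chain_inv_linear k : linear (@g k).
Proof. by move=> a x y; rewrite -[RHS]fK linearP !gK. Qed.
Definition chain_inv_lin k : {linear D k -> C k} :=
  HB.pack (@g k) (GRing.isLinear.Build A _ _ _ (@g k) (@chain_inv_linear k)).
Fact chain_invE i j x : chain_inv_lin j (cdiff D i j x) = cdiff C i j (chain_inv_lin i x).
Proof. by rewrite -[RHS]fK /= cmapE gK. Qed.
Definition chain_inv : chainMap D C := ChainMap chain_invE.
End ChainIso.

Section FrobeniusIso.
Variables (gT : finGroupType) (d : Order.disp_t) (S : finOrderType d) (s : S -> gT).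
Hypothesis cox : coxeter_system s.
Variables (R : comPzRingType) (q : S -> R).
Hypothesis q_inv : forall i : S, exists r : R, q i * r = 1.
Hypothesis q_conj : forall (i j : S) (w : gT), s j = (s i ^ w)%g -> q i = q j.
Variables (H : pzRingType) (eta : {rmorphism R -> H}) (h : gT -> H).
Hypothesis hecke : hecke_algebra s q eta h.

Theorem tens_trace_iso : naturally_isomorphic (tens_functor (X_complex s eta h))
  (ctot_functor (trace_complex cox q_inv q_conj hecke)).
Proof.
exists (fun C => phi_map cox q_inv q_conj hecke C).
exists (fun C => chain_inv (f := phi_map cox q_inv q_conj hecke C)
  (@phiK _ _ _ _ cox _ _ q_inv q_conj _ _ _ hecke C)
  (@psiK _ _ _ _ cox _ _ q_inv q_conj _ _ _ hecke C)).
split=> [C D f|C|C]; apply: eq_homotopic => k z.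
- by apply: dsumP => p; apply: alpha_map.
- exact: phiK.
- exact: psiK.
Qed.
End FrobeniusIso.

(** * Composites of two complexes of coinduction functors *)

Section Projection.
Variables (A : pzRingType) (I : choiceType) (P : pred I) (M : I -> lmodType A) (i : I).
Definition dsum_proj_fun (x : dsum P M) : M i := x i.
Fact dsum_proj_linear : linear dsum_proj_fun. Proof. by []. Qed.
Definition dsum_proj : {linear dsum P M -> M i} :=
  HB.pack dsum_proj_fun (GRing.isLinear.Build A _ _ _ dsum_proj_fun dsum_proj_linear).
End Projection.

Section Nested.
Variables (gT : finGroupType) (d : Order.disp_t) (S : finOrderType d) (s : S -> gT).
Hypothesis cox : coxeter_system s.
Variables (R : comPzRingType) (q : S -> R).
Hypothesis q_inv : forall i : S, exists r : R, q i * r = 1.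
Hypothesis q_conj : forall (i j : S) (w : gT), s j = (s i ^ w)%g -> q i = q j.
Variables (H : pzRingType) (eta : {rmorphism R -> H}) (h : gT -> H).
Hypothesis hecke : hecke_algebra s q eta h.
Local Notation l := (len s).
Local Notation rdesc := (rdesc cox).
Local Notation sub := (hecke_sub s eta h).
Local Notation coind J M := (@coind H (sub J) M).
Implicit Types (I J K O N : {set S}) (p r : int).

Section Values.
Variables (F G : coindComplex sub) (C : complex H).
Local Notation FG := (ctot F (ctot G C)).
Local Notation dF := (cc_deg F).
Local Notation dG := (cc_deg G).

(** The middle degree is forced by (N, r), so an element of a composite amounts to functions of two
    arguments, x for the outer coinduction and y for the inner one. Taking y = h w gives functions
    on W. *)
Definition nval k (z : FG k) O N r (x y : H) : C r :=
  (((z (O, dG N + r) : coind O (ctot G C (dG N + r))) x) (N, r) : coind N (C r)) y.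

Lemma nval_off k (z : FG k) O N r x y : dF O + (dG N + r) != k -> nval z O N r x y = 0.
Proof. by move=> ne; rewrite /nval (dsum_off z). Qed.

Lemma nval_eq k (z z' : FG k) :
  (forall O N r x w, nval z O N r x (h w) = nval z' O N r x (h w)) -> z = z'.
Proof.
move=> e; apply: dsumP => -[O p]; apply: coind_eq => x; apply: dsumP => -[N r].
have [<-|ne] := eqVneq (dG N + r) p; last by rewrite !dsum_off.
apply: coind_eq; apply: (rlinear_eq hecke); [exact: (coind_rlinear hecke)..|].
by move=> w; apply: e.
Qed.

Lemma nvalD k (z z' : FG k) O N r x y : nval (z + z') O N r x y = nval z O N r x y + nval z' O N r x y.
Proof. by []. Qed.

Lemma nvalZ k a (z : FG k) O N r x y : nval (a *: z) O N r x y = nval z O N r (x * a) y.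
Proof. by []. Qed.

Lemma nval_rlinear k (z : FG k) O N r y : rlinear eta (fun x => nval z O N r x y).
Proof.
split=> [x x'|a x]; rewrite /nval; first by rewrite coindD.
rewrite coindP; last exact: (sub_eta hecke).
rewrite -[LHS]/((((z (O, dG N + r) : coind O (ctot G C (dG N + r))) x) (N, r) : coind N (C r)) (y * eta a)).
by rewrite -(hecke_central hecke) coindP //; apply: (sub_eta hecke).
Qed.

Lemma nval_in k (z : FG k) O N r x j w : j \in N -> (l w < l (s j * w)%g)%N ->
  nval z O N r x (h (s j * w)%g) = h (s j) *: nval z O N r x (h w).
Proof.
move=> jN lt; rewrite /nval -(gen_hM_up hecke (cox := cox)) ?(ldescN cox) //.
by rewrite coind_gen.
Qed.

Lemma nval_out k (z : FG k) O N r x i w : i \in O -> (l w < l (w * s i)%g)%N ->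
  nval z O N r x (h (w * s i)%g) = nval z O N r (h (s i) * x) (h w).
Proof.
move=> iO lt; rewrite /nval -(h_genM_up hecke (cox := cox)) ?(rdescN cox) //.
by rewrite coind_gen.
Qed.

Section Build.
Variables (k : int) (val : {set S} -> {set S} -> forall r : int, gT -> H -> C r).

(** These are the conditions on values at the basis elements under which [build] assembles them into
    an element; again only ascending steps are required. *)
Record nested_values : Prop := NestedValues {
  nv_rlinear : forall O N r w, rlinear eta (val O N r w);
  nv_in : forall O N r j w x, j \in N -> (l w < l (s j * w)%g)%N ->
    val O N r (s j * w)%g x = h (s j) *: val O N r w x;
  nv_out : forall O N r i w x, i \in O -> (l w < l (w * s i)%g)%N ->
    val O N r (w * s i)%g x = val O N r w (h (s i) * x);
  nv_off : forall O N r w x, dF O + (dG N + r) != k -> val O N r w x = 0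
}.
Hypothesis nv : nested_values.

Let in_gen O N r x j y : j \in N ->
  ext hecke (fun w => val O N r w x) (h (s j) * y) =
  h (s j) *: ext hecke (fun w => val O N r w x) y.
Proof. by apply: ext_gen => // j' w j'N lt; apply: nv_in. Qed.

Definition build_in O N r x : coind N (C r) :=
  mkcoind cox hecke (rlinear_ext hecke (fun w => val O N r w x)) (@in_gen O N r x).

Definition build_mid_fun O p x (nr : {set S} * int) : coind nr.1 (C nr.2) :=
  if dG nr.1 + nr.2 == p then build_in O nr.1 nr.2 x else 0.
Fact build_mid_off O p x (nr : {set S} * int) :
  ~~ (dG nr.1 + nr.2 == p) -> build_mid_fun O p x nr = 0.
Proof. by rewrite /build_mid_fun => /negbTE ->. Qed.
Definition build_mid O p x : ctot G C p := DSum (@build_mid_off O p x) (off_fin (@build_mid_off O p x)).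

Let mid_rlinear O p : rlinear eta (build_mid O p).
Proof.
split=> [x x'|a x]; apply: dsumP => -[N r].
  rewrite [LHS]/(build_mid_fun _ _ _ _) [RHS]/(build_mid_fun _ _ _ _ + build_mid_fun _ _ _ _).
  rewrite /build_mid_fun /=; case: eqP => _; last by apply: coind_eq => y /=; rewrite addr0.
  apply: coind_eq => y; rewrite /= /ext -big_split; apply: eq_bigr => w _.
  by rewrite (nv_rlinear nv O N r w).1 scalerDr.
rewrite [LHS]/(build_mid_fun _ _ _ _) [RHS]/(eta a *: build_mid_fun _ _ _ _).
rewrite /build_mid_fun /=; case: eqP => _; last by apply: coind_eq.
apply: coind_eq => y; rewrite coindZE /= -(hecke_central hecke) extZ /ext scaler_sumr.
apply: eq_bigr => w _; rewrite (nv_rlinear nv O N r w).2 !scalerA.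
by rewrite (hecke_central hecke).
Qed.

Let mid_gen O p i x : i \in O -> build_mid O p (h (s i) * x) = h (s i) *: build_mid O p x.
Proof.
move=> iO; apply: dsumP => -[N r].
rewrite [LHS]/(build_mid_fun _ _ _ _) [RHS]/(h (s i) *: build_mid_fun _ _ _ _).
rewrite /build_mid_fun /=; case: eqP => _; last by apply: coind_eq.
apply: coind_eq; apply: (rlinear_eq hecke (f := build_in O N r (h (s i) * x))
  (g := fun y => build_in O N r x (y * h (s i)))) => [||w].
- exact: rlinear_ext.
- exact/rlinear_mul/rlinear_ext.
have vD := (nv_rlinear nv O N r w).1; have vZ := (nv_rlinear nv O N r w).2.
rewrite /= ext_h; have [di|di] := boolP (rdesc w i); last first.
  by rewrite (h_genM_up hecke di) ext_h (nv_out nv) // -(rdescN cox).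
have lt : (l (w * s i)%g < l (w * s i * s i)%g)%N by rewrite (genKr cox) -(rdescE cox).
rewrite (h_genM_down hecke di) extD !extZ !ext_h.
have := nv_out nv (O := O) N r (h (s i) * x) iO lt.
have := nv_out nv (O := O) N r x iO lt; rewrite (genKr cox) => -> ->.
have [wD wZ] := nv_rlinear nv O N r (w * s i)%g.
by rewrite mulrA (gen_sqE hecke) mulrDl wD -mulrA !wZ.
Qed.

Definition build_out_fun (op : {set S} * int) : coind op.1 (ctot G C op.2) :=
  if dF op.1 + op.2 == k then mkcoind cox hecke (@mid_rlinear op.1 op.2) (@mid_gen op.1 op.2) else 0.
Fact build_out_off (op : {set S} * int) : ~~ (dF op.1 + op.2 == k) -> build_out_fun op = 0.
Proof. by rewrite /build_out_fun => /negbTE ->. Qed.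
Definition build : FG k := DSum build_out_off (off_fin build_out_off).

Lemma nval_build O N r x w : nval build O N r x (h w) = val O N r w x.
Proof.
rewrite /nval -[build _]/(build_out_fun _) /build_out_fun /=; case: eqP => [_|/eqP ne].
  by rewrite -[_ (N, r)]/(build_mid_fun _ _ _ _) /build_mid_fun eqxx /= ext_h.
by rewrite (nv_off nv).
Qed.
End Build.
End Values.

Definition ctot_proj (G : coindComplex sub) (C : complex H) p N r :
    {linear ctot G C p -> coind N (C r)} :=
  dsum_proj [pred nr : {set S} * int | cc_deg G nr.1 + nr.2 == p]
    (fun nr : {set S} * int => coind nr.1 (C nr.2) : lmodType H) (N, r).

(** Naturality of the outer differential lets it commute with the projection to the component (N,
    r); the three parts of the differential then separate. *)
Lemma nval_diff (F G : coindComplex sub) (C : complex H) k n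
    (z : ctot F (ctot G C) k) O N r x y : n = k + 1 ->
  nval (cdiff (ctot F (ctot G C)) k n z) O N r x y =
  (cc_diff F (fun O' => coind_map (sub O')
    (ctot_proj G C (cc_deg G N + r) N r) (z (O', cc_deg G N + r))) O x : coind N (C r)) y +
  (-1) ^+ `|cc_deg F O|%N *:
    (cc_diff G (fun N' =>
       ((z (O, (cc_deg G N + r - 1)%R) : coind O (ctot G C _)) x) (N', r) : coind N' (C r)) N y +
     (-1) ^+ `|cc_deg G N|%N *: cdiff C (r - 1) r
       ((((z (O, (cc_deg G N + r - 1)%R) : coind O (ctot G C _)) x) (N, r - 1)
          : coind N (C (r - 1))) y)).
Proof.
move=> nk; rewrite /nval.
rewrite -[cdiff (ctot F _) k n z (O, _)]/(ctot_diff_fun n z (O, cc_deg G N + r)).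
rewrite /ctot_diff_fun nk eqxx; set p := cc_deg G N + r.
rewrite (cc_natural F (ctot_proj G C p N r) (fun O' => z (O', p) : coind O' (ctot G C p)) O).
transitivity ((((cc_diff F (fun O' => z (O', p) : coind O' (ctot G C p)) O : coind O (ctot G C p)) x) (N, r)
    : coind N (C r)) y + ((((-1) ^+ `|cc_deg F O|%N *: coind_map (sub O)
     (cdiff (ctot G C) (p - 1) p) (z (O, p - 1)) : coind O (ctot G C p)) x) (N, r)
    : coind N (C r)) y); first by [].
congr (_ + _); rewrite coind_sign dsumZ coind_sign coind_mapE; congr (_ *: _).
rewrite -[cdiff (ctot G C) _ _ _ (N, r)]/(ctot_diff_fun _ _ (N, r)).
rewrite /ctot_diff_fun subrK eqxx coindDE; congr (_ + _).
by rewrite -[RHS]/((-1) ^+ `|cc_deg G N|%N *: (coind_map (sub N) (cdiff C (r - 1) r)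
  ((z (O, p - 1) : coind O (ctot G C _)) x (N, r - 1)) : coind N (C r)) y) -coind_sign.
Qed.

Lemma nval_map (F G : coindComplex sub) (C D : complex H) (f : chainMap C D) k
  (z : ctot F (ctot G C) k) O N r x y :
  nval (ctot_chainMap F (ctot_chainMap G f) k z) O N r x y = f r (nval z O N r x y).
Proof. by []. Qed.

End Nested.

(** * Contraction of both composites onto the identity *)

Section Reduction.
Variables (gT : finGroupType) (d : Order.disp_t) (S : finOrderType d) (s : S -> gT).
Hypothesis cox : coxeter_system s.
Variables (R : comPzRingType) (q : S -> R).
Hypothesis q_inv : forall i : S, exists r : R, q i * r = 1.
Hypothesis q_conj : forall (i j : S) (w : gT), s j = (s i ^ w)%g -> q i = q j.
Variables (H : pzRingType) (eta : {rmorphism R -> H}) (h : gT -> H).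
Hypothesis hecke : hecke_algebra s q eta h.
Local Notation l := (len s).
Local Notation rmin := (rmin cox).
Local Notation W_ := (parabolic s).
Local Notation star := (star cox).
Local Notation sub := (hecke_sub s eta h).
Local Notation coind J M := (@coind H (sub J) M).
Local Notation qw_inv := (qw_inv cox q_inv).
Local Notation linv := (longest_inv cox q_inv hecke).
Implicit Types (I J K O N : {set S}) (p r : int).

(* sw selects the order of composition: the traces are the inner functor for
   sw = false and the outer one for sw = true.  In the second case the elements
   of W are inverted, so that J (for the traces) always acts on the left and I
   (for the inclusions) on the right. *)
Variable sw : bool.
Local Notation trc := (trace_complex cox q_inv q_conj hecke).
Local Notation inc := (incl_complex s eta h).
Definition outer_cc : coindComplex sub := if sw then trc else inc.
Definition inner_cc : coindComplex sub := if sw then inc else trc.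
Local Notation T C := (ctot outer_cc (ctot inner_cc C)).

Section Operators.
Variable M : lmodType H.
Definition arg_op (a : H) (b : H -> M) : H -> M := fun x => b (a * x).
Definition act_op (a : H) (b : H -> M) : H -> M := fun x => a *: b x.
(** In a double coinduction the inner index acts on the values, while the outer one acts on the
    argument x because A acts on a coinduced module through the argument. *)
Definition opL j := if sw then arg_op (h (s j)) else act_op (h (s j)).
Definition opR i := if sw then act_op (h (s i)) else arg_op (h (s i)).
Definition oprho w := if sw then act_op (h w^-1%g * linv) else arg_op (linv * h w).
Definition opv v := if sw then (fun b x => eta (qw_inv v) *: arg_op (h v^-1%g) b x)
  else act_op (eta (qw_inv v) * h v).

(** Injectivity of [opR] comes from the units h (s i), and the rules for [oprho] from the
    commutation of the inverse of h_(w0) with the generators up to [star]. *)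
Lemma op_biaction : biaction cox opL opR oprho opv.
Proof.
have unit i : exists x, x * h (s i) = 1 /\ h (s i) * x = 1 by apply: (h_unit cox q_inv hecke).
have up i w : (l w < l (w * s i)%g)%N -> h (w * s i)%g = h w * h (s i).
  by move=> lt; rewrite (h_genM_up hecke (cox := cox)) // rdescN.
have upl i w : (l w < l (s i * w)%g)%N -> h (s i * w)%g = h (s i) * h w.
  by move=> lt; rewrite (gen_hM_up hecke (cox := cox)) // ldescN.
have upV i w : (l w < l (w * s i)%g)%N -> h (w * s i)^-1%g = h (s i) * h w^-1%g.
  move=> lt; rewrite invMg (gen_inv cox) upl // -[X in (X < _)%N](lenV cox) invgK.
  by rewrite -[X in (_ < X)%N](lenV cox) invMg invgK (gen_inv cox).
have uplV i w : (l w < l (s i * w)%g)%N -> h (s i * w)^-1%g = h w^-1%g * h (s i).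
  move=> lt; rewrite invMg (gen_inv cox) up // -[X in (X < _)%N](lenV cox) invgK.
  by rewrite -[X in (_ < X)%N](lenV cox) invMg invgK (gen_inv cox).
have starj j : h (s j) * linv = linv * h (s (star j)).
  by rewrite (longest_inv_gen cox q_inv hecke) starK.
rewrite /opL /opR /oprho /opv /arg_op /act_op /vzero; case: sw; split=> //.
- by move=> j; apply: funext => x; rewrite scaler0.
- by move=> j b; apply: funext => x; rewrite scalerN.
- by move=> j b b'; apply: funext => x; rewrite scalerDr.
- by move=> w b b'; apply: funext => x; rewrite scalerDr.
- move=> i b b' e; apply: funext => x; have [y [y1 _]] := unit i.
  by rewrite -[b x]scale1r -[b' x]scale1r -y1 -!scalerA (congr1 (fun f => f x) e).
- by move=> w; apply: funext => x; rewrite scaler0.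
- by move=> b; apply: funext => x; rewrite (longestV cox) (longest_invV cox q_inv hecke) scale1r.
- by move=> i w b lt; apply: funext => x; rewrite upV // scalerA mulrA.
- by move=> j w b lt; apply: funext => x; rewrite uplV // scalerA -mulrA starj mulrA.
- by move=> v; apply: funext => x; rewrite scaler0.
- move=> b; apply: funext => x.
  by rewrite invg1 (h1 hecke) mul1r qw_inv1 rmorph1 scale1r.
- by move=> j; apply: funext => x; rewrite scaler0.
- by move=> j b; apply: funext => x; rewrite scalerN.
- by move=> j b b'; apply: funext => x; rewrite scalerDr.
- move=> i b b' e; apply: funext => x; have [y [_ y2]] := unit i.
  by rewrite -[x]mul1r -y2 -mulrA (congr1 (fun f => f (y * x)) e).
- by move=> b; apply: funext => x; rewrite (longest_invK cox q_inv hecke) mul1r.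
- by move=> i w b lt; apply: funext => x; rewrite up // !mulrA.
- by move=> j w b lt; apply: funext => x; rewrite upl // !mulrA (longest_inv_gen cox).
- by move=> v; apply: funext => x; rewrite scaler0.
- move=> b; apply: funext => x.
  by rewrite (h1 hecke) qw_inv1 rmorph1 mul1r scale1r.
Qed.
End Operators.

(** The total complex multiplies the inner differential by the sign of the outer degree, so #|I|
    enters the signs of the traces, or #|J| those of the inclusions, according to [sw]. *)
Definition ckap J I j : nat := (if sw then 0 else #|I|) + nlt (J :\ j) j.
Definition ckap' J I i : nat := (if sw then #|J| else 0) + nlt I i.

Section SigLinear.
Variables M N : lmodType H.
Local Notation SigM := (sig cox ckap ckap' (@oprho M)).
Local Notation SigN := (sig cox ckap ckap' (@oprho N)).

Lemma sig_map (g : {linear M -> N}) (e : {set S} -> {set S} -> gT -> H -> M) J I w x :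
  SigN (fun J I w x => g (e J I w x)) J I w x = g (SigM e J I w x).
Proof.
rewrite /sig /vsign; case: (ups_pick _ _ _) => [j|].
  by case: ifP => _; rewrite /vzero ?linear0 ?linearZ.
case: (star_pick _ _) => [i|]; last by rewrite /vzero linear0.
case: ifP => _; last by rewrite /vzero linear0.
by rewrite linearZ /oprho; case: sw; rewrite /act_op /arg_op ?linearZ.
Qed.

(** The homotopy changes #|J| + #|I| by one. This makes the differential of C disappear from the
    flow, see [cell_flow]. *)
Lemma sig_sgn (e : {set S} -> {set S} -> gT -> H -> M) J I w x :
  SigM (fun J I w x => (-1) ^+ (#|J| + #|I|) *: e J I w x) J I w x =
  - ((-1) ^+ (#|J| + #|I|) *: SigM e J I w x).
Proof.
have rho_sign n b : oprho w (fun x => (-1) ^+ n *: b x : M) = fun x => (-1) ^+ n *: oprho w b x.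
  apply: funext => y; rewrite -signr_odd /oprho; case: (odd n); case: sw;
    by rewrite /act_op /arg_op ?expr0 ?expr1 ?scale1r ?scaleN1r ?scalerN.
rewrite /sig /vsign; case: (ups_pick _ _ _) => [j|].
  case: ifP => jJ; first by rewrite /vzero scaler0 oppr0.
  rewrite cardsU1 jJ add1n addSn exprS mulN1r scaleNr scalerN; congr (- _).
  by rewrite !scalerA -!exprD addnC.
case: (star_pick _ _) => [i|]; last by rewrite /vzero scaler0 oppr0.
case: ifP => iI; last by rewrite /vzero scaler0 oppr0.
rewrite rho_sign [in RHS](cardsD1 i I) iI add1n addnS exprS mulN1r scaleNr opprK.
by rewrite !scalerA -!exprD addnC.
Qed.
End SigLinear.

Section Cells.
Variable C : complex H.
Local Notation TC := (T C).

Definition cell k (z : TC k) r J I w (x : H) : C r :=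
  if sw then nval z J I r x (h w^-1%g) else nval z I J r x (h w).

Lemma len_updV i w : (l w < l (s i * w)%g)%N -> (l w^-1%g < l (w^-1 * s i)%g)%N.
Proof. by rewrite -(rdescN cox) -(ldescN cox) ?(rdescV cox) invgK. Qed.

Lemma len_updVr i w : (l w < l (w * s i)%g)%N -> (l w^-1%g < l (s i * w^-1)%g)%N.
Proof. by rewrite -(rdescN cox) -(ldescN cox). Qed.

Lemma cell_biequiv k (z : TC k) r : biequivs s (@opL (C r)) (@opR (C r)) (cell z r).
Proof.
move=> J I; rewrite /cell /opL /opR; case: sw; split=> [j w jJ lt|i w iI lt]; apply: funext => x.
- rewrite invMg (gen_inv cox) (nval_out cox hecke) //; exact: len_updV.
- rewrite invMg (gen_inv cox) (nval_in cox hecke) //; exact: len_updVr.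
- by rewrite (nval_in cox hecke).
- by rewrite (nval_out cox hecke).
Qed.

(** The part of the differential that moves J or I; the matching concerns this part alone. *)
Definition Th k n (z : TC k) r J I w (x : H) : C r :=
  cell (cdiff TC k n z) r J I w x -
  (-1) ^+ (#|J| + #|I|) *: cdiff C (r - 1) r (cell z (r - 1) J I w x).

Lemma cell_diff k (z : TC k) n r J I w x : cell (cdiff TC k n z) r J I w x =
  Th n z r J I w x + (-1) ^+ (#|J| + #|I|) *: cdiff C (r - 1) r (cell z (r - 1) J I w x).
Proof. by rewrite subrK. Qed.

Lemma Th_biequiv k n (z : TC k) r : biequivs s (@opL (C r)) (@opR (C r)) (Th n z r).
Proof.
move=> J I; have bi := op_biaction (C r).
have h1 := cell_biequiv (cdiff TC k n z) r J I.
have h2 : biequiv s (@opL (C r)) (@opR (C r)) J I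
    (fun w x => cdiff C (r - 1) r (cell z (r - 1) J I w x)).
  have [fl fr] := cell_biequiv z (r - 1) J I; rewrite /opL /opR in fl fr *.
  case: sw fl fr => fl fr; split=> [j w jJ lt|i w iI lt]; apply: funext => x;
    rewrite ?fl ?fr // /arg_op /act_op linearZ //.
have h3 := biequivD bi h1 (biequiv_sign bi (#|J| + #|I|).+1 h2).
suff -> : Th n z r J I = (fun w a => cell (cdiff TC k n z) r J I w a +
    vsign (#|J| + #|I|).+1 (fun x => cdiff C (r - 1) r (cell z (r - 1) J I w x)) a) by [].
by apply: funext => w; apply: funext => x; rewrite /vsign exprS mulN1r scaleNr.
Qed.

Lemma trace_diffE (M : lmodType H) (z : forall J, coind J M) J x :
  trace_diff cox q_inv q_conj hecke z J x =
  \sum_(j in J) (-1) ^+ nlt (J :\ j) j *: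
    \sum_(v in W_ J | rmin (J :\ j) v) (eta (qw_inv v) * h v) *: z (J :\ j) (h v^-1%g * x).
Proof. by rewrite coind_sumE; apply: eq_bigr => j _; rewrite coind_sign. Qed.

Lemma nval_at (F G : coindComplex sub) k (z : ctot F (ctot G C) k) O N r p x y :
  p = cc_deg G N + r ->
  (((z (O, p) : coind O (ctot G C p)) x) (N, r) : coind N (C r)) y = nval z O N r x y.
Proof. by move=> ->. Qed.

Lemma nval_etaL (F G : coindComplex sub) k (z : ctot F (ctot G C) k) O N r x a y :
  nval z O N r x (eta a * y) = eta a *: nval z O N r x y.
Proof. by rewrite /nval coindP //; apply: (sub_eta hecke). Qed.

Lemma incl_part (M : lmodType H) (z : forall J, coind J M) I x :
  cc_diff inc z I x = \sum_(i in ~: I) (-1) ^+ nlt I i *: z (i |: I) x.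
Proof. exact: incl_diffE. Qed.

Lemma trace_part (M : lmodType H) (z : forall J, coind J M) J x :
  cc_diff trc z J x = \sum_(j in J) (-1) ^+ nlt (J :\ j) j *:
    \sum_(v in W_ J | rmin (J :\ j) v) (eta (qw_inv v) * h v) *: z (J :\ j) (h v^-1%g * x).
Proof. exact: trace_diffE. Qed.

Lemma incl_deg i I : i \notin I -> cc_deg inc (i |: I) = cc_deg inc I - 1.
Proof. by move=> iI; rewrite /= cardsU1 iI PoszD opprD addrC. Qed.

Lemma trace_deg j J : j \in J -> cc_deg trc (J :\ j) = cc_deg trc J - 1.
Proof. by move=> jJ; rewrite /= (cardsD1 j J) jJ PoszD addrAC subrr add0r. Qed.

Lemma Th_spec k n (z : TC k) r : n = k + 1 ->
  Dspec cox ckap ckap' (@opv (C r)) (cell z r) (Th n z r).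
Proof.
move=> nk J I w x wJ; rewrite /Th /cell /ckap /ckap' /opv /arg_op /act_op.
move: z; rewrite /outer_cc /inner_cc; case: sw => z; rewrite (nval_diff _ _ _ _ _ _ nk).
- rewrite trace_part incl_part coind_sumE.
  rewrite [X in _ *: (_ + X)](_ : _ = (-1) ^+ #|I| *:
    cdiff C (r - 1) r (nval z J I (r - 1) x (h w^-1%g))); last first.
    by rewrite nval_at ?addrA //= abszN.
  rewrite scalerDr scalerA -exprD addrA addrK; congr (_ + _).
    apply: eq_bigr => j jJ; rewrite coind_sign add0n coind_sumE; congr (_ *: _).
    apply: eq_bigr => v /andP[vJ _]; rewrite coindZE coind_mapE.
    (* The trace is outer here, so its coefficient h_v multiplies the inner argument: w^-1 becomes
       w^-1 v, the inverse of v^-1 w, and lengths add because w is left J-minimal. *)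
    rewrite -[LHS]/(nval z (J :\ j) I r (h v^-1%g * x) (h w^-1%g * (eta (qw_inv v) * h v))).
    rewrite invMg invgK (eta_mulCA hecke) nval_etaL (h_mul hecke) //.
    rewrite -[LHS](lenV cox) invMg invgK (len_lminM wJ) ?groupV // addnC.
    by rewrite !(lenV cox).
  rewrite scaler_sumr; apply: eq_bigr => i; rewrite inE => iI.
  by rewrite scalerA -exprD nval_at // incl_deg // addrAC.
- rewrite incl_part trace_part coind_sumE.
  rewrite [X in _ *: (_ + X)](_ : _ = (-1) ^+ #|J| *:
    cdiff C (r - 1) r (nval z I J (r - 1) x (h w))); last first.
    by rewrite nval_at ?addrA //=.
  have eI : `|cc_deg inc I|%N = #|I| by rewrite /= abszN.
  rewrite eI scalerDr scalerA -exprD [(#|I| + #|J|)%N]addnC addrA addrK addrC.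
  congr (_ + _).
    rewrite scaler_sumr; apply: eq_bigr => j jJ; rewrite scalerA -exprD; congr (_ *: _).
    apply: eq_bigr => v /andP[vJ _]; congr (_ *: _).
    transitivity (nval z I (J :\ j) r x (h v^-1%g * h w)).
      by apply: nval_at; rewrite trace_deg // addrAC.
    by rewrite (h_mul hecke) // (len_lminM wJ) ?groupV.
  by apply: eq_bigr => i _; rewrite coind_sign.
Qed.
Local Notation nested_values := (nested_values outer_cc inner_cc).

Lemma outer_inner_deg O N : cc_deg outer_cc O + cc_deg inner_cc N =
  if sw then #|O|%:Z - #|N|%:Z else #|N|%:Z - #|O|%:Z.
Proof. by rewrite /outer_cc /inner_cc; case: sw => //=; rewrite addrC. Qed.

Lemma cell_off k (z : TC k) r J I w x : #|J|%:Z - #|I|%:Z + r != k -> cell z r J I w x = 0.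
Proof.
move=> ne; rewrite /cell.
have [e|e] := boolP sw; rewrite nval_off ?addrA ?outer_inner_deg ?e //.
by rewrite (negbTE e).
Qed.

Lemma cell_rlinear k (z : TC k) r J I w : rlinear eta (cell z r J I w).
Proof. by rewrite /cell; case: sw; apply: (nval_rlinear hecke). Qed.

Definition cells := forall r, {set S} -> {set S} -> gT -> H -> C r.

Definition val_of (e : cells) O N r w (x : H) : C r :=
  if sw then e r O N w^-1%g x else e r N O w x.

Lemma val_of_nested k (e : cells) :
  (forall r, biequivs s (@opL (C r)) (@opR (C r)) (e r)) ->
  (forall r J I w, rlinear eta (e r J I w)) ->
  (forall r J I w x, #|J|%:Z - #|I|%:Z + r != k -> e r J I w x = 0) ->
  nested_values k (val_of e).
Proof.
move=> be le oe; rewrite /val_of; split=> [O N r w|O N r j w x jN lt|O N r i w x iO lt|O N r w x].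
- by case: sw.
- move: be; rewrite /opL /opR; case: sw => be.
    have [_ fr] := be r O N; rewrite invMg (gen_inv cox) fr //.
    exact: len_updV.
  by have [fl _] := be r N O; rewrite fl.
- move: be; rewrite /opL /opR; case: sw => be.
    have [fl _] := be r O N; rewrite invMg (gen_inv cox) fl //.
    exact: len_updVr.
  by have [_ fr] := be r N O; rewrite fr.
- by rewrite addrA outer_inner_deg; case: sw; apply: oe.
Qed.

Lemma cell_build k (e : cells) (ne : nested_values k (val_of e)) r J I w x :
  cell (build cox hecke ne) r J I w x = e r J I w x.
Proof. by rewrite /cell !nval_build /val_of; case: sw; rewrite ?invgK. Qed.

Lemma cell_eq k (z z' : TC k) :
  (forall r J I w x, cell z r J I w x = cell z' r J I w x) -> z = z'.
Proof.
rewrite /cell => e; apply: (nval_eq hecke) => O N r x w; move: e; case: sw => e.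
  by have := e r O N w^-1%g x; rewrite invgK.
exact: e.
Qed.

Local Notation Sig r := (sig cox ckap ckap' (@oprho (C r))).

Lemma sig_shift r (e : {set S} -> {set S} -> gT -> H -> C r) a J I w x :
  Sig r (fun J I w x => e J I w (x * a)) J I w x = Sig r e J I w (x * a).
Proof.
rewrite /sig /vsign /vzero; case: (ups_pick _ _ _) => [j|]; first by case: ifP.
case: (star_pick _ _) => [i|] //; case: ifP => // _; congr (_ *: _).
by rewrite /oprho; case: sw; rewrite /arg_op /act_op ?mulrA.
Qed.

Lemma sig_rlinear r (e : {set S} -> {set S} -> gT -> H -> C r) :
  (forall J I w, rlinear eta (e J I w)) -> forall J I w, rlinear eta (Sig r e J I w).
Proof.
move=> le J I w; have l0 : rlinear eta (@vzero H H (C r)).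
  by split=> [x y|a x]; rewrite /vzero ?addr0 ?scaler0.
rewrite /sig; case: (ups_pick _ _ _) => [j|].
  by case: ifP => // _; apply: (rlinear_scale hecke).
case: (star_pick _ _) => [i|] //; case: ifP => // _; apply: (rlinear_scale hecke).
by rewrite /oprho; case: sw; [apply: (rlinear_scale hecke)|apply: (rlinear_mull hecke)].
Qed.

Lemma sig_off r (e : {set S} -> {set S} -> gT -> H -> C r) k :
  (forall J I w x, #|J|%:Z - #|I|%:Z + r != k -> e J I w x = 0) ->
  forall J I w x, #|J|%:Z - #|I|%:Z + r != k - 1 -> Sig r e J I w x = 0.
Proof.
move=> oe J I w x ne; have rho0 := bi_rho0 (op_biaction (C r)).
have z0 K (L : {set S}) v : #|K|%:Z - #|L|%:Z = #|J|%:Z - #|I|%:Z + 1 ->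
      e K L v = vzero (C r).
  move=> KL; apply: funext => y; apply: oe; rewrite KL; apply: contra ne => /eqP <-.
  by rewrite [X in _ == X - _]addrAC addrK.
rewrite /sig; case: (ups_pick _ _ _) => [j|].
  case: ifP => // jJ; rewrite z0 ?vsign0 //.
  by rewrite cardsU1 jJ PoszD -addrA addrC.
case: (star_pick _ _) => [i|] //; case: ifP => // iI; rewrite z0 ?rho0 ?vsign0 //.
by rewrite (cardsD1 i I) iI; lia.
Qed.

(** A homotopy is a family of maps between any two degrees; those that do not lower the degree by
    one are taken to be zero. *)
Definition sigma_cells k n (z : TC k) : cells := fun r J I w x =>
  if n == k - 1 then Sig r (cell z r) J I w x else 0.

Lemma sigma_nested k n (z : TC k) : nested_values n (val_of (sigma_cells n z)).
Proof.
apply: val_of_nested => [r|r J I w|r J I w x]; rewrite /sigma_cells; case: (n =P k - 1) => e //.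
- exact/(sig_biequiv _ _ (op_biaction (C r)))/cell_biequiv.
- by move=> J I; apply: (biequiv0 (op_biaction (C r))).
- exact/sig_rlinear/cell_rlinear.
- by split=> [x y|a x]; rewrite ?addr0 ?scaler0.
- by rewrite e => ne; apply: sig_off ne => *; apply: cell_off.
Qed.

Definition sigma_fun k n (z : TC k) : TC n := build cox hecke (sigma_nested n z).

Lemma cell_linear k a (z z' : TC k) r J I w x :
  cell (a *: z + z') r J I w x = cell z r J I w (x * a) + cell z' r J I w x.
Proof. by rewrite /cell; case: sw. Qed.

Fact sigma_linear k n : linear (@sigma_fun k n).
Proof.
move=> a z z'; apply: cell_eq => r J I w x; rewrite cell_linear !cell_build /sigma_cells.
case: eqP => _; last by rewrite addr0.
rewrite -sig_shift -(sigD _ _ (op_biaction (C r))); congr (Sig r _ J I w x).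
do 4!apply: funext => ?; exact: cell_linear.
Qed.
Definition sigma k n : {linear TC k -> TC n} :=
  HB.pack (@sigma_fun k n) (GRing.isLinear.Build H _ _ _ (@sigma_fun k n) (@sigma_linear k n)).

Lemma cell_sigma k (z : TC k) n r J I w x : n = k - 1 ->
  cell (sigma k n z) r J I w x = Sig r (cell z r) J I w x.
Proof. by move=> nk; rewrite cell_build /sigma_cells nk eqxx. Qed.

(** Transport between equal degrees, extended by zero. On the critical cell the index r is only
    provably equal to the total degree k. *)
Definition dcast k r (c : C k) : C r :=
  if @eqP _ k r is ReflectT e then ecast i (C i) e c else 0.

Lemma dcast_id k (c : C k) : dcast k c = c.
Proof. by rewrite /dcast; case: eqP => // e; rewrite (eq_axiomK e). Qed.
Lemma dcast_ne k r (c : C k) : k != r -> dcast r c = 0.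
Proof. by rewrite /dcast; case: eqP. Qed.
Lemma dcast_linear k r : linear (@dcast k r).
Proof.
move=> a c c'; have [<-|ne] := eqVneq k r; first by rewrite !dcast_id.
by rewrite !dcast_ne // scaler0 addr0.
Qed.
Lemma dcast_diff k r (c : C k) :
  cdiff C (r - 1) r (dcast (r - 1) c) = dcast r (cdiff C k (k + 1) c).
Proof.
have [<-|ne] := eqVneq (k + 1) r.
  by rewrite dcast_id; move: (addrK 1 k) => e; rewrite e dcast_id.
rewrite !dcast_ne ?linear0 //; apply: contra ne => /eqP ->.
by rewrite subrK.
Qed.

(** For J = I = S both coinductions are over H itself and give back C: the element c becomes the
    function (y x) c of y and x. *)
Definition iota_cells k (c : C k) : cells := fun r J I w x =>
  if (J == setT) && (I == setT) then ((if sw then h w^-1%g * x else h w * x) *: dcast r c) else 0.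

Lemma iota_nested k (c : C k) : nested_values k (val_of (iota_cells c)).
Proof.
have upl i w : (l w < l (s i * w)%g)%N -> h (s i * w)%g = h (s i) * h w.
  by move=> lt; rewrite (gen_hM_up hecke (cox := cox)) // ldescN.
have up i w : (l w < l (w * s i)%g)%N -> h (w * s i)%g = h w * h (s i).
  by move=> lt; rewrite (h_genM_up hecke (cox := cox)) // rdescN.
split=> [O N r w|O N r j w x jN lt|O N r i w x iO lt|O N r w x]; rewrite /val_of /iota_cells.
- split=> [x y|a x]; case: sw; case: ifP => _; rewrite ?addr0 ?scaler0 // ?invgK.
  + by rewrite mulrDr scalerDl.
  + by rewrite mulrDr scalerDl.
  + by rewrite (eta_mulCA hecke) scalerA.
  + by rewrite (eta_mulCA hecke) scalerA.
- by case: sw; case: ifP => _; rewrite ?scaler0 // ?invgK upl // scalerA mulrA.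
- by case: sw; case: ifP => _; rewrite ?scaler0 // ?invgK up // mulrA.
- have e : cc_deg outer_cc setT + cc_deg inner_cc setT = 0.
    by rewrite outer_inner_deg; case: sw; rewrite subrr.
  move=> ne; suff z0 : (O == setT) && (N == setT) -> dcast r c = 0.
    case: sw; case: ifP => // ee; rewrite z0 ?scaler0 //.
    by rewrite andbC.
  case/andP=> /eqP OT /eqP NT; rewrite dcast_ne //; apply: contra ne => /eqP <-.
  by rewrite addrA OT NT e add0r.
Qed.
Definition iota_fun k (c : C k) : TC k := build cox hecke (iota_nested c).
Fact iota_linear k : linear (@iota_fun k).
Proof.
move=> a c c'; apply: cell_eq => r J I w x; rewrite cell_linear !cell_build /iota_cells.
case: ifP => _; last by rewrite addr0.
by rewrite dcast_linear scalerDr scalerA; case: sw; rewrite mulrA.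
Qed.
Definition iota k : {linear C k -> TC k} :=
  HB.pack (@iota_fun k) (GRing.isLinear.Build H _ _ _ (@iota_fun k) (@iota_linear k)).

Lemma subT a : sub setT a.
Proof.
exists (coef hecke a); rewrite {1}(coefE hecke a); apply: eq_bigl => w.
by rewrite (parabolicT cox).
Qed.

Lemma nvalT k (z : TC k) r x y : nval z setT setT r x y = (y * x) *: nval z setT setT r 1 1.
Proof.
rewrite -[x in LHS]mulr1 /nval coindP; last exact: subT.
rewrite -[LHS]/((((z (setT, cc_deg inner_cc setT + r) : coind _ (ctot _ _ _)) 1) (setT, r)
  : coind setT (C r)) (y * x)).
by rewrite -[y * x in LHS]mulr1 coindP //; apply: subT.
Qed.

Lemma cellT k (z : TC k) r w x : cell z r setT setT w x =
  (if sw then h w^-1%g * x else h w * x) *: nval z setT setT r 1 1.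
Proof. by rewrite /cell; case: sw; apply: nvalT. Qed.

Definition pr_fun k (z : TC k) : C k := nval z setT setT k 1 1.
Fact pr_linear k : linear (@pr_fun k).
Proof. by move=> a z z'; rewrite /pr_fun nvalD nvalZ nvalT !mul1r. Qed.
Definition pr k : {linear TC k -> C k} :=
  HB.pack (@pr_fun k) (GRing.isLinear.Build H _ _ _ (@pr_fun k) (@pr_linear k)).

Local Notation flow := (flow sigma).
Local Notation flow_iter := (flow_iter sigma).

Lemma flowE k (z : TC k) : flow k z =
  z - (cdiff TC (k - 1) k (sigma k (k - 1) z) + sigma (k + 1) k (cdiff TC k (k + 1) z)).
Proof. by []. Qed.

Lemma cellD k (z z' : TC k) r J I w x : cell (z + z') r J I w x = cell z r J I w x + cell z' r J I w x.
Proof. by rewrite /cell; case: sw. Qed.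

Lemma cellN k (z : TC k) r J I w x : cell (- z) r J I w x = - cell z r J I w x.
Proof. by rewrite /cell; case: sw. Qed.

Lemma cell0 k r J I w x : cell (0 : TC k) r J I w x = 0.
Proof. by rewrite -(subrr 0) cellD cellN subrr. Qed.

Lemma cell_sigma_fun k (z : TC k) n r : n = k - 1 ->
  cell (sigma k n z) r = Sig r (cell z r).
Proof. by move=> nk; do 4!apply: funext => ?; apply: cell_sigma. Qed.

(** The contributions of the differential of C to the two composites cancel by [sig_map] and
    [sig_sgn]. What remains is the expression treated by [morse1] and [morse2]. *)
Lemma cell_flow k (z : TC k) r J I w x :
  cell (flow k z) r J I w x = cell z r J I w x -
    (Th k (sigma k (k - 1) z) r J I w x + Sig r (Th (k + 1) z r) J I w x).
Proof.
rewrite flowE cellD cellN cellD cell_diff; congr (_ - _); rewrite -addrA; congr (_ + _).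
rewrite (cell_sigma z (r - 1)) // (cell_sigma (cdiff TC k (k + 1) z)) ?addrK //.
rewrite -sig_map.
rewrite (_ : cell (cdiff TC k (k + 1) z) r = fun J I w x => Th (k + 1) z r J I w x +
  (-1) ^+ (#|J| + #|I|) *: cdiff C (r - 1) r (cell z (r - 1) J I w x)); last first.
  by do 4!apply: funext => ?; apply: cell_diff.
by rewrite (sigD _ _ (op_biaction (C r))) sig_sgn addrCA subrr addr0.
Qed.

Definition long_vanish k (z : TC k) := forall r, Klong cox (cell z r).
Definition filtered n k (z : TC k) := forall r, Fil cox n (cell z r).

Lemma long_vanishD k (z z' : TC k) : long_vanish z -> long_vanish z' -> long_vanish (z + z').
Proof.
move=> hz hz' r J I JI; apply: funext => x; rewrite cellD hz // hz' //.
exact: addr0.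
Qed.

Lemma long_vanishN k (z : TC k) : long_vanish z -> long_vanish (- z).
Proof.
move=> hz r J I JI; apply: funext => x; rewrite cellN hz //.
exact: oppr0.
Qed.

Lemma long_vanish0 k : long_vanish (0 : TC k).
Proof. by move=> r J I _; apply: funext => x; apply: cell0. Qed.

Lemma Th_long k n (z : TC k) r : n = k + 1 -> Klong cox (cell z r) -> Klong cox (Th n z r).
Proof.
move=> nk; exact: (Klong_D (op_biaction (C r)) (cell_biequiv z r) (Th_biequiv n z r)
  (Th_spec z r nk)).
Qed.

Lemma long_vanish_diff k n (z : TC k) : long_vanish z -> long_vanish (cdiff TC k n z).
Proof.
move=> Kz; have [nk|nk] := eqVneq n (k + 1); last by rewrite cdiff_shape //; apply: long_vanish0.
move=> r J I JI; apply: funext => x; rewrite cell_diff (Th_long nk (Kz r)) // Kz //.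
by rewrite /vzero linear0 scaler0 addr0.
Qed.

Lemma long_vanish_sigma k n (z : TC k) : n = k - 1 -> long_vanish z -> long_vanish (sigma k n z).
Proof.
move=> nk Kz r; rewrite cell_sigma_fun //.
exact: (Klong_sig _ _ (op_biaction (C r)) (Kz r)).
Qed.

Lemma long_vanish_flow k (z : TC k) : long_vanish z -> long_vanish (flow k z).
Proof.
move=> Kz; rewrite flowE; apply/(long_vanishD Kz)/long_vanishN/long_vanishD.
  exact/long_vanish_diff/long_vanish_sigma.
by apply: long_vanish_sigma; [rewrite addrK|apply: long_vanish_diff].
Qed.

Lemma flow_low n k (z : TC k) : (n < ranktop S)%N -> filtered n z -> filtered n.+1 (flow k z).
Proof.
move=> nt fz r; apply: (Fil_step_low (op_biaction (C r)) (cell_biequiv z r)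
  (Th_biequiv (k + 1) z r) (Th_biequiv k (sigma k (k - 1) z) r) (Th_spec z r _) _ _ (fz r)) => //.
- by rewrite -(cell_sigma_fun z r (erefl (k - 1))); apply: Th_spec; rewrite subrK.
- exact: cell_flow.
Qed.

Lemma flow_high n k (z : TC k) : long_vanish z -> filtered n z -> filtered n.+1 (flow k z).
Proof.
move=> Kz fz r; apply: (Fil_step_high (op_biaction (C r)) (cell_biequiv z r)
  (Th_spec z r (erefl (k + 1))) (Dse := Th k (sigma k (k - 1) z) r) _ _ (fz r)).
- by rewrite -(cell_sigma_fun z r (erefl (k - 1))); apply: Th_spec; rewrite subrK.
- exact: cell_flow.
- exact: long_vanish_flow.
Qed.

Lemma flow_iter_high n k (z : TC k) : long_vanish z ->
  long_vanish (flow_iter n k z) /\ filtered n (flow_iter n k z).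
Proof.
move=> Kz; elim: n => [|n [Kn fn]] /=; first by split=> // r; apply: Fil0.
by split; [apply: long_vanish_flow|apply: flow_high].
Qed.

Lemma flow_iter_low n k (z : TC k) : filtered (minn n (ranktop S)) (flow_iter n k z).
Proof.
elim: n => [|n IH] /=; first by rewrite min0n => r; apply: Fil0.
have [lt|le] := ltnP n (ranktop S).
  by rewrite (minn_idPl lt); apply: flow_low => //; move: IH; rewrite (minn_idPl (ltnW lt)).
rewrite (minn_idPr (leqW le)); move: IH; rewrite (minn_idPr le).
(* From here on the level is only preserved: it is lowered by one and regained by [flow_low]. Level
   0 is vacuous. *)
case E: (ranktop S) => [|t] fz r; first exact: Fil0.
rewrite -E in fz *; move: r; rewrite E; apply: flow_low; first by rewrite E.
by move=> r; apply: FilW (fz r); rewrite E.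
Qed.

Local Notation rkm := (rankmax s).

Lemma flow_iter_long k (z : TC k) : long_vanish z -> flow_iter rkm k z = 0.
Proof.
move=> /(flow_iter_high rkm)[Kz fz]; apply: cell_eq => r J I w x; rewrite cell0.
by rewrite (Fil_max (op_biaction (C r)) _ _ _ (cell_biequiv _ r) (Kz r) (fz r)).
Qed.

Lemma cell_iota k (c : C k) r J I w x : cell (iota k c) r J I w x = iota_cells c r J I w x.
Proof. exact: cell_build. Qed.

Lemma iota_top k (c : C k) r : top_supported (cell (iota k c) r).
Proof.
move=> J I w JI; apply: funext => x; rewrite cell_iota /iota_cells.
by move: JI; case: eqP => //= _; case: eqP => //= _ [].
Qed.

Lemma long_vanish_iota k n (c : C k) :
  long_vanish (cdiff TC k n (iota k c) - iota n (cdiff C k n c)).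
Proof.
have [->|nk] := eqVneq n (k + 1); last first.
  by rewrite !cdiff_shape // linear0 subrr; apply: long_vanish0.
move=> r J I JI; apply: funext => x; rewrite cellD cellN cell_diff.
have -> : Th (k + 1) (iota k c) r J I (longest s) = vzero (C r).
  apply: (top_D (op_biaction (C r)) _ _ (Th_spec (iota k c) r (erefl _))) => //.
  - exact: cell_biequiv.
  - exact: Th_biequiv.
  - exact: iota_top.
rewrite /vzero add0r !cell_iota /iota_cells; case: ifP => [/andP[/eqP -> /eqP ->]|_].
  by rewrite -signr_odd addnn odd_double scale1r linearZ dcast_diff subrr.
by rewrite linear0 scaler0 subrr.
Qed.

Lemma pr_iota k (c : C k) : pr k (iota k c) = c.
Proof.
rewrite -[pr k _]/(nval _ _ _ _ _ _) -(h1 hecke) nval_build /val_of /iota_cells.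
by case: sw; rewrite eqxx /= dcast_id ?invg1 (h1 hecke) mulr1 scale1r.
Qed.

(** The hypothesis concerns the value at w0; choosing the argument inverse to h_(w0) turns it into
    the value at 1, which is [pr]. *)
Lemma long_vanish_pr k (z : TC k) : long_vanish z -> pr k z = 0.
Proof.
move=> Kz; have := Kz k setT setT (subsetT _); rewrite -[pr k z]/(nval _ _ _ _ _ _) => e.
have e' x := congr1 (fun f => f x) e; move: e' => {e}.
have [y yE] : exists y, (if sw then h (longest s)^-1%g * y else h (longest s) * y) = 1.
  exists linv; rewrite (longestV cox).
  by case: sw; rewrite (longest_invV cox q_inv hecke).
by move=> /(_ y); rewrite cellT yE scale1r.
Qed.

(** Since [rankmax] exceeds [ranktop], the only cell over a coset w0 W_I that can survive is J = I =
    S, where the value at 1 determines everything and only r = k is possible. *)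
Lemma long_vanish_im k (z : TC k) (n := rkm) :
  long_vanish (flow_iter n k z - iota k (pr k (flow_iter n k z))).
Proof.
have := flow_iter_low n z; rewrite (minn_idPr _); last by rewrite /n /rankmax leqW ?leq_addr.
set z' := flow_iter n k z => fz r J I JI; apply: funext => x.
rewrite cellD cellN cell_iota /iota_cells /vzero.
have [JT|JT] := eqVneq J setT; last by rewrite (Fil_long (fz r)) //= subr0.
rewrite (star_T JI JT) JT eqxx /=; have [<-|kr] := eqVneq k r.
  by rewrite dcast_id cellT subrr.
by rewrite dcast_ne // scaler0 subr0 cell_off // subrr add0r eq_sym.
Qed.

Lemma sigma_iota k n (c : C k) : sigma k n (iota k c) = 0.
Proof.
apply: cell_eq => r J I w x; rewrite cell0 cell_build /sigma_cells; case: eqP => // _.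
by rewrite (top_sig _ _ (op_biaction (C r)) _ _ _ (@iota_top k c r)).
Qed.

(** [sigma] kills the image of [iota], hence sends the differential of iota c to its value on an
    element of [long_vanish]. So the flow fixes iota c modulo [long_vanish]. *)
Lemma flow_iter_iota n k (c : C k) : long_vanish (flow_iter n k (iota k c) - iota k c).
Proof.
elim: n => [|n IH]; first by rewrite subrr; apply: long_vanish0.
set z := flow_iter n k (iota k c) in IH.
have -> : flow_iter n.+1 k (iota k c) - iota k c =
    flow k (z - iota k c) + (flow k (iota k c) - iota k c).
  by rewrite linearB addrA subrK.
apply: long_vanishD; first exact: long_vanish_flow.
rewrite flowE sigma_iota linear0 add0r addrAC subrr add0r.
apply: long_vanishN; rewrite -[X in long_vanish X]subr0 -(sigma_iota k (cdiff C k (k + 1) c)).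
rewrite -linearB; apply: long_vanish_sigma; first by rewrite addrK.
exact: long_vanish_iota.
Qed.

Lemma pr_flow n k (c : C k) : pr k (flow_iter n k (iota k c)) = c.
Proof.
rewrite -[X in pr k X](subrK (iota k c)) linearD pr_iota.
by rewrite (long_vanish_pr (flow_iter_iota n c)) add0r.
Qed.

Definition collapse_in : chainMap C TC :=
  red_in (sigma := sigma) long_vanish_iota flow_iter_long.
Definition collapse_out : chainMap TC C :=
  red_out long_vanish_diff long_vanish_iota long_vanish_im pr_iota long_vanish_pr.

End Cells.

Section Naturality.
Variables (C D : complex H) (f : chainMap C D).
Local Notation Tf := (ctot_chainMap outer_cc (ctot_chainMap inner_cc f)).

Lemma cell_map k (z : T C k) r J I w x : cell (Tf k z) r J I w x = f r (cell z r J I w x).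
Proof. by rewrite /cell; case: ifP => _; apply: nval_map. Qed.

Lemma sigma_map k n (z : T C k) : sigma D k n (Tf k z) = Tf n (sigma C k n z).
Proof.
apply: cell_eq => r J I w x; rewrite cell_map !cell_build /sigma_cells.
case: eqP => _; last by rewrite linear0.
rewrite -sig_map; congr (sig cox ckap ckap' _ _ J I w x).
do 4!apply: funext => ?; exact: cell_map.
Qed.

Lemma flow_map k (z : T C k) : flow (sigma D) k (Tf k z) = Tf k (flow (sigma C) k z).
Proof. by rewrite !flowE sigma_map -!cmapE sigma_map linearB [in RHS](linearD (Tf k)). Qed.

Lemma flow_iter_map n k (z : T C k) :
  flow_iter (sigma D) n k (Tf k z) = Tf k (flow_iter (sigma C) n k z).
Proof.
elim: n => // n IH; rewrite -[LHS]/(flow (sigma D) k (flow_iter _ n k _)) IH.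
exact: flow_map.
Qed.
End Naturality.

Theorem collapse_iso :
  naturally_isomorphic (comp_functor (ctot_functor outer_cc) (ctot_functor inner_cc))
    (id_functor (homotopy_category H)).
Proof.
exists (collapse_out), (collapse_in); split=> [C D f|C|C].
- apply: eq_homotopic => k z.
  rewrite -[LHS]/(pr D k (flow_iter (sigma D) (rankmax s) k
    (ctot_chainMap outer_cc (ctot_chainMap inner_cc f) k z))) flow_iter_map.
  exact: nval_map.
- exact: red_inK.
- apply: red_outK; exact: pr_flow.
Qed.
End Reduction.

(** * Finite generation *)

Section FinitelyGenerated.
Variable A : pzRingType.

Lemma finitely_generatedP (T : finType) (M : lmodType A) (g : T -> M) :
  (forall x, exists c : T -> A, x = \sum_t c t *: g t) -> finitely_generated M.
Proof.
move=> gen; exists #|T|, (g \o enum_val) => x; have [c ->] := gen x.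
exists (c \o enum_val); rewrite (reindex_onto (@enum_val T T) enum_rank) /=.
  by apply: eq_bigl => i; rewrite enum_valK eqxx.
by move=> t _; apply: enum_rankK.
Qed.

Lemma finitely_generated_sum (T : finType) (M : lmodType A) (N : T -> lmodType A)
    (i : forall t, {linear N t -> M}) :
  (forall t, finitely_generated (N t)) ->
  (forall x, exists y : forall t, N t, x = \sum_t i t (y t)) -> finitely_generated M.
Proof.
move=> fgN dec; pose n t := projT1 (cid (fgN t)).
have fg1 t : exists g : 'I_(n t) -> N t, forall x, exists c : 'I_(n t) -> A, x = \sum_k c k *: g k.
  exact: projT2 (cid (fgN t)).
pose g t := projT1 (cid (fg1 t)); have gP t : forall x, exists c, x = \sum_k c k *: g t k.
  exact: projT2 (cid (fg1 t)).
apply: (@finitely_generatedP {t : T & 'I_(n t)} _ (fun p => i (tag p) (g (tag p) (tagged p)))) => x.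
have [y ->] := dec x; pose c t := projT1 (cid (gP t (y t))).
have cP t : y t = \sum_k c t k *: g t k by exact: projT2 (cid (gP t (y t))).
exists (fun p => c (tag p) (tagged p)).
transitivity (\sum_t \sum_k c t k *: i t (g t k)); last by rewrite sig_big_dep.
apply: eq_bigr => t _; rewrite {1}cP linear_sum; apply: eq_bigr => k _.
exact: linearZ.
Qed.

Lemma finitely_generated_iso (M N : lmodType A) (f : {linear M -> N}) (g : N -> M) :
  cancel f g -> cancel g f -> finitely_generated N -> finitely_generated M.
Proof.
move=> fK gK [n [e gen]]; exists n, (g \o e) => x; have [c fx] := gen (f x).
exists c; apply: (can_inj fK); rewrite fx linear_sum; apply: eq_bigr => i _.
by rewrite linearZ /= gK.
Qed.

Lemma bounded_fg_iso (C D : complex A) (f : chainMap C D) (g : forall k, D k -> C k) :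
  (forall k, cancel (f k) (g k)) -> (forall k, cancel (g k) (f k)) ->
  bounded_fg D -> bounded_fg C.
Proof.
move=> fK gK [[m bD] fgD]; split=> [|k]; last exact: finitely_generated_iso (fK k) (gK k) (fgD k).
exists m => k km x; apply: (can_inj (fK k)); rewrite linear0.
exact: bD.
Qed.
End FinitelyGenerated.

Section BoundedTot.
Variables (A : pzRingType) (T : finType) (P : T -> A -> Prop) (F : coindComplex P).
Local Notation deg := (cc_deg F).

Definition ctot_inj_fun (C : complex A) k t (z : coind (P t) (C (k - deg t))) (p : T * int) :
    coind (P p.1) (C p.2) :=
  if @eqP _ (t, k - deg t) p is ReflectT e then ecast p (coind (P p.1) (C p.2)) e z else 0.

Fact ctot_inj_off (C : complex A) k t z p : ~~ (deg p.1 + p.2 == k) -> @ctot_inj_fun C k t z p = 0.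
Proof. by rewrite /ctot_inj_fun; case: eqP => // e /negP[]; rewrite -e addrC subrK. Qed.

Definition ctot_inj (C : complex A) k t z : ctot F C k :=
  DSum (@ctot_inj_off C k t z) (off_fin (@ctot_inj_off C k t z)).

Lemma ctot_inj_id (C : complex A) k t (z : coind (P t) (C (k - deg t))) :
  (ctot_inj z (t, k - deg t) : coind (P t) (C (k - deg t))) = z.
Proof.
rewrite -[LHS]/(ctot_inj_fun z (t, k - deg t)) /ctot_inj_fun; case: eqP => // e.
by rewrite (eq_axiomK e).
Qed.

Lemma ctot_inj_ne (C : complex A) k t z p : (t, k - deg t) != p -> @ctot_inj C k t z p = 0.
Proof. by rewrite -[X in _ -> X = _]/(ctot_inj_fun z p) /ctot_inj_fun; case: eqP. Qed.

Fact ctot_inj_linear (C : complex A) k t : linear (@ctot_inj C k t).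
Proof.
move=> a x y; apply: dsumP => p; rewrite dsumD dsumZ.
have [<-|ne] := eqVneq (t, k - deg t) p; first by rewrite !ctot_inj_id.
by rewrite !ctot_inj_ne // scaler0 addr0.
Qed.
Definition ctot_in (C : complex A) k t : {linear coind (P t) (C (k - deg t)) -> ctot F C k} :=
  HB.pack (@ctot_inj C k t) (GRing.isLinear.Build A _ _ _ (@ctot_inj C k t) (@ctot_inj_linear C k t)).

Lemma ctot_sum (C : complex A) k (z : ctot F C k) :
  z = \sum_t ctot_in C k t (z (t, k - deg t) : coind (P t) (C (k - deg t))).
Proof.
apply: dsumP => -[t r].
rewrite (big_morph (fun z : ctot F C k => z (t, r)) (id1 := 0) (op1 := +%R)) //.
have [<-|ne] := eqVneq (k - deg t) r.
  rewrite (bigD1 t) // big1 => [|u ut].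
    by rewrite -[RHS]/(_ + 0) addr0 -[RHS]/(ctot_inj (z (t, k - deg t) : coind (P t) (C (k - deg t))) _) ctot_inj_id.
  by apply: ctot_inj_ne; rewrite xpair_eqE (negbTE ut).
rewrite dsum_off ?big1 // => [u _|/=].
  by apply: ctot_inj_ne; rewrite xpair_eqE; case: eqP => // ->.
by apply: contra ne => /eqP <-; rewrite addrAC subrr add0r.
Qed.

Lemma ctot_bounded_fg (C : complex A) :
  (forall t M, finitely_generated M -> finitely_generated (coind (P t) M : lmodType A)) ->
  bounded_fg C -> bounded_fg (ctot F C).
Proof.
move=> fgP [[m bC] fgC]; split=> [|k]; last first.
  apply: (@finitely_generated_sum _ _ _ (fun t => coind (P t) (C (k - deg t)) : lmodType A)
    (ctot_in C k)) => [t|z]; first exact: fgP.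
  by exists (fun t => z (t, k - deg t) : coind (P t) (C (k - deg t))); apply: ctot_sum.
(* In a nonzero component |r| <= m, so |k| <= m + |deg t|; the sum over all t makes the bound
   uniform. *)
exists (m + \sum_t `|deg t|) => k km z; apply: dsumP => -[t r].
have [e|ne] := eqVneq (deg t + r) k; last by rewrite dsum_off.
apply: coind_eq => x; apply: bC; rewrite -e in km.
have le : `|deg t| <= \sum_u `|deg u|.
  by rewrite (bigD1 t) //= lerDl; apply: sumr_ge0 => u _.
rewrite -(ltrD2r (\sum_u `|deg u|)); apply: lt_le_trans km _.
by apply: le_trans (ler_normD _ _) _; rewrite addrC lerD2l.
Qed.
End BoundedTot.

(** * Natural isomorphisms and restriction to full subcategories *)

Section Categories.
Variables C D E : category.

Lemma natural_iso_trans (F G K : functor C D) : naturally_isomorphic F G ->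
  naturally_isomorphic G K -> naturally_isomorphic F K.
Proof.
move=> [a [b [na ba ab]]] [a' [b' [na' ba' ab']]].
exists (fun x => comp (a' x) (a x)), (fun x => comp (b x) (b' x)); split=> [x y f|x|x].
- apply: heq_trans (heq_sym (compA _ _ _)) _.
  apply: heq_trans (heq_comp (heq_refl _) (na _ _ f)) _.
  apply: heq_trans (compA _ _ _) _.
  apply: heq_trans (heq_comp (na' _ _ f) (heq_refl _)) _.
  exact: heq_sym (compA _ _ _).
- apply: heq_trans (heq_sym (compA _ _ _)) _.
  apply: heq_trans (heq_comp (heq_refl _) (compA _ _ _)) _.
  apply: heq_trans (heq_comp (heq_refl _) (heq_comp (ba' x) (heq_refl _))) _.
  by apply: heq_trans (heq_comp (heq_refl _) (comp1m _)) _.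
- apply: heq_trans (heq_sym (compA _ _ _)) _.
  apply: heq_trans (heq_comp (heq_refl _) (compA _ _ _)) _.
  apply: heq_trans (heq_comp (heq_refl _) (heq_comp (ab x) (heq_refl _))) _.
  by apply: heq_trans (heq_comp (heq_refl _) (comp1m _)) _.
Qed.

Lemma natural_iso_compl (K : functor D E) (F G : functor C D) : naturally_isomorphic F G ->
  naturally_isomorphic (comp_functor K F) (comp_functor K G).
Proof.
move=> [a [b [na ba ab]]]; exists (fun x => fhom K (a x)), (fun x => fhom K (b x)).
split=> [x y f|x|x] /=.
- apply: heq_trans (heq_sym (fhomM K _ _)) _.
  by apply: heq_trans (fhom_heq K (na _ _ f)) _; apply: fhomM.
- apply: heq_trans (heq_sym (fhomM K _ _)) _.
  by apply: heq_trans (fhom_heq K (ba x)) _; apply: fhom1.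
- apply: heq_trans (heq_sym (fhomM K _ _)) _.
  by apply: heq_trans (fhom_heq K (ab x)) _; apply: fhom1.
Qed.

Lemma natural_iso_compr (K : functor C D) (F G : functor D E) : naturally_isomorphic F G ->
  naturally_isomorphic (comp_functor F K) (comp_functor G K).
Proof.
move=> [a [b [na ba ab]]]; exists (fun x => a (K x)), (fun x => b (K x)).
by split=> [x y f|x|x]; [apply: na|apply: ba|apply: ab].
Qed.
End Categories.

Lemma restrict_equivalence (C D : category) (P : C -> Prop) (Q : D -> Prop)
    (F : functor C D) (G : functor D C) (PQ : forall a, P a -> Q (F a)) :
  (forall a, Q a -> P (G a)) ->
  naturally_isomorphic (comp_functor G F) (id_functor C) ->
  naturally_isomorphic (comp_functor F G) (id_functor D) ->
  is_equivalence (restrict PQ).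
Proof.
move=> QP [a [b [na ba ab]]] [a' [b' [na' ba' ab']]]; exists (restrict QP); split.
  exists (fun x : full_subcategory P => a (sval x)), (fun x => b (sval x)).
  by split=> [x y f|x|x]; [apply: na|apply: ba|apply: ab].
exists (fun x : full_subcategory Q => a' (sval x)), (fun x => b' (sval x)).
by split=> [x y f|x|x]; [apply: na'|apply: ba'|apply: ab'].
Qed.

Section CoindFG.
Variables (gT : finGroupType) (d : Order.disp_t) (S : finOrderType d) (s : S -> gT).
Hypothesis cox : coxeter_system s.
Variables (R : comPzRingType) (q : S -> R).
Hypothesis q_inv : forall i : S, exists r : R, q i * r = 1.
Hypothesis q_conj : forall (i j : S) (w : gT), s j = (s i ^ w)%g -> q i = q j.
Variables (H : pzRingType) (eta : {rmorphism R -> H}) (h : gT -> H).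
Hypothesis hecke : hecke_algebra s q eta h.
Local Notation sub := (hecke_sub s eta h).

(** In the language of H (x)_(H_J) M, every element is a combination of elements 1 (x) m. Writing m
    through the g_k with coefficients in the basis h_u, the central scalars from R move to the left
    and leave the finitely many 1 (x) h_u g_k. *)
Lemma coind_finitely_generated J (M : lmodType H) : finitely_generated M ->
  finitely_generated (coind (sub J) M : lmodType H).
Proof.
move=> [n [g gen]].
apply: (@finitely_generatedP _ (gT * 'I_n)%type _
  (fun p => ind_elt cox hecke J 1 (h p.1 *: g p.2) : coind (sub J) M)) => f.
have [c cE] := choice (fun v : gT => gen (f (h v^-1%g))).
exists (fun p => \sum_(v | rmin cox J v)
  (eta (qw_inv cox q_inv v) * h v) * eta (coef hecke (c v p.2) p.1)).
rewrite (ind_expand cox q_inv q_conj hecke f).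
under [RHS]eq_bigr => p _ do rewrite scaler_suml.
rewrite [RHS]exchange_big; apply: eq_bigr => v _ /=; rewrite cE.
apply: coind_eq => x; rewrite coind_sumE /= scaler_sumr.
pose F u k := proj hecke J (x * (eta (qw_inv cox q_inv v) * h v * eta (coef hecke (c v k) u)) * 1)
  *: (h u *: g k).
transitivity (\sum_u \sum_k F u k); last by rewrite pair_bigA.
rewrite exchange_big; apply: eq_bigr => k _ /=.
rewrite {1}(coefE hecke (c v k)) [X in _ *: X = _]scaler_suml scaler_sumr; apply: eq_bigr => u _.
rewrite /F mulr1; set r := coef hecke _ u.
rewrite [x * (_ * eta r)]mulrA -[_ * eta r](hecke_central hecke) (proj_rlinear hecke J).2.
by rewrite !scalerA mulrA -[eta r *: _]/(eta r * _) (hecke_central hecke r).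
Qed.

End CoindFG.

Theorem theorem19 (gT : finGroupType) (d : Order.disp_t) (S : finOrderType d)
    (s : S -> gT) (cox : coxeter_system s)
    (R : comPzRingType) (q : S -> R)
    (q_inv : forall i : S, exists r : R, (q i * r = 1)%R)
    (q_conj : forall (i j : S) (w : gT), s j = (s i ^ w)%g -> q i = q j)
    (H : pzRingType) (eta : {rmorphism R -> H}) (h : gT -> H)
    (hecke : hecke_algebra s q eta h) :
  exists fg : forall C : complex H,
      bounded_fg C -> bounded_fg (tens_complex (X_complex s eta h) C),
    is_equivalence
      (restrict (F := tens_functor (X_complex s eta h)) fg : functor (Kb H) (Kb H)).
Proof.
have fg_coind := coind_finitely_generated cox q_inv q_conj hecke.
have fgX C : bounded_fg C -> bounded_fg (tens_complex (X_complex s eta h) C).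
  move=> fgC; apply: (bounded_fg_iso (f := phi_map cox q_inv q_conj hecke C)
    (@phiK _ _ _ _ cox _ _ q_inv q_conj _ _ _ hecke C)
    (@psiK _ _ _ _ cox _ _ q_inv q_conj _ _ _ hecke C)).
  exact: ctot_bounded_fg.
exists fgX; have trX := tens_trace_iso cox q_inv q_conj hecke.
refine (restrict_equivalence (F := tens_functor (X_complex s eta h))
  (G := ctot_functor (incl_complex s eta h)) fgX _ _ _) => [C fgC||].
- exact: ctot_bounded_fg.
- apply: natural_iso_trans (natural_iso_compl _ trX) _.
  exact: (collapse_iso cox q_inv q_conj hecke false).
- apply: natural_iso_trans (natural_iso_compr _ trX) _.
  exact: (collapse_iso cox q_inv q_conj hecke true).
Qed.
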